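(* Let $d$ be an odd positive integer, let $k$ be a field, let $A$ be a basic finite dimensional $k$-algebra that is twisted $(d+2)$-periodic with respect to an algebra automorphism $\sigma$ of $A$, and endow $\operatorname{proj}A$ with the Amiot--Lin $(d+2)$-angulated category structure. There is a bijective correspondence between: (1) $\mathbb{S}_d$-invariant additive functions $\alpha$ on $\operatorname{mod}(\operatorname{proj}A)$; (2) rank functions $\rho_{\mathrm m}$ on morphisms in $\operatorname{proj}A$. It is given by the following well-defined, mutually inverse assignments: to $\alpha$ assign $\varphi(\alpha)$, where $\varphi(\alpha)(f)=\alpha\big(\operatorname{Im}(\operatorname{Hom}_A(-,f)|_{\operatorname{proj}A})\big)$ for each morphism $f$ in $\operatorname{proj}A$; to $\rho_{\mathrm m}$ assign $\psi(\rho_{\mathrm m})$, where $\psi(\rho_{\mathrm m})(M)=\rho_{\mathrm m}(f)$ for any morphism $f$ in $\operatorname{proj}A$ with $M\cong\operatorname{Im}(\operatorname{Hom}_A(-,f)|_{\operatorname{proj}A})$. Moreover, the correspondence restricts to a bijection between $\mathbb{S}_d$-invariant integral additive functions on $\operatorname{mod}(\operatorname{proj}A)$ and integral rank functions on morphisms in $\operatorname{proj}A$. Furthermore, it restricts to a bijection between $\mathbb{S}_d$-irreducible additive functions on $\operatorname{mod}(\operatorname{proj}A)$ and irreducible rank functions on morphisms in $\operatorname{proj}A$.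
   Context: Amiot--Lin structure. $\operatorname{mod}A$ is the category of finite dimensional right $A$-modules and $\operatorname{proj}A$ its full subcategory of projective modules. For an algebra automorphism $\tau$ of $A$, ${}_{\tau}A_1$ is the $A$-bimodule with underlying space $A$, left action $a\cdot x=\tau(a)x$ and right action $x\cdot b=xb$. $A$ is twisted $(d+2)$-periodic with respect to $\sigma$ if the $(d+2)$-th syzygy of $A$ as an $A$-bimodule is isomorphic to ${}_{\sigma^{-1}}A_1$. Then $A$ is selfinjective and there is an exact sequence of finite dimensional $A$-bimodules $\theta\colon 0\to{}_{\sigma^{-1}}A_1\to P_{d+1}\to\cdots\to P_1\to P_0\to A\to0$ with each $P_i$ projective-injective; fix it. The functors $\Sigma_d=-\otimes_A{}_\sigma A_1$ and $\Sigma_d^{-1}=-\otimes_A{}_{\sigma^{-1}}A_1$ are exact, mutually quasi-inverse on $\operatorname{mod}A$, and restrict to $\operatorname{proj}A$. A sequence $X_0\xrightarrow{x_0}X_1\xrightarrow{x_1}\cdots\to X_{d+1}\xrightarrow{x_{d+1}}\Sigma_dX_0$ in $\operatorname{proj}A$ is a $(d+2)$-angle if: (C1) $X_0\xrightarrow{x_0}X_1\to\cdots\to X_{d+1}\xrightarrow{x_{d+1}}\Sigma_dX_0\xrightarrow{\Sigma_dx_0}\Sigma_dX_1$ is exact in $\operatorname{mod}A$; (C2) writing $p\colon\Sigma_dX_0\to C$ for the cokernel of $x_{d+1}$, there is $i\colon\Sigma_d^{-1}C\to X_1$ such that $x_0$ is the composition $X_0\cong\Sigma_d^{-1}\Sigma_dX_0\xrightarrow{\Sigma_d^{-1}p}\Sigma_d^{-1}C\xrightarrow{i}X_1$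 and $0\to\Sigma_d^{-1}C\xrightarrow{i}X_1\xrightarrow{x_1}\cdots\to X_{d+1}\xrightarrow{x_{d+1}}\Sigma_dX_0\xrightarrow{p}C\to0$ is exact, and this exact sequence is equivalent in $\operatorname{Ext}_A^{d+2}(C,\Sigma_d^{-1}C)$ to the (exact) sequence $C\otimes_A\theta$. It is known (Amiot, Lin) that with these $(d+2)$-angles $(\operatorname{proj}A,\Sigma_d)$ is a $(d+2)$-angulated category in the sense of Geiss--Keller--Oppermann. Functor category. Put $\mathcal{C}=\operatorname{proj}A$. $\operatorname{mod}\mathcal{C}=\operatorname{mod}(\operatorname{proj}A)$ is the abelian category of finitely presented additive functors $\mathcal{C}^{\mathrm{op}}\to\mathrm{Ab}$ (those $M$ admitting an exact sequence $\mathcal{C}(-,X)\to\mathcal{C}(-,Y)\to M\to0$). $\mathbb{S}_d$ is the exact autoequivalence $M\mapsto M\circ\Sigma_d^{-1}$ of $\operatorname{mod}\mathcal{C}$. Additive functions. An additive function $\alpha$ on an essentially small abelian category $\mathcal{A}$ assigns to each object a nonnegative real number, is constant on isomorphism classes, and satisfies $\alpha(B)=\alpha(B')+\alpha(B'')$ for each short exact sequence $0\to B'\to B\to B''\to0$. It is integral if it has integer values. An additive function on $\operatorname{mod}\mathcal{C}$ is $\mathbb{S}_d$-invariant if $\alpha(\mathbb{S}_dM)=\alpha(M)$ for all $M$. It is $\mathbb{S}_d$-irreducible if it is nonzero, integral, $\mathbb{S}_d$-invariant and whenever $\alpha=\alpha_1+\alpha_2$ with $\alpha_1,\alpha_2$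 integral $\mathbb{S}_d$-invariant additive functions, then $\alpha_1=0$ or $\alpha_2=0$. Rank functions. A rank function on morphisms $\rho_{\mathrm m}$ in $\mathcal{C}$ assigns to each morphism $f$ a nonnegative real number such that: (RM0) $\rho_{\mathrm m}(f)=\rho_{\mathrm m}(g)$ whenever there are isomorphisms $\psi,\varphi$ with $\varphi f=g\psi$; (RM1) $\rho_{\mathrm m}(f\oplus g)=\rho_{\mathrm m}(f)+\rho_{\mathrm m}(g)$; (RM2) $\rho_{\mathrm m}(f)-\rho_{\mathrm m}(1_Y)+\rho_{\mathrm m}(g)=0$ for each pair of consecutive morphisms $X\xrightarrow{f}Y\xrightarrow{g}Z$ in a $(d+2)$-angle; (RM3) $\rho_{\mathrm m}(\Sigma_df)=\rho_{\mathrm m}(f)$. It is integral if it has integer values. Sums are pointwise. It is irreducible if it is nonzero, integral and whenever $\rho_{\mathrm m}=\rho_{\mathrm m,1}+\rho_{\mathrm m,2}$ with integral rank functions on morphisms, then $\rho_{\mathrm m,1}=0$ or $\rho_{\mathrm m,2}=0$. *)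

(* Defs.v *)
From HB Require Import structures.
From mathcomp Require Import all_boot all_order all_algebra falgebra.
From mathcomp Require Import boolp reals.
From Stdlib Require Import Relation_Operators.

Set Implicit Arguments.
Unset Strict Implicit.
Unset Printing Implicit Defensive.

Import GRing.Theory Num.Theory.
Local Open Scope ring_scope.

Record rmod (k : fieldType) (A : falgType k) := RMod {
  rcar :> vectType k;
  ract : rcar -> A -> rcar;
  ract_linl : forall a, linear (ract^~ a);
  ract_linr : forall x, linear (ract x);
  ract1 : forall x, ract x 1 = x;
  ractM : forall x a b, ract x (a * b) = ract (ract x a) b }.

Record rhom (k : fieldType) (A : falgType k) (X Y : rmod A) := RHom {
  rhom_lf :> 'Hom(X, Y);
  rhomP : `[< forall x a, rhom_lf (ract x a) = ract (rhom_lf x) a >] }.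

Section RhomZmod.
Variables (k : fieldType) (A : falgType k) (X Y : rmod A).

Definition rlinear : {pred 'Hom(X, Y)} :=
  fun f => `[< forall x a, f (ract x a) = ract (f x) a >].

HB.instance Definition _ := [isSub for @rhom_lf k A X Y].
HB.instance Definition _ := [Choice of rhom X Y by <:].

Lemma ractBl (M : rmod A) (x y : M) a : ract (x - y) a = ract x a - ract y a.
Proof.
have := ract_linl a (-1) y x.
by rewrite !scaleN1r !(addrC (- _)).
Qed.

Lemma ract0l (M : rmod A) a : ract (0 : M) a = 0.
Proof. by have := ractBl (0 : M) 0 a; rewrite !subrr. Qed.

Lemma ractDl (M : rmod A) (x y : M) a : ract (x + y) a = ract x a + ract y a.
Proof. by have := ract_linl a 1 x y; rewrite !scale1r. Qed.

Lemma ractZl (M : rmod A) c (x : M) a : ract (c *: x) a = c *: ract x a.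
Proof. by have := ract_linl a c x 0; rewrite ract0l !addr0. Qed.

Lemma ractDr (M : rmod A) (x : M) a b : ract x (a + b) = ract x a + ract x b.
Proof. by have := ract_linr x 1 a b; rewrite !scale1r. Qed.

Lemma rlinear_zmod : zmod_closed rlinear.
Proof.
split; first by apply/asboolP => x a; rewrite !zero_lfunE ract0l.
move=> f g /asboolP fP /asboolP gP; apply/asboolP => x a.
by rewrite !add_lfunE !opp_lfunE fP gP ractBl.
Qed.

HB.instance Definition _ := GRing.isZmodClosed.Build _ rlinear rlinear_zmod.
HB.instance Definition _ :=
  GRing.SubChoice_isSubZmodule.Build _ rlinear (rhom X Y) rlinear_zmod.

Lemma rhom_act (f : rhom X Y) x a : f (ract x a) = ract (f x) a.
Proof. by move/asboolP: (rhomP f) => ->. Qed.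

Lemma rhom_add (f : rhom X Y) x y : f (x + y) = f x + f y.
Proof. exact: linearD. Qed.

Lemma rhom_scale (f : rhom X Y) c x : f (c *: x) = c *: f x.
Proof. exact: linearZ. Qed.

Lemma rhom_sum (f : rhom X Y) I r (P : pred I) (F : I -> X) :
  f (\sum_(i <- r | P i) F i) = \sum_(i <- r | P i) f (F i).
Proof. exact: linear_sum. Qed.

Lemma rhom_ext (f g : rhom X Y) : (forall x, f x = g x) -> f = g.
Proof. by move=> h; apply/val_inj/lfunP. Qed.

Lemma rhomD (f g : rhom X Y) x : (f + g) x = f x + g x.
Proof. exact: add_lfunE. Qed.

Lemma rhomB (f g : rhom X Y) x : (f - g) x = f x - g x.
Proof. by rewrite rhomD; congr (_ + _); apply: opp_lfunE. Qed.

Lemma rhom0 x : (0 : rhom X Y) x = 0.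
Proof. exact: zero_lfunE. Qed.

Section Make.
Variables (f : X -> Y) (fl : linear f).
Hypothesis fa : forall x a, f (ract x a) = ract (f x) a.

Definition mk_linear : {linear X -> Y} :=
  HB.pack f (GRing.isLinear.Build k X Y *:%R f fl).

Lemma mk_rhom_subproof :
  `[< forall x a, linfun mk_linear (ract x a) = ract (linfun mk_linear x) a >].
Proof. by apply/asboolP => x a; rewrite !lfunE /= fa. Qed.

Definition mk_rhom : rhom X Y := RHom mk_rhom_subproof.

Lemma mk_rhomE x : mk_rhom x = f x.
Proof. exact: (lfunE mk_linear). Qed.

End Make.

End RhomZmod.

Section Modules.
Variables (k : fieldType) (A : falgType k).
Implicit Types X Y Z M N P : rmod A.

Lemma rid_subproof X : `[< forall x a, \1%VF (ract x a) = ract (\1%VF x : X) a >].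
Proof. by apply/asboolP => x a; rewrite !id_lfunE. Qed.
Definition rid X : rhom X X := RHom (rid_subproof X).

Lemma rcomp_subproof X Y Z (g : rhom Y Z) (f : rhom X Y) :
  `[< forall x a, (g \o f)%VF (ract x a) = ract ((g \o f)%VF x) a >].
Proof. by apply/asboolP => x a; rewrite !comp_lfunE !rhom_act. Qed.
Definition rcomp X Y Z (g : rhom Y Z) (f : rhom X Y) : rhom X Z :=
  RHom (rcomp_subproof g f).

Lemma ridE X x : rid X x = x. Proof. exact: id_lfunE. Qed.
Lemma rcompE X Y Z (g : rhom Y Z) (f : rhom X Y) x : rcomp g f x = g (f x).
Proof. exact: comp_lfunE. Qed.

Definition rinj X Y (f : rhom X Y) := lker f = 0%VS.
Definition rsurj X Y (f : rhom X Y) := limg f = fullv.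
Definition rexact X Y Z (f : rhom X Y) (g : rhom Y Z) := limg f = lker g.

Definition is_riso X Y (f : rhom X Y) :=
  exists g : rhom Y X, rcomp g f = rid X /\ rcomp f g = rid Y.
Definition riso X Y := exists f : rhom X Y, is_riso f.

Definition rproj P := forall M N (g : rhom M N) (f : rhom P N),
  rsurj g -> exists h : rhom P M, rcomp g h = f.

Lemma rsurjP X Y (f : rhom X Y) : rsurj f <-> forall y, exists x, f x = y.
Proof.
split=> [h y|h].
  have := memvf y; rewrite -h => /memv_imgP[x _ ->]; by exists x.
apply/eqP; rewrite eqEsubv subvf /=; apply/subvP => y _.
by have [x <-] := h y; apply/memv_img/memvf.
Qed.

Section Sum.
Variables M N : rmod A.
Let sact (u : (M * N)%type) (a : A) : (M * N)%type := (ract u.1 a, ract u.2 a).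
Lemma rsum_linl a : linear (sact^~ a).
Proof.
by move=> c u v; congr pair; rewrite /= ractDl ractZl.
Qed.
Lemma rsum_linr u : linear (sact u).
Proof. by move=> c a b; congr pair; rewrite /= ract_linr. Qed.
Lemma rsum_1 u : sact u 1 = u.
Proof. by case: u => x y; rewrite /sact /= !ract1. Qed.
Lemma rsum_M u a b : sact u (a * b) = sact (sact u a) b.
Proof. by rewrite /sact /= !ractM. Qed.
Definition rsum : rmod A := RMod rsum_linl rsum_linr rsum_1 rsum_M.

Lemma rinl_subproof : linear (fun x : M => (x, 0) : rsum).
Proof. by move=> c x y; congr pair; rewrite /= scaler0 addr0. Qed.
Lemma rinl_act (x : M) a : (ract x a, 0) = ract ((x, 0) : rsum) a.
Proof. by congr pair; rewrite /= ract0l. Qed.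
Definition rinl : rhom M rsum := mk_rhom rinl_subproof rinl_act.
Lemma rinr_subproof : linear (fun x : N => (0, x) : rsum).
Proof. by move=> c x y; congr pair; rewrite /= scaler0 addr0. Qed.
Lemma rinr_act (x : N) a : (0, ract x a) = ract ((0, x) : rsum) a.
Proof. by congr pair; rewrite /= ract0l. Qed.
Definition rinr : rhom N rsum := mk_rhom rinr_subproof rinr_act.

Lemma rsum_proj : rproj M -> rproj N -> rproj rsum.
Proof.
move=> pM pN U V g f sg.
have [h1 e1] := pM U V g (rcomp f rinl) sg.
have [h2 e2] := pN U V g (rcomp f rinr) sg.
pose h (u : rsum) := h1 u.1 + h2 u.2.
have hl : linear h.
  by move=> c u v; rewrite /h /= !linearP scalerDr addrACA.
have ha (u : rsum) a : h (ract u a) = ract (h u) a.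
  by rewrite /h /= !rhom_act ractDl.
have E1 x : g (h1 x) = f (rinl x) by rewrite -rcompE e1 rcompE.
have E2 x : g (h2 x) = f (rinr x) by rewrite -rcompE e2 rcompE.
exists (mk_rhom hl ha); apply: rhom_ext => u; rewrite rcompE mk_rhomE /h rhom_add.
rewrite E1 E2 -rhom_add; congr (rhom_lf f _); rewrite !mk_rhomE.
by case: u => x y; congr pair; rewrite /= ?addr0 ?add0r.
Qed.
End Sum.

Lemma rsum_map_lin M N M' N' (f : rhom M N) (g : rhom M' N') :
  linear (fun u : rsum M M' => (f u.1, g u.2) : rsum N N').
Proof. by move=> c u v; congr pair; rewrite /= rhom_add rhom_scale. Qed.
Lemma rsum_map_act M N M' N' (f : rhom M N) (g : rhom M' N') (u : rsum M M') a :
  ((f (ract u a).1, g (ract u a).2) : rsum N N') =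
  ract ((f u.1, g u.2) : rsum N N') a.
Proof. by congr pair; rewrite /= rhom_act. Qed.
Definition rsum_map M N M' N' (f : rhom M N) (g : rhom M' N') :
  rhom (rsum M M') (rsum N N') := mk_rhom (rsum_map_lin f g) (rsum_map_act f g).

Section Submodule.
Variables (M : rmod A) (U : {vspace M}).
Hypothesis US : forall x a, x \in U -> ract x a \in U.
Let sact (u : subvs_of U) (a : A) : subvs_of U := Subvs (US a (subvsP u)).
Lemma submod_linl a : linear (sact^~ a).
Proof. by move=> c u v; apply: val_inj; rewrite /= ractDl ractZl. Qed.
Lemma submod_linr u : linear (sact u).
Proof. by move=> c a b; apply: val_inj; rewrite /= ract_linr. Qed.
Lemma submod_1 u : sact u 1 = u.
Proof. by apply: val_inj; rewrite /= ract1. Qed.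
Lemma submod_M u a b : sact u (a * b) = sact (sact u a) b.
Proof. by apply: val_inj; rewrite /= ractM. Qed.
Definition submod : rmod A := RMod submod_linl submod_linr submod_1 submod_M.

Lemma subinc_lin : linear (fun u : submod => vsval u).
Proof. by move=> c u v. Qed.
Lemma subinc_act (u : submod) a : vsval (ract u a) = ract (vsval u) a.
Proof. by []. Qed.
Definition subinc : rhom submod M := mk_rhom subinc_lin subinc_act.
End Submodule.

Section Free.
Variable n : nat.
Let fact (u : {ffun 'I_n -> A}) (a : A) : {ffun 'I_n -> A} :=
  [ffun i => u i * a].
Lemma free_linl a : linear (fact^~ a).
Proof. by move=> c u v; apply/ffunP => i; rewrite !ffunE mulrDl scalerAl. Qed.
Lemma free_linr u : linear (fact u).
Proof. by move=> c a b; apply/ffunP => i; rewrite !ffunE mulrDr scalerAr. Qed.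
Lemma free_1 u : fact u 1 = u.
Proof. by apply/ffunP => i; rewrite !ffunE mulr1. Qed.
Lemma free_M u a b : fact u (a * b) = fact (fact u a) b.
Proof. by apply/ffunP => i; rewrite !ffunE mulrA. Qed.
Definition rfree : rmod A := RMod free_linl free_linr free_1 free_M.

Section FreeMap.
Variables (M : rmod A) (m : 'I_n -> M).
Lemma free_map_lin : linear (fun u : rfree => \sum_i ract (m i) (u i)).
Proof.
move=> c u v; rewrite scaler_sumr -big_split; apply: eq_bigr => i _.
by rewrite !ffunE ract_linr.
Qed.
Lemma free_map_act (u : rfree) a :
  \sum_i ract (m i) ((ract u a : {ffun 'I_n -> A}) i) = ract (\sum_i ract (m i) (u i)) a.
Proof.
rewrite (big_morph (fun x : M => ract x a) (fun x y => ractDl x y a) (@ract0l k A M a)).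
by apply: eq_bigr => i _; rewrite /= ffunE ractM.
Qed.
Definition free_map : rhom rfree M := mk_rhom free_map_lin free_map_act.
End FreeMap.

Definition free_gen (i : 'I_n) : rfree := [ffun j => (j == i)%:R].

Lemma free_decomp (u : rfree) : u = \sum_i ract (free_gen i) (u i).
Proof.
apply/ffunP => j; rewrite sum_ffunE (bigD1 j) //= !ffunE eqxx mul1r.
rewrite big1 ?addr0 // => i /negbTE ne; by rewrite !ffunE eq_sym ne mul0r.
Qed.

Lemma rfree_proj : rproj rfree.
Proof.
move=> M N g f /rsurjP sg.
have [m mE] := choice (fun i => sg (f (free_gen i))).
exists (free_map m); apply: rhom_ext => u.
rewrite rcompE mk_rhomE rhom_sum {2}[u]free_decomp rhom_sum.
by apply: eq_bigr => i _; rewrite !rhom_act mE.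
Qed.
End Free.

Lemma rfree_cover M :
  rsurj (free_map (fun i : 'I_(\dim {: M}) => tnth (vbasis {: M}) i)).
Proof.
apply/rsurjP => y.
exists [ffun i => (coord (vbasis {: M}) i y)%:A].
rewrite mk_rhomE [RHS](coord_vbasis (memvf y)); apply: eq_bigr => i _.
rewrite ffunE (tnth_nth 0).
have -> : (coord (vbasis {:M}) i y)%:A = coord (vbasis {:M}) i y *: 1 + 0 :> A.
  by rewrite addr0.
rewrite ract_linr ract1.
have -> : ract (vbasis {: M})`_i (0 : A) = 0.
  by have := ract_linr (vbasis {: M})`_i (-1) 0 0;
     rewrite !scaleN1r oppr0 addr0 addrC subrr.
by rewrite addr0.
Qed.

End Modules.

(* The base field acts centrally: both actions are linear for the same
   k-structure. *)
Record bimod (k : fieldType) (A : falgType k) := BiMod {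
  bcar :> rmod A;
  lact : A -> bcar -> bcar;
  lact_linl : forall x, linear (lact^~ x);
  lact_linr : forall a, linear (lact a);
  lact1 : forall x, lact 1 x = x;
  lactM : forall a b x, lact (a * b) x = lact a (lact b x);
  lactA : forall a x b, ract (lact a x) b = lact a (ract x b) }.

Record bihom (k : fieldType) (A : falgType k) (B B' : bimod A) := BiHom {
  bihom_r :> rhom B B';
  bihomP : forall a x, bihom_r (lact a x) = lact a (bihom_r x) }.

Record algaut (k : fieldType) (A : falgType k) := AlgAut {
  aut :> {lrmorphism A -> A};
  autV : {lrmorphism A -> A};
  autK : cancel aut autV;
  autVK : cancel autV aut }.

Section Bimodules.
Variables (k : fieldType) (A : falgType k).
Implicit Types B P Q : bimod A.

Definition aut_inv (s : algaut A) : algaut A := AlgAut (autVK s) (autK s).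

Definition bisubmod B (U : {vspace B}) :=
  forall x a, x \in U -> lact a x \in U /\ ract x a \in U.

Definition biso B B' := exists (f : bihom B B') (g : bihom B' B),
  rcomp g f = rid B /\ rcomp f g = rid B'.

Definition bproj P := forall B B' (g : bihom B B') (f : bihom P B'),
  rsurj g -> exists h : bihom P B, rcomp g h = f.

Definition binj Q := forall B B' (g : bihom B B') (f : bihom B Q),
  rinj g -> exists h : bihom B' Q, rcomp h g = f.

Definition bproj_cover P B (p : bihom P B) :=
  [/\ bproj P, rsurj p &
      forall U : {vspace P}, bisubmod U -> (U + lker p = fullv)%VS ->
        U = fullv].

(* N is isomorphic to the n-th syzygy of B in a minimal projective
   resolution by bimodules. *)
Fixpoint is_syzygy (n : nat) (B N : bimod A) : Prop :=
  if n is m.+1 then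
    exists (P K : bimod A) (i : bihom K P) (p : bihom P B),
      [/\ bproj_cover p, rinj i, rexact i p & is_syzygy m K N]
  else biso B N.

Section Twist.
Variable t : {lrmorphism A -> A}.
Let ra (x a : A) : A := x * a.
Lemma twist_rlinl a : linear (ra^~ a).
Proof. by move=> c x y; rewrite /ra mulrDl scalerAl. Qed.
Lemma twist_rlinr x : linear (ra x).
Proof. by move=> c a b; rewrite /ra mulrDr scalerAr. Qed.
Lemma twist_r1 x : ra x 1 = x. Proof. exact: mulr1. Qed.
Lemma twist_rM x a b : ra x (a * b) = ra (ra x a) b. Proof. exact: mulrA. Qed.
Definition regmod : rmod A :=
  @RMod k A A ra twist_rlinl twist_rlinr twist_r1 twist_rM.

Let la (a : A) (x : regmod) : regmod := t a * x.
Lemma twist_llinl x : linear (la^~ x).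
Proof. by move=> c a b; rewrite /la linearP mulrDl scalerAl. Qed.
Lemma twist_llinr a : linear (la a).
Proof. by move=> c x y; rewrite /la mulrDr scalerAr. Qed.
Lemma twist_l1 x : la 1 x = x. Proof. by rewrite /la rmorph1 mul1r. Qed.
Lemma twist_lM a b x : la (a * b) x = la a (la b x).
Proof. by rewrite /la rmorphM mulrA. Qed.
Lemma twist_lA a x b : ract (la a x) b = la a (ract x b).
Proof. by rewrite /= /ra /la mulrA. Qed.
Definition twist : bimod A :=
  BiMod twist_llinl twist_llinr twist_l1 twist_lM twist_lA.
End Twist.

Definition regbimod : bimod A := twist idfun.

Definition twisted_periodic (d : nat) (s : algaut A) :=
  is_syzygy d.+2 regbimod (twist (aut_inv s)).

Lemma eA_subproof (e : A) (x : regmod) a :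
  x \in (<[e]> * fullv)%VS -> ract x a \in (<[e]> * fullv)%VS.
Proof.
move=> xe; have := memv_mul xe (memvf a); rewrite -prodvA.
by apply/subvP/prodvSr/subvf.
Qed.
(* The right ideal eA as a right module. *)
Definition eA (e : A) : rmod A := submod (@eA_subproof e).

Definition orth_idem (e f : A) :=
  [/\ e * e = e, f * f = f, e * f = 0 & f * e = 0].

Definition primitive_idem (e : A) :=
  [/\ e != 0, e * e = e & forall f g, orth_idem f g -> e = f + g ->
        f = 0 \/ g = 0].

Definition basic := exists (n : nat) (e : 'I_n -> A),
  [/\ forall i, primitive_idem (e i),
      forall i j, i != j -> e i * e j = 0,
      \sum_i e i = 1
    & forall i j, i != j -> ~ riso (eA (e i)) (eA (e j))].

End Bimodules.

Arguments basic {k} A.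
Arguments regbimod {k} A.
Arguments regmod {k} A.

Section Tensor.
Variables (k : fieldType) (A : falgType k).

Section Def.
Variables (M : rmod A) (B : bimod A).

(* The tensor product over k, in coordinates. *)
Definition ktens := 'M[k]_(\dim {: M}, \dim {: B}).
Definition kpure (m : M) (b : B) : ktens :=
  \matrix_(i, j) (coord (vbasis {: M}) i m * coord (vbasis {: B}) j b).

Definition tens_rel : {vspace ktens} :=
  <<[seq kpure (ract m ab.1) ab.2 - kpure m (lact ab.1 ab.2)
      | m <- vbasis {: M},
        ab <- [seq (a, b) | a <- vbasis {: A}, b <- vbasis {: B}]]>>%VS.

(* The quotient of ktens by tens_rel is realized on a complement of
   tens_rel. *)
Definition tens_car := subvs_of (tens_rel^C)%VS.
Definition pure (m : M) (b : B) : tens_car :=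
  vsproj _ (daddv_pi (tens_rel^C) tens_rel (kpure m b)).

Definition balanced (V : lmodType k) (h : M -> B -> V) :=
  [/\ forall b, linear (h^~ b), forall m, linear (h m)
    & forall m a b, h (ract m a) b = h m (lact a b)].

Definition klift_fun (V : lmodType k) (h : M -> B -> V) (t : ktens) : V :=
  \sum_i \sum_j t i j *: h (vbasis {: M})`_i (vbasis {: B})`_j.

Lemma klift_lin (V : lmodType k) (h : M -> B -> V) : linear (klift_fun h).
Proof.
move=> c t u; rewrite /klift_fun scaler_sumr -big_split; apply: eq_bigr => i _.
rewrite scaler_sumr -big_split; apply: eq_bigr => j _.
by rewrite !mxE scalerDl scalerA.
Qed.

Definition tens_lift_fun (V : lmodType k) (h : M -> B -> V) (t : tens_car) : V := klift_fun h (vsval t).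

Lemma tens_lift_lin (V : lmodType k) (h : M -> B -> V) : linear (tens_lift_fun h).
Proof. by move=> c t u; rewrite /tens_lift_fun klift_lin. Qed.

Lemma kpure_lin1 b : linear (kpure^~ b).
Proof. by move=> c x y; apply/matrixP => i j; rewrite !mxE linearP mulrDl mulrA. Qed.

Lemma kpure_lin2 m : linear (kpure m).
Proof. by move=> c x y; apply/matrixP => i j; rewrite !mxE linearP mulrDr mulrCA. Qed.

Lemma klift_pure (V : lmodType k) (h : M -> B -> V) m b : balanced h -> klift_fun h (kpure m b) = h m b.
Proof.
move=> [h1 h2 _]; rewrite [in RHS](coord_vbasis (memvf m)).
rewrite [in RHS](coord_vbasis (memvf b)) /klift_fun.
pose H1 y : {linear M -> V} := HB.pack (h^~ y) (GRing.isLinear.Build k M V *:%R (h^~ y) (h1 y)).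
pose H2 x : {linear B -> V} := HB.pack (h x) (GRing.isLinear.Build k B V *:%R (h x) (h2 x)).
rewrite -[RHS]/(H1 _ _) linear_sum; apply: eq_bigr => i _.
rewrite linearZ /= -[h _ _]/(H2 _ _) linear_sum scaler_sumr; apply: eq_bigr => j _.
by rewrite linearZ /= mxE scalerA.
Qed.

Lemma tens_dec (t : ktens) :
  t = \sum_i \sum_j t i j *: kpure (vbasis {: M})`_i (vbasis {: B})`_j.
Proof.
have cE (U : vectType k) (i j : 'I_(\dim {: U})) :
    coord (vbasis {: U}) i (vbasis {: U})`_j = (j == i)%:R.
  by rewrite coord_free ?(basis_free (vbasisP _)) // eq_sym.
apply/matrixP => i j; rewrite summxE (bigD1 i) //= summxE (bigD1 j) //=.
rewrite !mxE !cE !eqxx !mulr1 big1 => [|l /negbTE nl]; last first.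
  by rewrite !mxE !cE nl !mulr0.
rewrite !big1 ?addr0 // => l /negbTE nl; rewrite summxE big1 // => l' _.
by rewrite !mxE !cE nl mul0r mulr0.
Qed.

Lemma klift_rel (V : lmodType k) (h : M -> B -> V) t : balanced h -> t \in tens_rel -> klift_fun h t = 0.
Proof.
move=> hb; have [h1 h2 h3] := hb.
pose K : {linear ktens -> V} := HB.pack (klift_fun h)
  (GRing.isLinear.Build k ktens V *:%R (klift_fun h) (klift_lin h)).
rewrite /tens_rel; set S := (X in <<X>>%VS) => tr.
rewrite -[klift_fun h t]/(K t) (@coord_span _ _ _ (in_tuple S) t tr).
rewrite linear_sum big1 // => i _; rewrite linearZ /=.
have : S`_i \in S by apply: mem_nth; rewrite -[X in (_ < X)%N](size_tuple (in_tuple S)).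
rewrite {2}/S; case/allpairsPdep => m [[a b] [_ _ ->]].
by rewrite -[klift_fun h _]/(K _) linearB /= !klift_pure // h3 subrr scaler0.
Qed.

Definition kproj (t : ktens) : tens_car :=
  vsproj _ (daddv_pi (tens_rel^C) tens_rel t).

Lemma kproj_lin : linear kproj.
Proof. by move=> c t u; rewrite /kproj !linearP. Qed.

Lemma capCrel : (tens_rel^C :&: tens_rel = 0)%VS.
Proof. by rewrite capvC capv_compl. Qed.

Lemma kproj_rel t : t - vsval (kproj t) \in tens_rel.
Proof.
rewrite vsprojK ?memv_pi //.
have tC : t \in (tens_rel^C + tens_rel)%VS by rewrite addvC addv_complf memvf.
have e := daddv_pi_add capCrel tC.
by rewrite -[X in X - _]e addrC addKr memv_pi.
Qed.

Lemma kproj_eq0 t : t \in tens_rel -> kproj t = 0.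
Proof.
move=> tr; have := kproj_rel t; have := subvsP (kproj t) => h1 h2.
have h3 : vsval (kproj t) \in tens_rel.
  by rewrite -[vsval _](subKr t) rpredB.
apply/val_inj/eqP; rewrite /= -memv0 -capCrel memv_cap h1; exact: h3.
Qed.

Lemma kproj_val (t : tens_car) : kproj (vsval t) = t.
Proof.
apply: val_inj; rewrite /= vsprojK ?memv_pi // daddv_pi_id ?capCrel //.
exact: subvsP.
Qed.

Lemma tens_lift_pure (V : lmodType k) (h : M -> B -> V) m b : balanced h ->
  tens_lift_fun h (pure m b) = h m b.
Proof.
move=> hb; rewrite -[RHS](klift_pure m b hb) /tens_lift_fun.
apply/esym/eqP; rewrite -subr_eq0.
pose K : {linear ktens -> V} := HB.pack (klift_fun h)
  (GRing.isLinear.Build k ktens V *:%R (klift_fun h) (klift_lin h)).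
rewrite -[klift_fun h (kpure m b)]/(K _) -[klift_fun h _]/(K _) -linearB /=.
by rewrite klift_rel //; apply: kproj_rel.
Qed.

Lemma pure_lin1 b : linear (pure^~ b).
Proof. by move=> c x y; rewrite /pure kpure_lin1 -kproj_lin. Qed.

Lemma pure_lin2 m : linear (pure m).
Proof. by move=> c x y; rewrite /pure kpure_lin2 -kproj_lin. Qed.

Lemma klift_pure_proj t : klift_fun pure t = kproj t.
Proof.
pose K : {linear ktens -> tens_car} := HB.pack kproj
  (GRing.isLinear.Build k ktens tens_car *:%R kproj kproj_lin).
rewrite -[kproj t]/(K t) [in RHS](tens_dec t) linear_sum; apply: eq_bigr => i _.
by rewrite linear_sum; apply: eq_bigr => j _; rewrite linearZ.
Qed.

Lemma tens_ind (V : lmodType k) (f g : tens_car -> V) :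
  linear f -> linear g -> (forall m b, f (pure m b) = g (pure m b)) ->
  forall t, f t = g t.
Proof.
move=> fl gl e t.
pose F : {linear tens_car -> V} :=
  HB.pack f (GRing.isLinear.Build k tens_car V *:%R f fl).
pose G : {linear tens_car -> V} :=
  HB.pack g (GRing.isLinear.Build k tens_car V *:%R g gl).
rewrite -[f t]/(F t) -[g t]/(G t) -(kproj_val t) -klift_pure_proj.
rewrite !linear_sum; apply: eq_bigr => i _.
by rewrite !linear_sum; apply: eq_bigr => j _; rewrite !linearZ /= e.
Qed.

Lemma pure_bal m a b : pure (ract m a) b = pure m (lact a b).
Proof.
suff r : kpure (ract m a) b - kpure m (lact a b) \in tens_rel.
  apply/eqP; rewrite -subr_eq0 -[_ - _]addrC -scaleN1r -kproj_lin scaleN1r addrC.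
  by rewrite kproj_eq0.
pose inr m a b := kpure (ract m a) b - kpure m (lact a b) \in tens_rel.
have P x y c : x \in tens_rel -> y \in tens_rel -> c *: x + y \in tens_rel.
  by move=> *; rewrite rpredD ?rpredZ.
have sumE (U : vectType k) (f : U -> ktens) : linear f ->
    (forall i : 'I_(\dim {: U}), f (vbasis {: U})`_i \in tens_rel) -> forall u, f u \in tens_rel.
  move=> fl fb u.
  pose F : {linear U -> ktens} :=
    HB.pack f (GRing.isLinear.Build k U ktens *:%R f fl).
  rewrite -[f u]/(F u) (coord_vbasis (memvf u)) linear_sum rpred_sum // => i _.
  by rewrite linearZ rpredZ //; apply: fb.
have linB (U : vectType k) (f g : U -> ktens) : linear f -> linear g ->
    linear (fun u => f u - g u).
  by move=> fl gl c u v; rewrite fl gl scalerBr opprD addrACA.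
apply: (sumE _ (fun m => kpure (ract m a) b - kpure m (lact a b))) => [|i].
  apply: linB; last exact: kpure_lin1.
  by move=> c u v; rewrite ract_linl kpure_lin1.
apply: (sumE _ (fun a => kpure (ract (vbasis {: M})`_i a) b -
                         kpure (vbasis {: M})`_i (lact a b))) => [|j].
  apply: linB; first by move=> c u v; rewrite ract_linr kpure_lin1.
  by move=> c u v; rewrite lact_linl kpure_lin2.
apply: (sumE _ (fun b => kpure (ract (vbasis {: M})`_i (vbasis {: A})`_j) b -
                 kpure (vbasis {: M})`_i (lact (vbasis {: A})`_j b))) => [|l].
  apply: linB; first exact: kpure_lin2.
  by move=> c u v; rewrite lact_linr kpure_lin2.
apply: memv_span; apply/allpairsPdep.
exists (vbasis {: M})`_i, ((vbasis {: A})`_j, (vbasis {: B})`_l); split => //.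
  by apply: mem_nth; rewrite size_tuple; apply: ltn_ord.
apply/allpairsPdep; exists (vbasis {: A})`_j, (vbasis {: B})`_l.
by split=> //; apply: mem_nth; rewrite size_tuple; apply: ltn_ord.
Qed.

Lemma pure_balanced : balanced pure.
Proof. by split; [exact: pure_lin1|exact: pure_lin2|exact: pure_bal]. Qed.

Let tact (t : tens_car) (a : A) : tens_car :=
  tens_lift_fun (fun m b => pure m (ract b a)) t.

Lemma tact_bal a : balanced (fun m b => pure m (ract b a)).
Proof.
split=> [b|m|m c b]; first exact: pure_lin1.
  by move=> c x y; rewrite ract_linl pure_lin2.
by rewrite pure_bal lactA.
Qed.
Lemma tact_pure m b a : tact (pure m b) a = pure m (ract b a).
Proof. exact/tens_lift_pure/tact_bal. Qed.
Lemma tens_linl a : linear (tact^~ a).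
Proof. exact: tens_lift_lin. Qed.
Lemma tens_linr t : linear (tact t).
Proof.
move=> c a b; move: t; apply: tens_ind; first exact: tens_linl.
  move=> e x y; rewrite !tens_linl !scalerDr !scalerA [c * e]mulrC.
  by rewrite addrACA.
by move=> m x; rewrite !tact_pure ract_linr pure_lin2.
Qed.
Lemma tens_1 t : tact t 1 = t.
Proof.
move: t; apply: tens_ind; first exact: tens_linl.
  by [].
by move=> m x; rewrite tact_pure ract1.
Qed.
Lemma tens_M t a b : tact t (a * b) = tact (tact t a) b.
Proof.
move: t; apply: tens_ind; first exact: tens_linl.
  by move=> c x y; rewrite !tens_linl.
by move=> m x; rewrite !tact_pure ractM.
Qed.
Definition tens : rmod A := RMod tens_linl tens_linr tens_1 tens_M.

Lemma tens_act_pure m b a : ract (pure m b : tens) a = pure m (ract b a).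
Proof. exact: tact_pure. Qed.

Section Lift.
Variables (N : rmod A) (h : M -> B -> N).
Hypothesis hb : balanced h.
Hypothesis ha : forall m b a, h m (ract b a) = ract (h m b) a.
Let lf (t : tens) : N := tens_lift_fun h t.
Lemma lf_lin : linear lf. Proof. exact: tens_lift_lin. Qed.
Lemma lf_act t a : lf (ract t a) = ract (lf t) a.
Proof.
move: t; apply: tens_ind.
- by move=> c x y; rewrite ractDl ractZl lf_lin.
- by move=> c x y; rewrite lf_lin ractDl ractZl.
move=> m b; rewrite tens_act_pure /lf !tens_lift_pure //; exact: ha.
Qed.
Definition tens_lift : rhom tens N := mk_rhom lf_lin lf_act.
Lemma tens_liftE m b : tens_lift (pure m b : tens) = h m b.
Proof. by rewrite mk_rhomE /lf tens_lift_pure. Qed.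
End Lift.

Lemma tens_ext N (f g : rhom tens N) :
  (forall m b, f (pure m b) = g (pure m b)) -> f = g.
Proof.
move=> e; apply: rhom_ext; apply: tens_ind => //.
- by move=> c x y; rewrite rhom_add rhom_scale.
- by move=> c x y; rewrite rhom_add rhom_scale.
Qed.

End Def.

Section MapL.
Variables (M N : rmod A) (B : bimod A) (f : rhom M N).
Lemma tens_map_bal : balanced (fun m (b : B) => pure (f m) b : tens N B).
Proof.
split=> [b|m|m a b]; last by rewrite rhom_act pure_bal.
  by move=> c x y; rewrite rhom_add rhom_scale pure_lin1.
exact: pure_lin2.
Qed.
Lemma tens_map_act m (b : B) a :
  (pure (f m) (ract b a) : tens N B) = ract (pure (f m) b : tens N B) a.
Proof. by rewrite tens_act_pure. Qed.
Definition tens_map : rhom (tens M B) (tens N B) :=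
  tens_lift tens_map_bal tens_map_act.
Lemma tens_mapE m b : tens_map (pure m b : tens M B) = pure (f m) b.
Proof. exact: tens_liftE. Qed.
End MapL.

Section MapR.
Variables (M : rmod A) (B B' : bimod A) (g : bihom B B').
Lemma tens_mapr_bal : balanced (fun (m : M) b => pure m (g b) : tens M B').
Proof.
split=> [b|m|m a b]; last by rewrite bihomP pure_bal.
  exact: pure_lin1.
by move=> c x y; rewrite rhom_add rhom_scale pure_lin2.
Qed.
Lemma tens_mapr_act (m : M) b a :
  (pure m (g (ract b a)) : tens M B') = ract (pure m (g b) : tens M B') a.
Proof. by rewrite tens_act_pure rhom_act. Qed.
Definition tens_mapr : rhom (tens M B) (tens M B') :=
  tens_lift tens_mapr_bal tens_mapr_act.
End MapR.

(* The canonical isomorphism from the tensor product of M and A to M. *)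
Section TensA.
Variable M : rmod A.
Lemma tens_reg_bal : balanced (fun (m : M) (b : regbimod A) => ract m b).
Proof.
split=> [b|m|m a b]; [exact: ract_linl|exact: ract_linr|].
by rewrite -ractM.
Qed.
Lemma tens_reg_act (m : M) (b : regbimod A) a :
  ract m (ract b a) = ract (ract m b) a.
Proof. exact: ractM. Qed.
Definition tens_reg : rhom (tens M (regbimod A)) M :=
  tens_lift tens_reg_bal tens_reg_act.
End TensA.

(* The canonical isomorphism from M to its image under
   - (x) _t A_1 followed by - (x) _{t^-1} A_1. *)
Section Unit.
Variables (t : algaut A) (M : rmod A).
Let T := tens (tens M (twist t)) (twist (aut_inv t)).
Let u (m : M) : T := pure (pure m (1 : twist t) : tens M (twist t)) (1 : twist (aut_inv t)).
Lemma unit_lin : linear u.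
Proof. by move=> c x y; rewrite /u !pure_lin1. Qed.
Lemma unit_act m a : u (ract m a) = ract (u m) a.
Proof.
have e1 : lact a (1 : twist t) = ract (1 : twist t) (t a).
  by rewrite /= mul1r mulr1.
have e2 : lact (t a) (1 : twist (aut_inv t)) = ract (1 : twist (aut_inv t)) a.
  by rewrite /= mul1r mulr1 autK.
rewrite /u pure_bal e1 (_ : pure m _ =
  ract (pure m (1 : twist t) : tens M (twist t)) (t a)); last first.
  by rewrite tens_act_pure.
by rewrite [in LHS]pure_bal e2 tens_act_pure.
Qed.
Definition tens_unit : rhom M T := mk_rhom unit_lin unit_act.
End Unit.

Section Restriction.
Variables (t : {lrmorphism A -> A}) (L : rmod A).
Let r (x : L) (a : A) : L := ract x (t a).
Lemma restr_linl a : linear (r^~ a). Proof. exact: ract_linl. Qed.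
Lemma restr_linr x : linear (r x).
Proof. by move=> c a b; rewrite /r linearP ract_linr. Qed.
Lemma restr_1 x : r x 1 = x. Proof. by rewrite /r rmorph1 ract1. Qed.
Lemma restr_M x a b : r x (a * b) = r (r x a) b.
Proof. by rewrite /r rmorphM ractM. Qed.
Definition restr : rmod A := RMod restr_linl restr_linr restr_1 restr_M.
End Restriction.

Lemma tens_proj (t : algaut A) (P : rmod A) :
  rproj P -> rproj (tens P (twist t)).
Proof.
move=> pP M N g f sg.
pose tw := restr t.
have fE x (b : twist t) a :
    ract (f (pure x b)) a = f (pure x (ract b a)).
  by rewrite -rhom_act tens_act_pure.
have gl : linear (fun x : tw M => g x : tw N).
  by move=> c x y; rewrite rhom_add rhom_scale.
have ga (x : tw M) a : (g (ract x a : tw M) : tw N) = ract (g x : tw N) a.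
  by rewrite /= rhom_act.
have fl : linear (fun x : P => f (pure x (1 : twist t)) : tw N).
  by move=> c x y; rewrite pure_lin1 rhom_add rhom_scale.
have fa (x : P) a : (f (pure (ract x a) (1 : twist t)) : tw N) =
    ract (f (pure x (1 : twist t)) : tw N) a.
  rewrite (fE x (1 : twist t) (t a) : ract (f _ : tw N) a = _) pure_bal.
  by congr (f (pure _ _)); rewrite /= mulr1 mul1r.
have [h hE] : exists h : rhom P (tw M), rcomp (mk_rhom gl ga) h = mk_rhom fl fa.
  apply: pP; apply/rsurjP => y; have [x <-] := (rsurjP g).1 sg y.
  by exists x; rewrite mk_rhomE.
have hb : balanced (fun (x : P) (b : twist t) => ract (h x : M) b).
  split=> [b c x y|x|x a b]; last by rewrite rhom_act /= -ractM.
    by rewrite rhom_add rhom_scale ract_linl.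
  exact: ract_linr.
have hA (x : P) (b : twist t) a : ract (h x : M) (ract b a) = ract (ract (h x : M) b) a.
  exact: ractM.
exists (tens_lift hb hA); apply: tens_ext => x b.
rewrite rcompE tens_liftE rhom_act.
have := congr1 (fun f : rhom P (tw N) => f x) hE.
rewrite rcompE !mk_rhomE => ->; rewrite fE; congr (f (pure _ _)).
by rewrite /= mul1r.
Qed.

End Tensor.

(* 0 -> Y -> eob 0 -> ... -> eob d -> elast -> C -> 0; the objects eob i
   with i > d and the maps emap i with i >= d are irrelevant. *)
Record exseq (k : fieldType) (A : falgType k) (d : nat) (Y C : rmod A) := ExSeq {
  eob : nat -> rmod A;
  elast : rmod A;
  ein : rhom Y (eob 0);
  emap : forall i, rhom (eob i) (eob i.+1);
  eend : rhom (eob d) elast;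
  eout : rhom elast C }.

Section ExSeq.
Variables (k : fieldType) (A : falgType k) (d : nat).

Section Ends.
Variables Y C : rmod A.

Definition eob1 (E : exseq d Y C) (i : nat) : rmod A :=
  if i is j.+1 then eob E j else Y.

Definition emap1 (E : exseq d Y C) (i : nat) : rhom (eob1 E i) (eob1 E i.+1) :=
  match i with 0 => ein E | j.+1 => emap E j end.

Definition exseq_exact (E : exseq d Y C) :=
  [/\ rinj (ein E),
      forall i, (i < d)%N -> rexact (emap1 E i) (emap1 E i.+1),
      rexact (emap1 E d) (eend E),
      rexact (eend E) (eout E)
    & rsurj (eout E)].

Definition exseq_mor (E F : exseq d Y C) :=
  exists (u : forall i, rhom (eob E i) (eob F i)) (ul : rhom (elast E) (elast F)),
  [/\ rcomp (u 0) (ein E) = ein F,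
      forall i, (i < d)%N ->
        rcomp (u i.+1) (emap E i) = rcomp (emap F i) (u i),
      rcomp ul (eend E) = rcomp (eend F) (u d)
    & rcomp (eout F) ul = eout E].

(* Equality of the Yoneda classes in Ext^{d+2}(C, Y). *)
Definition ext_equiv : exseq d Y C -> exseq d Y C -> Prop :=
  clos_refl_sym_trans _
    (fun E F => [/\ exseq_exact E, exseq_exact F & exseq_mor E F]).

End Ends.
End ExSeq.

(* 0 -> _{s^-1}A_1 -> tob 0 -> ... -> tob d -> tlast -> A -> 0 in bimodules,
   where tob i is the term P_{d+1-i} and tlast is P_0. *)
Record biseq (k : fieldType) (A : falgType k) (d : nat) (s : algaut A) := BiSeq {
  tob : nat -> bimod A;
  tlast : bimod A;
  tin : bihom (twist (aut_inv s)) (tob 0);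
  tmap : forall i, bihom (tob i) (tob i.+1);
  tend : bihom (tob d) tlast;
  tout : bihom tlast (regbimod A) }.

Section AmiotLin.
Variables (k : fieldType) (A : falgType k) (d : nat) (s : algaut A).

Definition biseq_exseq (th : biseq d s) :
    exseq d (twist (aut_inv s)) (regbimod A) :=
  @ExSeq k A d (twist (aut_inv s)) (regbimod A) (tob th) (tlast th)
    (tin th) (tmap th) (tend th) (tout th).

Definition projinj_resolution (th : biseq d s) :=
  [/\ exseq_exact (biseq_exseq th),
      forall i, (i <= d)%N -> bproj (tob th i) /\ binj (tob th i)
    & bproj (tlast th) /\ binj (tlast th)].

Definition tens_seq (C : rmod A) (th : biseq d s) :
    exseq d (tens C (twist (aut_inv s))) C :=
  @ExSeq k A d (tens C (twist (aut_inv s))) C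
    (fun i => tens C (tob th i)) (tens C (tlast th))
    (tens_mapr C (tin th)) (fun i => tens_mapr C (tmap th i))
    (tens_mapr C (tend th)) (rcomp (tens_reg C) (tens_mapr C (tout th))).

End AmiotLin.

Record projA (k : fieldType) (A : falgType k) := ProjA {
  pcar :> rmod A;
  pcarP : rproj pcar }.
Arguments pcarP {k A} p.

Section Angles.
Variables (k : fieldType) (A : falgType k).
Implicit Types X Y Z : projA A.

Definition psum X Y : projA A := ProjA (rsum_proj (pcarP X) (pcarP Y)).

(* The functor - (x) _t A_1 on proj A. *)
Definition Sigma (t : algaut A) X : projA A := ProjA (@tens_proj k A t X (pcarP X)).
Definition Sigma_map (t : algaut A) X Y (f : rhom X Y) :
  rhom (Sigma t X) (Sigma t Y) := tens_map (twist t) f.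

Lemma Sigma_map_id t X : Sigma_map t (rid X) = rid (Sigma t X).
Proof. by apply: tens_ext => x b; rewrite tens_mapE !ridE. Qed.

Lemma Sigma_map_comp t X Y Z (g : rhom Y Z) (f : rhom X Y) :
  Sigma_map t (rcomp g f) = rcomp (Sigma_map t g) (Sigma_map t f).
Proof. by apply: tens_ext => x b; rewrite rcompE !tens_mapE rcompE. Qed.

Lemma Sigma_mapD t X Y (f g : rhom X Y) :
  Sigma_map t (f + g) = Sigma_map t f + Sigma_map t g.
Proof.
apply: tens_ext => x b; rewrite rhomD !tens_mapE rhomD.
by have := pure_lin1 b 1 (f x) (g x); rewrite !scale1r.
Qed.

Section Angle.
Variables (d : nat) (s : algaut A) (th : biseq d s).
(* X_0 -> ... -> X_{d+1} -> Sigma X_0; only the objects X i with i <= d + 1 and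
   the maps x i with i <= d are relevant. *)
Variables (X : nat -> projA A) (x : forall i, rhom (X i) (X i.+1)).
Variable xl : rhom (X d.+1) (Sigma s (X 0%N)).

Definition angle_exact :=
  [/\ forall i, (i < d)%N -> rexact (x i) (x i.+1),
      rexact (x d) xl
    & rexact xl (Sigma_map s (x 0))].

Definition angle_seq (C : rmod A) (p : rhom (Sigma s (X 0%N)) C)
    (i : rhom (tens C (twist (aut_inv s))) (X 1%N)) :
    exseq d (tens C (twist (aut_inv s))) C :=
  @ExSeq k A d (tens C (twist (aut_inv s))) C
    (fun i => X i.+1) (Sigma s (X 0%N)) i (fun i => x i.+1) xl p.

Definition angle_class :=
  exists (C : rmod A) (p : rhom (Sigma s (X 0%N)) C)
         (i : rhom (tens C (twist (aut_inv s))) (X 1%N)),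
  [/\ rexact xl p /\ rsurj p,
      x 0 = rcomp i (rcomp (tens_map (twist (aut_inv s)) p) (tens_unit s (X 0%N))),
      exseq_exact (angle_seq p i)
    & ext_equiv (angle_seq p i) (tens_seq C th)].

Definition angle := angle_exact /\ angle_class.

End Angle.

Section Rank.
Variables (R : realType) (d : nat) (s : algaut A) (th : biseq d s).

Definition morfun := forall X Y, rhom X Y -> R.

Definition rank_iso (rho : morfun) :=
  forall X Y X' Y' (f : rhom X Y) (g : rhom X' Y')
    (psi : rhom X X') (phi : rhom Y Y'), is_riso psi -> is_riso phi ->
    rcomp phi f = rcomp g psi -> rho _ _ f = rho _ _ g.

Definition rank_sum (rho : morfun) :=
  forall X Y X' Y' (f : rhom X Y) (g : rhom X' Y'),
    rho (psum X X') (psum Y Y') (rsum_map f g) = rho _ _ f + rho _ _ g.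

Definition rank_angle (rho : morfun) :=
  forall (X : nat -> projA A) (x : forall i, rhom (X i) (X i.+1))
    (xl : rhom (X d.+1) (Sigma s (X 0%N))), angle th x xl ->
    (forall i, (i < d)%N ->
       rho _ _ (x i) - rho _ _ (rid (X i.+1)) + rho _ _ (x i.+1) = 0) /\
    rho _ _ (x d) - rho _ _ (rid (X d.+1)) + rho _ _ xl = 0.

Definition rank_shift (rho : morfun) :=
  forall X Y (f : rhom X Y),
    rho (Sigma s X) (Sigma s Y) (Sigma_map s f) = rho _ _ f.

Definition is_rank (rho : morfun) :=
  [/\ forall X Y (f : rhom X Y), 0 <= rho _ _ f,
      rank_iso rho, rank_sum rho, rank_angle rho & rank_shift rho].

Definition rank_integral (rho : morfun) :=
  forall X Y (f : rhom X Y), rho _ _ f \is a Num.int.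

Definition rank_zero (rho : morfun) := forall X Y (f : rhom X Y), rho _ _ f = 0.

Definition rank_irreducible (rho : morfun) :=
  [/\ is_rank rho, ~ rank_zero rho, rank_integral rho
    & forall rho1 rho2 : morfun,
        is_rank rho1 -> rank_integral rho1 ->
        is_rank rho2 -> rank_integral rho2 ->
        (forall X Y (f : rhom X Y), rho _ _ f = rho1 _ _ f + rho2 _ _ f) ->
        rank_zero rho1 \/ rank_zero rho2].

End Rank.
End Angles.

Record ftr (k : fieldType) (A : falgType k) := Ftr {
  fob :> projA A -> zmodType;
  fmor : forall X Y : projA A, rhom X Y -> {additive fob Y -> fob X};
  fmor_id : forall X (u : fob X), fmor (rid X) u = u;
  fmor_comp : forall (X Y Z : projA A) (g : rhom Y Z) (f : rhom X Y) (u : fob Z),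
    fmor (rcomp g f) u = fmor f (fmor g u);
  fmorD : forall (X Y : projA A) (f g : rhom X Y) (u : fob Y),
    fmor (f + g) u = fmor f u + fmor g u }.

Record ntr (k : fieldType) (A : falgType k) (F G : ftr A) := Ntr {
  ntr_fun :> forall X, {additive F X -> G X};
  ntr_nat : forall (X Y : projA A) (f : rhom X Y) (u : F Y),
    ntr_fun X (fmor F f u) = fmor G f (ntr_fun Y u) }.

Section Image.
Variables (U V : zmodType) (f : {additive U -> V}).
Record imT := ImT { im_val :> V; imP : `[< exists u, f u = im_val >] }.
Definition im_pred : {pred V} := fun v => `[< exists u, f u = v >].
HB.instance Definition _ := [isSub for im_val].
HB.instance Definition _ := [Choice of imT by <:].
Lemma im_zmod : zmod_closed im_pred.
Proof.
split; first by apply/asboolP; exists 0; rewrite raddf0.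
move=> _ _ /asboolP[u <-] /asboolP[v <-]; apply/asboolP.
by exists (u - v); rewrite raddfB.
Qed.
HB.instance Definition _ := GRing.SubChoice_isSubZmodule.Build _ im_pred imT im_zmod.
End Image.

Section Functors.
Variables (k : fieldType) (A : falgType k).
Implicit Types (X Y Z W K : projA A) (F G H : ftr A).

Definition mk_additive (U V : zmodType) (f : U -> V) (fP : zmod_morphism f) :
  {additive U -> V} := HB.pack f (GRing.isZmodMorphism.Build U V f fP).

(* The representable functor Hom(-, X) on proj A. *)
Section Yoneda.
Variable X : projA A.
Lemma yo_additive Y Z (f : rhom Y Z) :
  zmod_morphism (fun h : rhom Z X => rcomp h f).
Proof. by move=> g h; apply: rhom_ext => y; rewrite rcompE !rhomB !rcompE. Qed.
Lemma yo_id Y (u : rhom Y X) : rcomp u (rid Y) = u.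
Proof. by apply: rhom_ext => y; rewrite rcompE ridE. Qed.
Lemma yo_comp Y Z W (g : rhom Z W) (f : rhom Y Z) (u : rhom W X) :
  rcomp u (rcomp g f) = rcomp (rcomp u g) f.
Proof. by apply: rhom_ext => y; rewrite !rcompE. Qed.
Lemma yo_D Y Z (f g : rhom Y Z) (u : rhom Z X) :
  rcomp u (f + g) = rcomp u f + rcomp u g.
Proof.
by apply: rhom_ext => y; rewrite rhomD !rcompE rhomD rhom_add.
Qed.
Definition yo : ftr A :=
  @Ftr k A (fun Y => rhom Y X : zmodType)
    (fun Y Z f => mk_additive (yo_additive f))
    yo_id (fun Y Z W g f u => yo_comp g f u) (fun Y Z f g u => yo_D f g u).
End Yoneda.

Section YonedaMap.
Variables (X Y : projA A) (f : rhom X Y).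
Lemma yo_map_additive Z : zmod_morphism (fun h : rhom Z X => rcomp f h).
Proof.
move=> g h; apply: rhom_ext => z.
by rewrite rcompE !rhomB !rcompE linearB.
Qed.
Definition yo_map : ntr (yo X) (yo Y) :=
  @Ntr k A (yo X) (yo Y) (fun Z => mk_additive (@yo_map_additive Z))
    (fun Z W g u => yo_comp _ _ _).
End YonedaMap.

Definition ntr_surj F G (p : ntr F G) := forall X v, exists u, p X u = v.
Definition ntr_inj F G (p : ntr F G) := forall X, injective (p X).
Definition ntr_exact F G H (i : ntr F G) (p : ntr G H) :=
  forall X v, p X v = 0 <-> exists u, i X u = v.

Definition fiso F G := exists (a : ntr F G) (b : ntr G F),
  (forall X u, b X (a X u) = u) /\ (forall X u, a X (b X u) = u).

Definition finpres F := exists X Y (q : ntr (yo X) (yo Y)) (p : ntr (yo Y) F),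
  ntr_exact q p /\ ntr_surj p.

Section ImageFunctor.
Variables (F G : ftr A) (q : ntr F G).
Let iob X : zmodType := imT (q X).
Lemma imF_subproof X Y (f : rhom X Y) (u : iob Y) :
  `[< exists v, q X v = fmor G f (im_val u) >].
Proof.
case: u => u /= /asboolP[v <-]; apply/asboolP; exists (fmor F f v).
by rewrite ntr_nat.
Qed.
Lemma imF_additive X Y (f : rhom X Y) :
  zmod_morphism (fun u : iob Y => ImT (imF_subproof f u) : iob X).
Proof. by move=> u v; apply: val_inj; rewrite /= raddfB. Qed.
Let imor X Y (f : rhom X Y) : {additive iob Y -> iob X} :=
  mk_additive (imF_additive f).
Lemma imF_id X (u : iob X) : imor (rid X) u = u.
Proof. by apply: val_inj; rewrite /= fmor_id. Qed.
Lemma imF_comp X Y Z (g : rhom Y Z) (f : rhom X Y) (u : iob Z) :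
  imor (rcomp g f) u = imor f (imor g u).
Proof. by apply: val_inj; rewrite /= fmor_comp. Qed.
Lemma imF_D X Y (f g : rhom X Y) (u : iob Y) : imor (f + g) u = imor f u + imor g u.
Proof. by apply: val_inj; rewrite /= fmorD. Qed.
Definition imF : ftr A := Ftr imF_id imF_comp imF_D.
End ImageFunctor.

Lemma weak_kernel X Y (f : rhom X Y) :
  exists K (j : rhom K X), forall Z (h : rhom Z X),
    rcomp f h = 0 <-> exists l : rhom Z K, rcomp j l = h.
Proof.
have kS (x : X) a : x \in lker f -> ract x a \in lker f.
  by rewrite !memv_ker rhom_act => /eqP ->; rewrite ract0l.
pose N := submod kS; pose g := free_map (fun i => tnth (vbasis {: N}) i).
have sg : rsurj g := rfree_cover N.
exists (ProjA (@rfree_proj k A _)), (rcomp (subinc kS) g) => Z h; split.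
  move=> fh; have hk z : h z \in lker f by rewrite memv_ker -rcompE fh rhom0.
  have h1l : linear (fun z => Subvs (hk z) : N).
    by move=> c u v; apply: val_inj; rewrite /= rhom_add rhom_scale.
  have h1a z a : (Subvs (hk (ract z a)) : N) = ract (Subvs (hk z) : N) a.
    by apply: val_inj; rewrite /= rhom_act.
  have [l lE] := pcarP Z _ _ g (mk_rhom h1l h1a) sg.
  exists l; apply: rhom_ext => z; rewrite !rcompE -[g _]rcompE lE !mk_rhomE.
  by [].
move=> [l <-]; apply: rhom_ext => z; rewrite !rcompE rhom0 mk_rhomE.
by apply/eqP; rewrite -memv_ker; apply: subvsP.
Qed.

Lemma imF_finpres X Y (f : rhom X Y) : finpres (imF (yo_map f)).
Proof.
have [K [j jP]] := weak_kernel f.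
have iP Z (u : yo X Z) : `[< exists v, yo_map f Z v = yo_map f Z u >].
  by apply/asboolP; exists u.
have iA Z : zmod_morphism (fun u : yo X Z => ImT (iP Z u) : imF (yo_map f) Z).
  by move=> u v; apply: val_inj; exact: (raddfB (yo_map f Z)).
have iN Z W (g : rhom Z W) (u : yo X W) :
    mk_additive (iA Z) (fmor (yo X) g u) = fmor (imF (yo_map f)) g (mk_additive (iA W) u).
  by apply: val_inj; rewrite /= yo_comp.
exists K, X, (yo_map j), (@Ntr k A (yo X) (imF (yo_map f)) (fun Z => mk_additive (iA Z)) iN).
split=> [Z v|Z [v vP]].
  split=> [/(congr1 val) e|/(jP _ v).2 e].
    by apply/(jP _ v).1; exact: e.
  by apply: val_inj.
by have /asboolP[u uE] := vP; exists u; apply: val_inj.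
Qed.

End Functors.

Record modC (k : fieldType) (A : falgType k) := ModC {
  mfun :> ftr A;
  mfunP : finpres mfun }.

Definition imC (k : fieldType) (A : falgType k) (X Y : projA A) (f : rhom X Y) :
  modC A := ModC (imF_finpres f).

Section Shift.
Variables (k : fieldType) (A : falgType k) (t : algaut A).

Implicit Types (X Y Z W P Q : projA A).

Section ShiftFunctor.
Variable M : ftr A.
Let sob X := M (Sigma t X).
Let smor X Y (f : rhom X Y) : {additive sob Y -> sob X} := fmor M (Sigma_map t f).
Lemma shiftF_id X (u : sob X) : smor (rid X) u = u.
Proof. by rewrite /smor Sigma_map_id fmor_id. Qed.
Lemma shiftF_comp X Y Z (g : rhom Y Z) (f : rhom X Y) (u : sob Z) :
  smor (rcomp g f) u = smor f (smor g u).
Proof. by rewrite /smor Sigma_map_comp fmor_comp. Qed.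
Lemma shiftF_D X Y (f g : rhom X Y) (u : sob Y) :
  smor (f + g) u = smor f u + smor g u.
Proof. by rewrite /smor Sigma_mapD fmorD. Qed.
(* M precomposed with - (x) _t A_1. *)
Definition shiftF : ftr A := Ftr shiftF_id shiftF_comp shiftF_D.
End ShiftFunctor.

Let ti := aut_inv t.
Let tiK a : t (ti a) = a := autVK t a.
Let tK a : ti (t a) = a := autK t a.

Section Counit.
Variable X : rmod A.
Let e0 (x : X) (y : twist ti) : restr t X := ract x (t y).
Lemma e0_bal : balanced e0.
Proof.
split=> [y|x|x a y]; first by move=> c x x'; rewrite /e0 ract_linl.
  by move=> c y y'; rewrite /e0 linearP ract_linr.
by rewrite /e0 (_ : t (lact a y) = a * t y) ?ractM // -[in RHS](tiK a) -rmorphM.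
Qed.
Lemma e0_act x y a : e0 x (ract y a) = ract (e0 x y) a.
Proof. by rewrite /e0 /= rmorphM ractM. Qed.
Definition cou0 : rhom (tens X (twist ti)) (restr t X) := tens_lift e0_bal e0_act.
Lemma cou0E x y : cou0 (pure x y) = ract (x : X) (t y).
Proof. exact: tens_liftE. Qed.
Let e1 (u : tens X (twist ti)) (z : twist t) : X := ract (cou0 u : X) z.
Lemma e1_bal : balanced e1.
Proof.
split=> [z|u|u a z].
- by move=> c u v; rewrite /e1 rhom_add rhom_scale ract_linl.
- by move=> c z z'; rewrite /e1 ract_linr.
by rewrite /e1 rhom_act /= -ractM.
Qed.
Lemma e1_act u z a : e1 u (ract z a) = ract (e1 u z) a.
Proof. by rewrite /e1 /= ractM. Qed.
Definition counit : rhom (tens (tens X (twist ti)) (twist t)) X :=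
  tens_lift e1_bal e1_act.
Lemma counitE u z : counit (pure u z) = ract (cou0 u : X) z.
Proof. exact: tens_liftE. Qed.
End Counit.

Definition adj P X (h : rhom P (Sigma ti X)) : rhom (Sigma t P) X :=
  rcomp (counit X) (Sigma_map t h).

Definition adjV P X (g : rhom (Sigma t P) X) : rhom P (Sigma ti X) :=
  rcomp (Sigma_map ti g) (tens_unit t P).

Lemma adjE P X (h : rhom P (Sigma ti X)) p z :
  adj h (pure p z) = ract (cou0 X (h p) : X) z.
Proof. by rewrite rcompE tens_mapE counitE. Qed.

Lemma adjVE P X (g : rhom (Sigma t P) X) p :
  adjV g p = pure (g (pure p (1 : twist t))) (1 : twist ti).
Proof.
rewrite rcompE (_ : tens_unit t P p = pure (pure p (1 : twist t) : tens P (twist t))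
  (1 : twist ti)); first exact: tens_mapE.
exact: mk_rhomE.
Qed.

Lemma adjK P X (h : rhom P (Sigma ti X)) : adjV (adj h) = h.
Proof.
apply: rhom_ext => p; rewrite adjVE adjE ract1.
move: (h p); apply: (@tens_ind _ _ _ _ _ (fun u : tens X (twist ti) =>
  pure (cou0 X u : X) (1 : twist ti)) id) => //.
  by move=> c x y; rewrite rhom_add rhom_scale pure_lin1.
move=> x y; rewrite cou0E pure_bal; congr pure.
by rewrite -[RHS]mulr1 -[X in _ = X * _]tK.
Qed.

Lemma adjVK P X (g : rhom (Sigma t P) X) : adj (adjV g) = g.
Proof.
apply: tens_ext => p z; rewrite adjE adjVE cou0E rmorph1 ract1.
by rewrite -rhom_act tens_act_pure /= mul1r.
Qed.

Lemma adj_natl P Q X (h : rhom Q (Sigma ti X)) (r : rhom P Q) :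
  adj (rcomp h r) = rcomp (adj h) (Sigma_map t r).
Proof.
apply: tens_ext => p z; rewrite [RHS]rcompE (_ : Sigma_map t r _ = pure (r p) z).
  by rewrite !adjE rcompE.
exact: tens_mapE.
Qed.

Lemma adj_natr P X Y (f : rhom X Y) (h : rhom P (Sigma ti X)) :
  adj (rcomp (Sigma_map ti f) h) = rcomp f (adj h).
Proof.
apply: tens_ext => p z; rewrite [RHS]rcompE !adjE rcompE rhom_act; congr ract.
move: (h p); apply: (@tens_ind _ _ _ _ _
  (fun u : tens X (twist ti) => cou0 Y (Sigma_map ti f u) : Y)
  (fun u : tens X (twist ti) => f (cou0 X u : X))).
- by move=> c x y; rewrite !rhom_add !rhom_scale.
- by move=> c x y; rewrite !rhom_add !rhom_scale.
by move=> x y; rewrite tens_mapE !cou0E rhom_act.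
Qed.

Lemma adjB P X (h h' : rhom P (Sigma ti X)) : adj (h - h') = adj h - adj h'.
Proof.
apply: tens_ext => p z; rewrite rhomB !adjE rhomB -ractBl.
by rewrite -scaleN1r addrC rhom_add rhom_scale addrC scaleN1r.
Qed.

Lemma shiftF_finpres (M : ftr A) : finpres M -> finpres (shiftF M).
Proof.
move=> [X [Y [q [p [qp ps]]]]].
pose f : rhom X Y := q X (rid X).
have qE Z (u : rhom Z X) : q Z u = rcomp f u.
  have := ntr_nat q u (rid X); rewrite /= => <-.
  by congr (q Z _); apply: rhom_ext => z; rewrite rcompE ridE.
have pA Z : zmod_morphism (fun h : yo (Sigma ti Y) Z => p (Sigma t Z) (adj h)).
  move=> h h'; rewrite (adjB h h'); exact: raddfB.
have pN Z W (g : rhom Z W) (u : yo (Sigma ti Y) W) :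
    mk_additive (pA Z) (fmor (yo (Sigma ti Y)) g u) =
    fmor (shiftF M) g (mk_additive (pA W) u).
  rewrite /= adj_natl; exact: (ntr_nat p (Sigma_map t g) (adj u)).
exists (Sigma ti X), (Sigma ti Y), (yo_map (Sigma_map ti f)).
exists (@Ntr k A (yo (Sigma ti Y)) (shiftF M) (fun Z => mk_additive (pA Z)) pN).
split=> [Z v|Z v]; last first.
  have [u <-] := ps _ v; exists (adjV u); congr (p _ _); exact: adjVK.
split=> [/(qp (Sigma t Z) (adj v)).1 [u uE]|[u <-]].
  exists (adjV u); rewrite -[RHS]adjK -uE qE -{2}[u]adjVK -adj_natr adjK.
  by [].
apply/(qp (Sigma t Z) _).2; exists (adj u); rewrite qE; exact/esym/adj_natr.
Qed.

Definition shiftC (M : modC A) : modC A := ModC (shiftF_finpres (mfunP M)).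

End Shift.

Section Additive.
Variables (k : fieldType) (A : falgType k) (R : realType) (s : algaut A).
Implicit Types (al : modC A -> R).

(* proj A has weak kernels (weak_kernel), so mod (proj A) is closed under
   kernels and cokernels of functors: its exactness is objectwise. *)
Definition is_additive al :=
  [/\ forall M, 0 <= al M,
      forall M N : modC A, fiso M N -> al M = al N
    & forall (L M N : modC A) (i : ntr L M) (p : ntr M N),
        ntr_inj i -> ntr_exact i p -> ntr_surj p -> al M = al L + al N].

(* M |-> M o Sigma^-1 *)
Definition SS (M : modC A) : modC A := shiftC (aut_inv s) M.

Definition S_invariant al := forall M, al (SS M) = al M.

Definition add_integral al := forall M, al M \is a Num.int.

Definition add_zero al := forall M, al M = 0.

Definition S_irreducible al :=
  [/\ is_additive al, S_invariant al, ~ add_zero al, add_integral al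
    & forall al1 al2,
        is_additive al1 -> S_invariant al1 -> add_integral al1 ->
        is_additive al2 -> S_invariant al2 -> add_integral al2 ->
        (forall M, al M = al1 M + al2 M) ->
        add_zero al1 \/ add_zero al2].

End Additive.

Definition Sadd (R : realType) (k : fieldType) (A : falgType k) (s : algaut A) :=
  {al : modC A -> R | is_additive al /\ S_invariant s al}.

Definition rankf (R : realType) (k : fieldType) (A : falgType k) (d : nat)
    (s : algaut A) (th : biseq d s) :=
  {rho : morfun A R | is_rank th rho}.

(* Main.v *)
Require Import Defs.
From HB Require Import structures.
From mathcomp Require Import all_boot all_order all_algebra falgebra.
From mathcomp Require Import boolp reals lra.

Set Implicit Arguments.
Unset Strict Implicit.
Unset Printing Implicit Defensive.

Import GRing.Theory Num.Theory.
Local Open Scope ring_scope.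

(* Write Im f for the image of Hom(-,f).  Since Hom(P,-) is exact for P
   projective, an exact pair X -f-> Y -g-> Z yields a short exact sequence
   0 -> Im f -> Hom(-,Y) -> Im g -> 0, so an additive function gives a rank
   function.

   Conversely let rho be a rank function.  The angles with terms
   P, 0, ..., 0, P (up to shift) force rho to vanish on P -> 0 and 0 -> P, so
   rho f depends only on the image of f, and, projectives being injective, only
   on the kernel of f; hence rho f depends only on Im f.  The angles given by
   C (x) theta and Schanuel's lemma show rho g + rho f = rho 1_P for every exact
   W -g-> P -f-> Q in proj A.  Applying this along M (x) theta, where f factors
   as X ->> M >-> Y, leads from f to Sigma^-1 f, which has the same rank, in
   d + 2 steps:
     rho f = sum_i (-1)^i rho 1_(M (x) P_i) + (-1)^(d+2) rho f.
   As d is odd, 2 rho f is the alternating sum, and this is additive in M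
   because M |-> M (x) P_i is exact with projective values. *)

(** * Right modules *)

(** The obstacle is that (RM2) speaks only about angles. It gives additivity for short exact
    sequences of functors with representable middle term, whereas all short exact sequences have to
    be handled. The Euler characteristic trades the rank of an arbitrary image for ranks of
    identities of projectives, whose additivity does follow from exact pairs. An angle moreover has
    a prescribed class in Ext^{d+2}, so a given exact pair need not lie in one; only the class of C
    (x) theta is at hand, for C the cokernel of the pair, and Schanuel's lemma is what compares two
    presentations of C. The facts about modules come from theta as well. Over A^op it is an exact
    sequence of projectives ending in A, hence contractible, and so it stays exact under M (x) -.
    Its first map yields a natural embedding of every module into a projective one, and this is how
    projectives are seen to be injective. *)

Section ModuleLemmas.
Variables (k : fieldType) (A : falgType k).
Implicit Types L M N P X Y Z : rmod A.

Lemma rexactP X Y Z (f : rhom X Y) (g : rhom Y Z) :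
  rexact f g <-> forall y, g y = 0 <-> exists x, f x = y.
Proof.
split=> [e y|h].
  split=> [gy|[x <-]].
    have : y \in limg f by rewrite e memv_ker gy.
    by case/memv_imgP=> x _ ->; exists x.
  by apply/eqP; rewrite -memv_ker -e memv_img ?memvf.
apply/vspaceP => y; rewrite memv_ker; apply/idP/eqP.
  by case/memv_imgP=> x _ ->; apply/h; exists x.
by case/h => x <-; rewrite memv_img ?memvf.
Qed.

Lemma rinjP X Y (f : rhom X Y) : rinj f <-> forall x, f x = 0 -> x = 0.
Proof.
split=> [e x fx|h].
  by apply/eqP; rewrite -memv0 -e memv_ker fx.
apply/vspaceP => x; rewrite memv_ker memv0; apply/eqP/eqP => [|->]; first exact: h.
exact: linear0.
Qed.

Lemma rhom_is0 X Y (f : rhom X Y) : f 0 = 0.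
Proof. exact: linear0. Qed.

Lemma rhom_sub X Y (f : rhom X Y) x y : f (x - y) = f x - f y.
Proof. exact: linearB. Qed.

Lemma rhom_eq X Y (f g : rhom X Y) x : f = g -> f x = g x.
Proof. by move=> ->. Qed.

Lemma rhomN X Y (f : rhom X Y) x : (- f) x = - f x.
Proof. exact: opp_lfunE. Qed.

Lemma rcompA W X Y Z (h : rhom Y Z) (g : rhom X Y) (f : rhom W X) :
  rcomp h (rcomp g f) = rcomp (rcomp h g) f.
Proof. by apply: rhom_ext => x; rewrite !rcompE. Qed.

Lemma rcomp1f X Y (f : rhom X Y) : rcomp (rid Y) f = f.
Proof. by apply: rhom_ext => x; rewrite rcompE ridE. Qed.

Lemma rcompf1 X Y (f : rhom X Y) : rcomp f (rid X) = f.
Proof. by apply: rhom_ext => x; rewrite rcompE ridE. Qed.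

Lemma rcomp0f X Y Z (f : rhom X Y) : rcomp (0 : rhom Y Z) f = 0.
Proof. by apply: rhom_ext => x; rewrite rcompE !rhom0. Qed.

Lemma rcompf0 X Y Z (f : rhom Y Z) : rcomp f (0 : rhom X Y) = 0.
Proof. by apply: rhom_ext => x; rewrite rcompE !rhom0 rhom_is0. Qed.

Lemma is_riso_id X : is_riso (rid X).
Proof. by exists (rid X); rewrite rcomp1f. Qed.

Lemma is_riso_bij X Y (f : rhom X Y) :
  (forall x, f x = 0 -> x = 0) -> (forall y, exists x, f x = y) -> is_riso f.
Proof.
move=> fi fs; have [h hE] := choice fs.
have inj x y : f x = f y -> x = y.
  by move=> e; apply/eqP; rewrite -subr_eq0; apply/eqP/fi; rewrite rhom_sub e subrr.
have hl : linear h.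
  by move=> c x y; apply: inj; rewrite rhom_add rhom_scale !hE.
have ha y a : h (ract y a) = ract (h y) a by apply: inj; rewrite rhom_act !hE.
exists (mk_rhom hl ha); split; apply: rhom_ext => x; rewrite rcompE mk_rhomE ridE //.
by apply: inj; rewrite hE.
Qed.

Lemma is_riso_inj X Y (f : rhom X Y) : is_riso f -> forall x, f x = 0 -> x = 0.
Proof.
by move=> [g [e _]] x fx; rewrite -(ridE x) -e rcompE fx rhom_is0.
Qed.

Lemma factor_surj X M N (e : rhom X M) (g : rhom X N) :
  (forall y, exists x, e x = y) -> (forall x, e x = 0 -> g x = 0) ->
  exists h : rhom M N, rcomp h e = g.
Proof.
move=> es eg; have [s sE] := choice es.
have gE x y : e x = e y -> g x = g y.
  move=> exy; apply/eqP; rewrite -subr_eq0 -rhom_sub; apply/eqP/eg.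
  by rewrite rhom_sub exy subrr.
have hl : linear (fun m => g (s m)).
  by move=> c x y; rewrite -rhom_scale -rhom_add; apply: gE;
     rewrite rhom_add rhom_scale !sE.
have ha m a : g (s (ract m a)) = ract (g (s m)) a.
  by rewrite -rhom_act; apply: gE; rewrite rhom_act !sE.
by exists (mk_rhom hl ha); apply: rhom_ext => x; rewrite rcompE mk_rhomE; apply: gE.
Qed.

Lemma factor_inj X M N (m : rhom M X) (g : rhom N X) :
  (forall y, m y = 0 -> y = 0) -> (forall x, exists y, m y = g x) ->
  exists h : rhom N M, rcomp m h = g.
Proof.
move=> mi mg; have [s sE] := choice mg.
have inj x y : m x = m y -> x = y.
  by move=> e; apply/eqP; rewrite -subr_eq0; apply/eqP/mi; rewrite rhom_sub e subrr.
have hl : linear s.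
  by move=> c x y; apply: inj; rewrite rhom_add rhom_scale !sE rhom_add rhom_scale.
have ha x a : s (ract x a) = ract (s x) a by apply: inj; rewrite rhom_act !sE rhom_act.
by exists (mk_rhom hl ha); apply: rhom_ext => x; rewrite rcompE mk_rhomE.
Qed.

Lemma image_factor X Y (f : rhom X Y) : exists M (e : rhom X M) (m : rhom M Y),
  [/\ forall y, exists x, e x = y, forall y, m y = 0 -> y = 0 & rcomp m e = f].
Proof.
have US (y : Y) a : y \in limg f -> ract y a \in limg f.
  by case/memv_imgP=> x _ ->; rewrite -rhom_act memv_img ?memvf.
have mi y : subinc US y = 0 -> y = 0.
  by rewrite mk_rhomE => h; apply: val_inj.
have [|e eE] := @factor_inj Y _ _ (subinc US) f mi.
  move=> x; have h : f x \in limg f by rewrite memv_img ?memvf.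
  by exists (Subvs h); rewrite mk_rhomE.
exists (submod US), e, (subinc US); split=> // y.
have /memv_imgP[x _ xE] : subinc US y \in limg f by rewrite mk_rhomE; apply: subvsP.
exists x; apply/eqP; rewrite -subr_eq0; apply/eqP/mi.
by rewrite rhom_sub -rcompE eE xE subrr.
Qed.

Lemma kernel_ex X Y (f : rhom X Y) : exists M (m : rhom M X),
  (forall y, m y = 0 -> y = 0) /\ rexact m f.
Proof.
have kS (x : X) a : x \in lker f -> ract x a \in lker f.
  by rewrite !memv_ker rhom_act => /eqP ->; rewrite ract0l.
exists (submod kS), (subinc kS); split.
  by move=> y; rewrite mk_rhomE => h; apply: val_inj.
apply/rexactP => y; split=> [fy|[x <-]].
  have h : y \in lker f by rewrite memv_ker fy.
  by exists (Subvs h); rewrite mk_rhomE.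
by rewrite mk_rhomE; apply/eqP; rewrite -memv_ker; apply: subvsP.
Qed.

Section Quotient.
Variables (M : rmod A) (U : {vspace M}).
Hypothesis US : forall x a, x \in U -> ract x a \in U.

(** The quotient M/U is carried by a complement of U, with [pr] the projection along U; the action
    is the old one followed by [pr]. *)
Let pr (x : M) : subvs_of (U^C)%VS := vsproj _ (daddv_pi (U^C) U x).

Let pr_lin : linear pr.
Proof. by move=> c x y; rewrite /pr !linearP. Qed.

Let capCU : (U^C :&: U = 0)%VS.
Proof. by rewrite capvC capv_compl. Qed.

Let pr_val (u : subvs_of (U^C)%VS) : pr (vsval u) = u.
Proof.
apply: val_inj; rewrite /= vsprojK ?memv_pi // daddv_pi_id ?capCU //.
exact: subvsP.
Qed.

Let pr_mod x : x - vsval (pr x) \in U.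
Proof.
rewrite vsprojK ?memv_pi //.
have tC : x \in (U^C + U)%VS by rewrite addvC addv_complf memvf.
by rewrite -[X in X - _](daddv_pi_add capCU tC) addrC addKr memv_pi.
Qed.

Let prB x y : pr (x - y) = pr x - pr y.
Proof. by have := pr_lin (-1) y x; rewrite !scaleN1r !(addrC (- _)). Qed.

Let pr_eq0 x : (pr x == 0) = (x \in U).
Proof.
apply/eqP/idP => [h|h].
  by have := pr_mod x; rewrite h subr0.
have h1 : vsval (pr x) \in U by rewrite -[vsval _](subKr x) rpredB.
apply/val_inj/eqP; rewrite /= -memv0 -capCU memv_cap h1 andbT.
exact: subvsP.
Qed.

Let pr_eq x y : x - y \in U -> pr x = pr y.
Proof. by rewrite -pr_eq0 prB subr_eq0 => /eqP. Qed.

Let qact (u : subvs_of (U^C)%VS) (a : A) := pr (ract (vsval u) a).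

Let qact_pr x a : qact (pr x) a = pr (ract x a).
Proof. by apply/esym/pr_eq; rewrite -ractBl US. Qed.

Let q_linl a : linear (qact^~ a).
Proof. by move=> c u v; rewrite /qact linearP ract_linl pr_lin. Qed.
Let q_linr u : linear (qact u).
Proof. by move=> c a b; rewrite /qact ract_linr pr_lin. Qed.
Let q_1 u : qact u 1 = u.
Proof. by rewrite /qact ract1. Qed.
Let q_M u a b : qact u (a * b) = qact (qact u a) b.
Proof. by rewrite [qact u a]/qact qact_pr -ractM. Qed.

Lemma quotient_ex : exists (N : rmod A) (p : rhom M N),
  (forall y, exists x, p x = y) /\ forall x, p x = 0 <-> x \in U.
Proof.
pose N := RMod q_linl q_linr q_1 q_M.
have pa x a : (pr (ract x a) : N) = ract (pr x : N) a by exact/esym/qact_pr.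
exists N, (@mk_rhom k A M N pr pr_lin pa); split=> [y|x].
  by exists (vsval y); rewrite mk_rhomE pr_val.
by rewrite mk_rhomE -pr_eq0; split=> /eqP.
Qed.
End Quotient.

Lemma cokernel_ex X Y (f : rhom X Y) : exists N (p : rhom Y N),
  (forall y, exists x, p x = y) /\ rexact f p.
Proof.
have US (y : Y) a : y \in limg f -> ract y a \in limg f.
  by case/memv_imgP=> x _ ->; rewrite -rhom_act memv_img ?memvf.
have [N [p [ps pE]]] := quotient_ex US.
exists N, p; split=> //; apply/rexactP => y; rewrite pE; split.
  by case/memv_imgP=> x _ ->; exists x.
by move=> [x <-]; rewrite memv_img ?memvf.
Qed.

(** Projectivity against a map that need not be onto: u lands in the image of f, and f is onto its
    image. *)
Lemma rproj_lift P M N (f : rhom M N) (u : rhom P N) : rproj P ->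
  (forall x, exists y, f y = u x) -> exists w : rhom P M, rcomp f w = u.
Proof.
move=> pP fu; have [I [e [m [es mi fE]]]] := image_factor f.
have [u' uE] : exists u', rcomp m u' = u.
  by apply: factor_inj => // x; have [y <-] := fu x; exists (e y); rewrite -fE rcompE.
have [w wE] := pP _ _ e u' ((rsurjP _).2 es).
by exists w; rewrite -fE -rcompA wE.
Qed.

Lemma rproj_retract P Q (i : rhom P Q) (r : rhom Q P) :
  rcomp r i = rid P -> rproj Q -> rproj P.
Proof.
move=> ri pQ M N g f sg; have [h hE] := pQ M N g (rcomp f r) sg.
by exists (rcomp h i); rewrite rcompA hE -rcompA ri rcompf1.
Qed.

Section Pairs.
Variables L M N : rmod A.

Lemma row_lin (f : rhom L N) (g : rhom M N) :
  linear (fun u : rsum L M => f u.1 + g u.2).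
Proof. by move=> c u v; rewrite !linearP scalerDr addrACA. Qed.
Lemma row_act (f : rhom L N) (g : rhom M N) (u : rsum L M) a :
  f (ract u a).1 + g (ract u a).2 = ract (f u.1 + g u.2) a.
Proof. by rewrite /= !rhom_act ractDl. Qed.
Definition row_rhom (f : rhom L N) (g : rhom M N) : rhom (rsum L M) N :=
  mk_rhom (row_lin f g) (row_act f g).
Lemma row_rhomE f g u : row_rhom f g u = f u.1 + g u.2.
Proof. exact: mk_rhomE. Qed.

Lemma col_lin (f : rhom N L) (g : rhom N M) :
  linear (fun x : N => (f x, g x) : rsum L M).
Proof. by move=> c u v; congr pair; rewrite !linearP. Qed.
Lemma col_act (f : rhom N L) (g : rhom N M) x a :
  ((f (ract x a), g (ract x a)) : rsum L M) = ract ((f x, g x) : rsum L M) a.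
Proof. by congr pair; rewrite /= rhom_act. Qed.
Definition col_rhom (f : rhom N L) (g : rhom N M) : rhom N (rsum L M) :=
  mk_rhom (col_lin f g) (col_act f g).
Lemma col_rhomE f g x : col_rhom f g x = (f x, g x).
Proof. exact: mk_rhomE. Qed.
End Pairs.

Lemma rinlE M N x : rinl M N x = (x, 0).
Proof. exact: mk_rhomE. Qed.

Lemma rinrE M N x : rinr M N x = (0, x).
Proof. exact: mk_rhomE. Qed.

Lemma rsum_mapE M N M' N' (f : rhom M N) (g : rhom M' N') u :
  rsum_map f g u = (f u.1, g u.2).
Proof. exact: mk_rhomE. Qed.

Lemma rsum_map_id M N : rsum_map (rid M) (rid N) = rid (rsum M N).
Proof. by apply: rhom_ext => -[x y]; rewrite rsum_mapE !ridE. Qed.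

End ModuleLemmas.

(** * Tensoring with projective bimodules *)

Section LinearFunctions.
Variables (k : fieldType) (U V : lmodType k) (f : U -> V).
Hypothesis fl : linear f.

Definition linear_pack : {linear U -> V} :=
  HB.pack f (GRing.isLinear.Build k U V *:%R f fl).

Lemma lin_sum I r (P : pred I) (F : I -> U) :
  f (\sum_(i <- r | P i) F i) = \sum_(i <- r | P i) f (F i).
Proof. exact: (linear_sum linear_pack). Qed.
Lemma lin0 : f 0 = 0. Proof. exact: (linear0 linear_pack). Qed.
Lemma linZ c x : f (c *: x) = c *: f x. Proof. exact: (linearZ_LR linear_pack). Qed.
Lemma linB x y : f (x - y) = f x - f y. Proof. exact: (linearB linear_pack). Qed.
End LinearFunctions.

Section FreeBimodule.
Variables (k : fieldType) (A : falgType k).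

Local Notation n := (\dim {: A}).
Local Notation a_ i := ((vbasis {: A})`_i).
Local Notation c_ i x := (coord (vbasis {: A}) i x).

Lemma coord_sum (E : vectType k) (V : lmodType k) (F : E -> V) (x : E) :
  linear F ->
  \sum_(i < \dim {: E}) coord (vbasis {: E}) i x *: F (vbasis {: E})`_i = F x.
Proof.
move=> Fl; rewrite [in RHS](coord_vbasis (memvf x)) (lin_sum Fl).
by apply: eq_bigr => i _; rewrite (linZ Fl).
Qed.

Lemma coord_delta (E : vectType k) (i j : 'I_(\dim {: E})) :
  coord (vbasis {: E}) i (vbasis {: E})`_j = (i == j)%:R.
Proof. by rewrite coord_free ?(basis_free (vbasisP _)) // eq_sym. Qed.

Variable W : rmod A.

Let fact (u : {ffun 'I_n -> W}) (a : A) : {ffun 'I_n -> W} :=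
  [ffun i => ract (u i) a].
Let fact_linl a : linear (fact^~ a).
Proof. by move=> c u v; apply/ffunP => i; rewrite !ffunE ract_linl. Qed.
Let fact_linr u : linear (fact u).
Proof. by move=> c a b; apply/ffunP => i; rewrite !ffunE ract_linr. Qed.
Let fact_1 u : fact u 1 = u.
Proof. by apply/ffunP => i; rewrite !ffunE ract1. Qed.
Let fact_M u a b : fact u (a * b) = fact (fact u a) b.
Proof. by apply/ffunP => i; rewrite !ffunE ractM. Qed.
Let F0 : rmod A := RMod fact_linl fact_linr fact_1 fact_M.

(** Left multiplication on the coordinates of sum a_i (x) u_i: each b a_i is expanded in the basis
    again and the scalars are moved to the u_i. *)
Let fl (b : A) (u : F0) : F0 := 
  [ffun j => \sum_(i < n) c_ j (b * a_ i) *: (u : {ffun 'I_n -> W}) i].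
Let fl_linl u : linear (fl^~ u).
Proof.
move=> c a b; apply/ffunP => j; rewrite !ffunE scaler_sumr -big_split.
by apply: eq_bigr => i _; rewrite mulrDl linearD -scalerAl linearZ scalerDl scalerA.
Qed.
Let fl_linr b : linear (fl b).
Proof.
move=> c u v; apply/ffunP => j; rewrite !ffunE scaler_sumr -big_split.
by apply: eq_bigr => i _; rewrite !ffunE scalerDr !scalerA mulrC.
Qed.
Let fl_1 u : fl 1 u = u.
Proof.
apply/ffunP => j; rewrite ffunE (bigD1 j) //= big1 => [|i /negbTE ij].
  by rewrite mul1r coord_delta eqxx scale1r addr0.
by rewrite mul1r coord_delta eq_sym ij scale0r.
Qed.
Let fl_M a b u : fl (a * b) u = fl a (fl b u).
Proof.
apply/ffunP => j; rewrite !ffunE.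
under [RHS]eq_bigr => l _ do rewrite ffunE scaler_sumr.
rewrite exchange_big; apply: eq_bigr => i _.
under eq_bigr => l _ do rewrite scalerA mulrC -scalerA.
rewrite -mulrA.
apply/esym/(@coord_sum _ _ (fun y => c_ j (a * y) *: u i)) => e x y.
by rewrite mulrDr linearD -scalerAr linearZ scalerDl scalerA.
Qed.
Let fl_A a u b : ract (fl a u) b = fl a (ract u b).
Proof.
apply/ffunP => j; rewrite !ffunE (lin_sum (ract_linl b)).
by apply: eq_bigr => i _; rewrite ffunE ractZl.
Qed.

(* The bimodule A (x)_k W, an element sum_i a_i (x) u_i being represented by
   its coordinates u_i in the basis a_i of A. *)
Definition freebimod : bimod A := BiMod fl_linl fl_linr fl_1 fl_M fl_A.

(** The element 1 (x) w. *)
Definition bin (w : W) : freebimod := [ffun i => c_ i 1 *: w].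

Lemma bin_lin : linear bin.
Proof. by move=> c x y; apply/ffunP => i; rewrite !ffunE scalerDr !scalerA mulrC. Qed.

Lemma bin_act w a : bin (ract w a) = ract (bin w) a.
Proof. by apply/ffunP => i; rewrite !ffunE ractZl. Qed.

Lemma lact_bin (i : 'I_n) w :
  lact (a_ i) (bin w) = ([ffun j => (j == i)%:R *: w] : {ffun 'I_n -> W}).
Proof.
apply/ffunP => j; rewrite !ffunE.
transitivity (\sum_(l < n) c_ l 1 *: (c_ j (a_ i * a_ l) *: w)).
  by apply: eq_bigr => l _; rewrite ffunE !scalerA mulrC.
rewrite (@coord_sum _ _ (fun y => c_ j (a_ i * y) *: w)) ?mulr1 ?coord_delta //.
by move=> e x y; rewrite mulrDr linearD -scalerAr linearZ scalerDl scalerA.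
Qed.

Lemma freebimod_dec (u : freebimod) :
  u = \sum_(i < n) lact (a_ i) (bin ((u : {ffun 'I_n -> W}) i)).
Proof.
under eq_bigr => i _ do rewrite lact_bin.
apply/ffunP => j; rewrite sum_ffunE (bigD1 j) //= ffunE eqxx scale1r.
rewrite big1 ?addr0 // => i /negbTE ij.
by rewrite ffunE eq_sym ij scale0r.
Qed.

Section Extension.
Variables (X : bimod A) (phi : W -> X).
Hypothesis phil : linear phi.

(** The map a (x) w |-> a phi(w). It is left linear as soon as phi is k-linear, so that k-linear
    choices on W can serve to lift left linear maps. *)
Definition fext (u : freebimod) : X :=
  \sum_(i < n) lact (a_ i) (phi ((u : {ffun 'I_n -> W}) i)).

Lemma fext_lin : linear fext.
Proof.
move=> c u v; rewrite /fext scaler_sumr -big_split; apply: eq_bigr => i _.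
by rewrite !ffunE phil lact_linr.
Qed.

Lemma fext_lact b u : fext (lact b u) = lact b (fext u).
Proof.
rewrite /fext (lin_sum (lact_linr b)).
transitivity (\sum_(j < n) \sum_(i < n)
  c_ j (b * a_ i) *: lact (a_ j) (phi ((u : {ffun 'I_n -> W}) i))).
  apply: eq_bigr => j _; rewrite ffunE (lin_sum phil) (lin_sum (lact_linr _)).
  by apply: eq_bigr => i _; rewrite (linZ phil) (linZ (lact_linr _)).
rewrite exchange_big; apply: eq_bigr => i _.
by rewrite (coord_sum _ (lact_linl _)) lactM.
Qed.

Lemma fext_bin w : fext (bin w) = phi w.
Proof.
transitivity (\sum_(i < n) c_ i 1 *: lact (a_ i) (phi w)).
  by apply: eq_bigr => i _; rewrite ffunE (linZ phil) (linZ (lact_linr _)).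
by rewrite (coord_sum _ (lact_linl _)) lact1.
Qed.
End Extension.

(* tcoord l is the coordinate along the l-th basis vector of W under
   M (x)_A (A (x)_k W) = M (x)_k W. *)
Section TensFree.
Variable M : rmod A.
Let T := tens M freebimod.
Local Notation m := (\dim {: W}).
Local Notation w_ l := ((vbasis {: W})`_l).
Local Notation cw_ l x := (coord (vbasis {: W}) l x).

(** The rule x (x) (a (x) w) |-> h(xa, w), written in the basis of A. *)
Lemma tens_fext (V : lmodType k) (h : M -> W -> V) :
  (forall w, linear (h^~ w)) -> (forall x, linear (h x)) ->
  balanced (fun (x : M) (u : freebimod) =>
    \sum_(i < n) h (ract x (a_ i)) ((u : {ffun 'I_n -> W}) i)).
Proof.
move=> h1 h2; split=> [u|x|x b u].
- move=> c x y; rewrite scaler_sumr -big_split; apply: eq_bigr => i _.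
  by rewrite ract_linl h1.
- move=> c u v; rewrite scaler_sumr -big_split; apply: eq_bigr => i _.
  by rewrite !ffunE h2.
transitivity (\sum_(j < n) \sum_(i < n)
  c_ j (b * a_ i) *: h (ract x (a_ j)) ((u : {ffun 'I_n -> W}) i)); last first.
  apply: eq_bigr => j _; rewrite ffunE (lin_sum (h2 _)).
  by apply: eq_bigr => i _; rewrite (linZ (h2 _)).
rewrite exchange_big; apply: eq_bigr => i _.
rewrite (@coord_sum _ _ (fun y => h (ract x y) ((u : {ffun 'I_n -> W}) i))) ?ractM //.
by move=> e y z; rewrite ract_linr h1.
Qed.

Let hc (l : 'I_m) (x : M) (w : W) : M := cw_ l w *: x.
Let hc1 l w : linear (hc l ^~ w).
Proof. by move=> c x y; rewrite /hc scalerDr !scalerA mulrC. Qed.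
Let hc2 l x : linear (hc l x).
Proof. by move=> c v w; rewrite /hc linearD linearZ scalerDl scalerA. Qed.

Definition tcoord (l : 'I_m) (t : T) : M := tens_lift_fun
  (fun (x : M) (u : freebimod) => \sum_(i < n) hc l (ract x (a_ i)) ((u : {ffun 'I_n -> W}) i)) t.

Lemma tcoord_lin l : linear (tcoord l).
Proof. exact: tens_lift_lin. Qed.

Lemma tcoord_pure l x u : tcoord l (pure x u) =
  \sum_(i < n) cw_ l ((u : {ffun 'I_n -> W}) i) *: ract x (a_ i).
Proof. exact/tens_lift_pure/tens_fext. Qed.

Lemma tens_free_dec (t : T) : t = \sum_(l < m) pure (tcoord l t) (bin (w_ l)).
Proof.
move: t; apply: tens_ind => //.
  move=> c t u; rewrite scaler_sumr -big_split; apply: eq_bigr => l _.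
  by rewrite tcoord_lin pure_lin1.
move=> x u; rewrite [u in LHS]freebimod_dec (lin_sum (pure_lin2 x)).
transitivity (\sum_(l < m) \sum_(i < n) cw_ l ((u : {ffun 'I_n -> W}) i) *:
   pure (ract x (a_ i)) (bin (w_ l))); last first.
  apply: eq_bigr => l _; rewrite tcoord_pure (lin_sum (pure_lin1 _)).
  by apply: eq_bigr => i _; rewrite (linZ (pure_lin1 _)).
rewrite exchange_big; apply: eq_bigr => i _.
rewrite (@coord_sum _ _ (fun y => pure (ract x (a_ i)) (bin y))) ?pure_bal //.
by move=> e y z; rewrite bin_lin pure_lin2.
Qed.

(** M (x)_k W is a sum of copies of W indexed by a basis m_j of M, so a lift is chosen on each m_j
    (x) W and the lifts are combined linearly in M. *)
Lemma tens_free_proj : rproj W -> rproj T.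
Proof.
move=> pW X Y g f sg.
pose m_ j := (vbasis {: M})`_j.
have fl_ j : linear (fun w : W => f (pure (m_ j) (bin w))).
  by move=> c v w; rewrite bin_lin pure_lin2 rhom_add rhom_scale.
have fa_ j (w : W) a : f (pure (m_ j) (bin (ract w a))) = ract (f (pure (m_ j) (bin w))) a.
  by rewrite -rhom_act tens_act_pure bin_act.
have [h hE] := choice (fun j : 'I_(\dim {: M}) => pW X Y g (mk_rhom (fl_ j) (fa_ j)) sg).
pose H (x : M) (w : W) : X := \sum_(j < \dim {: M}) coord (vbasis {: M}) j x *: h j w.
have H1 w : linear (H^~ w).
  move=> c x y; rewrite /H scaler_sumr -big_split; apply: eq_bigr => j _.
  by rewrite linearD linearZ scalerDl scalerA.
have H2 x : linear (H x).
  move=> c v w; rewrite /H scaler_sumr -big_split; apply: eq_bigr => j _.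
  by rewrite rhom_add rhom_scale scalerDr !scalerA mulrC.
have Ha (x : M) (u : freebimod) a :
    \sum_(i < n) H (ract x (a_ i)) ((ract u a : {ffun 'I_n -> W}) i) =
    ract (\sum_(i < n) H (ract x (a_ i)) ((u : {ffun 'I_n -> W}) i)) a.
  rewrite (lin_sum (ract_linl a)); apply: eq_bigr => i _.
  rewrite ffunE (lin_sum (ract_linl a)); apply: eq_bigr => j _.
  by rewrite ractZl rhom_act.
exists (tens_lift (tens_fext H1 H2) Ha); apply: tens_ext => x u.
rewrite rcompE tens_liftE rhom_sum [u in RHS]freebimod_dec (lin_sum (pure_lin2 x)) rhom_sum.
apply: eq_bigr => i _; rewrite rhom_sum -pure_bal.
rewrite -(@coord_sum _ _ (fun y => f (pure y (bin ((u : {ffun 'I_n -> W}) i))))).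
  apply: eq_bigr => j _; rewrite rhom_scale; congr (_ *: _).
  by rewrite -rcompE hE mk_rhomE.
by move=> e y z; rewrite pure_lin1 rhom_add rhom_scale.
Qed.

End TensFree.

Lemma tcoord_map M N (f : rhom M N) l t :
  tcoord l (tens_map freebimod f t) = f (tcoord l t).
Proof.
move: t; apply: tens_ind.
- by move=> c t u; rewrite rhom_add rhom_scale tcoord_lin.
- by move=> c t u; rewrite tcoord_lin rhom_add rhom_scale.
move=> x u; rewrite tens_mapE !tcoord_pure rhom_sum; apply: eq_bigr => i _.
by rewrite rhom_scale rhom_act.
Qed.

(** In the coordinates [tcoord] the two maps act componentwise as f and g. *)
Lemma tens_free_exact L M N (f : rhom L M) (g : rhom M N) : rexact f g ->
  rexact (tens_map freebimod f) (tens_map freebimod g).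
Proof.
move=> /rexactP fg; apply/rexactP => t; split=> [gt|[u <-]].
  have E l : exists x, f x = tcoord l t.
    by apply/fg; rewrite -tcoord_map gt (lin0 (tcoord_lin _)).
  have [x xE] := choice E.
  exists (\sum_(l < \dim {: W}) pure (x l) (bin (vbasis {: W})`_l)).
  rewrite rhom_sum [RHS]tens_free_dec; apply: eq_bigr => l _.
  by rewrite tens_mapE xE.
rewrite [LHS]tens_free_dec big1 // => l _; rewrite !tcoord_map.
suff -> : g (f (tcoord l u)) = 0 by rewrite (lin0 (pure_lin1 _)).
by apply/fg; exists (tcoord l u).
Qed.

End FreeBimodule.

Section ProjectiveBimodules.
Variables (k : fieldType) (A : falgType k).
Implicit Types (L M N : rmod A) (P Q X Y Z : bimod A).

Lemma tens_map_comp L M N B (g : rhom M N) (f : rhom L M) t :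
  tens_map B g (tens_map B f t) = tens_map B (rcomp g f) t.
Proof.
rewrite -rcompE; congr (rhom_lf _ t).
by apply: tens_ext => m b; rewrite rcompE !tens_mapE rcompE.
Qed.

Lemma tens_maprE M X Y (g : bihom X Y) m b :
  tens_mapr M g (pure m b) = pure m (g b).
Proof. exact: tens_liftE. Qed.

Lemma tens_map_mapr M N X Y (f : rhom M N) (g : bihom X Y) t :
  tens_map Y f (tens_mapr M g t) = tens_mapr N g (tens_map X f t).
Proof.
rewrite -!rcompE; congr (rhom_lf _ t).
by apply: tens_ext => m b; rewrite !rcompE !(tens_mapE, tens_maprE).
Qed.

Lemma bproj_free_retract P : bproj P -> exists W : rmod A, rproj W /\
  exists (i : bihom P (freebimod W)) (r : bihom (freebimod W) P),
    forall x, r (i x) = x.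
Proof.
move=> pP; pose W := rfree A (\dim {: P}).
pose phi : rhom W P := free_map (fun i => tnth (vbasis {: P}) i).
have phis : forall y, exists x, phi x = y by apply/rsurjP/rfree_cover.
have phil : linear phi by move=> c x y; rewrite rhom_add rhom_scale.
have ra (u : freebimod W) a : fext phi (ract u a) = ract (fext phi u) a.
  rewrite /fext (lin_sum (ract_linl a)); apply: eq_bigr => i _.
  by rewrite ffunE rhom_act lactA.
pose r0 := mk_rhom (fext_lin phil) ra.
have r0l a x : r0 (lact a x) = lact a (r0 x) by rewrite !mk_rhomE fext_lact.
pose r := BiHom r0l.
have rs : rsurj r.
  by apply/rsurjP => y; have [x <-] := phis y; exists (bin x); rewrite mk_rhomE fext_bin.
have idl a (x : P) : rid P (lact a x) = lact a (rid P x) by rewrite !ridE.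
have [i iE] := pP _ _ r (BiHom idl) rs.
exists W; split; first exact: rfree_proj.
by exists i, r => x; rewrite -rcompE iE /= ridE.
Qed.

Lemma tens_bproj_proj M P : bproj P -> rproj (tens M P).
Proof.
move=> /bproj_free_retract[W [pW [i [r rK]]]].
apply: (@rproj_retract _ _ _ _ (tens_mapr M i) (tens_mapr M r)).
  by apply: tens_ext => m b; rewrite rcompE !tens_maprE rK ridE.
exact: tens_free_proj.
Qed.

Lemma tens_bproj_exact L M N P (f : rhom L M) (g : rhom M N) :
  bproj P -> rexact f g -> rexact (tens_map P f) (tens_map P g).
Proof.
move=> /bproj_free_retract[W [_ [i [r rK]]]] fg.
have rKt K (t : tens K P) : tens_mapr K r (tens_mapr K i t) = t.
  rewrite -rcompE -[RHS](ridE t); congr (rhom_lf _ t).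
  by apply: tens_ext => m b; rewrite rcompE !tens_maprE rK ridE.
have /rexactP fgF := tens_free_exact W fg.
apply/rexactP => t; split=> [gt|[u <-]].
  have /fgF[v vE] : tens_map (freebimod W) g (tens_mapr M i t) = 0.
    by rewrite tens_map_mapr gt rhom_is0.
  by exists (tens_mapr L r v); rewrite tens_map_mapr vE rKt.
rewrite -[LHS]rKt -(tens_map_mapr _ i) -(tens_map_mapr _ i).
have -> : tens_map (freebimod W) g (tens_map (freebimod W) f (tens_mapr L i u)) = 0.
  by apply/fgF; exists (tens_mapr L i u).
exact: rhom_is0.
Qed.

Lemma tens_bproj_surj M N P (g : rhom M N) : bproj P ->
  (forall y, exists x, g x = y) -> forall y, exists x, tens_map P g x = y.
Proof.
move=> bP gs y.
have /(tens_bproj_exact bP)/rexactP e : rexact g (0 : rhom N N).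
  by apply/rexactP => z; rewrite rhom0; split.
apply/e; rewrite (_ : tens_map P 0 = 0) ?rhom0 //; apply: tens_ext => m b.
by rewrite tens_mapE !rhom0 (lin0 (pure_lin1 _)).
Qed.

Lemma tens_bproj_inj M N P (g : rhom M N) : bproj P ->
  (forall x, g x = 0 -> x = 0) -> forall x, tens_map P g x = 0 -> x = 0.
Proof.
move=> bP gi x.
have /(tens_bproj_exact bP)/rexactP e : rexact (0 : rhom M M) g.
  apply/rexactP => z; split=> [/gi ->|[y <-]]; last by rewrite rhom0 rhom_is0.
  by exists 0; rewrite rhom0.
move=> /e[u <-]; rewrite (_ : tens_map P 0 = 0) ?rhom0 //; apply: tens_ext => m b.
by rewrite tens_mapE !rhom0 (lin0 (pure_lin1 _)).
Qed.

Definition leftlinear X Y (t : X -> Y) :=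
  linear t /\ forall a x, t (lact a x) = lact a (t x).

Lemma leftlinear_bihom X Y (f : bihom X Y) : leftlinear f.
Proof. by split=> [c x y|a x]; rewrite ?rhom_add ?rhom_scale ?bihomP. Qed.

Lemma leftlinear_comp X Y Z (g : Y -> Z) (f : X -> Y) :
  leftlinear g -> leftlinear f -> leftlinear (g \o f).
Proof. by move=> [g1 g2] [f1 f2]; split=> [c x y|a x]; rewrite /= ?f1 ?g1 ?f2 ?g2. Qed.

(** P is projective as a left module: on A (x)_k W a lift is needed only on W, where the k-linear
    pseudo-inverse of f provides one, and P is a retract of it. *)
Lemma bproj_left_lift P X Y (f : bihom X Y) (e : P -> Y) : bproj P ->
  leftlinear e -> (forall x, exists y, f y = e x) ->
  exists t : P -> X, leftlinear t /\ forall x, f (t x) = e x.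
Proof.
move=> /bproj_free_retract[W [_ [i [r rK]]]] [e1 e2] ef.
pose phi (w : W) : X := ((rhom_lf f)^-1)%VF (e (r (bin w))).
have phil : linear phi.
  by move=> c v w; rewrite /phi bin_lin rhom_add rhom_scale e1 linearP.
have fphi w : f (phi w) = e (r (bin w)).
  rewrite limg_lfunVK //; have [y <-] := ef (r (bin w)).
  by rewrite memv_img ?memvf.
have ft u : f (fext phi u) = e (r u).
  rewrite /fext rhom_sum [u in RHS]freebimod_dec rhom_sum (lin_sum e1).
  by apply: eq_bigr => l _; rewrite !bihomP e2 fphi.
exists (fext phi \o i); split; last by move=> x; rewrite /= ft rK.
apply: leftlinear_comp (leftlinear_bihom i); split; first exact: fext_lin.
by move=> *; rewrite fext_lact.
Qed.

Section TensLeft.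
Variables (M : rmod A) (X Y : bimod A) (t : X -> Y).
Hypothesis tl : leftlinear t.

(** The map 1 (x) t for t merely left linear; it is k-linear but no map of right modules, hence not
    an [rhom]. *)
Definition tens_left (u : tens M X) : tens M Y :=
  tens_lift_fun (fun (m : M) b => pure m (t b)) u.
Lemma tens_left_lin : linear tens_left.
Proof. exact: tens_lift_lin. Qed.
Lemma tens_leftE m b : tens_left (pure m b) = pure m (t b).
Proof.
have [t1 t2] := tl; apply: tens_lift_pure; split=> [x|x|x a y].
- exact: pure_lin1.
- by move=> c y z; rewrite t1 pure_lin2.
- by rewrite t2 pure_bal.
Qed.
End TensLeft.

(* An exact sequence of left projective bimodules ending in A is contractible
   over A^op; its differentials are von Neumann regular for left linear maps,
   a property which survives C (x)_A -. *)
Definition left_regular X Y (f : bihom X Y) :=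
  exists s : Y -> X, leftlinear s /\ forall x, f (s (f x)) = f x.

Lemma left_regular_exact X Y Z (f : bihom X Y) (g : bihom Y Z) :
  bproj Y -> rexact f g -> left_regular g ->
  left_regular f /\ forall C : rmod A, rexact (tens_mapr C f) (tens_mapr C g).
Proof.
move=> pY /rexactP fg [s [[sl sa] gsg]].
have el : leftlinear (fun y : Y => y - s (g y)).
  split=> [c x y|a x].
    by rewrite rhom_add rhom_scale sl scalerBr opprD addrACA.
  by rewrite bihomP sa (linB (lact_linr a)).
have [|t [tl ft]] := @bproj_left_lift Y X Y f (fun y => y - s (g y)) pY el.
  by move=> y; apply/fg; rewrite rhom_sub gsg subrr.
have gf x : g (f x) = 0 by apply/fg; exists x.
split; first by exists t; split=> // x; rewrite ft gf (lin0 sl) subr0.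
move=> C; apply/rexactP => u; split=> [gu|[v <-]]; last first.
  rewrite -rcompE -[RHS](rhom0 _ v); congr (rhom_lf _ v).
  by apply: tens_ext => m b; rewrite rcompE !tens_maprE gf rhom0 (lin0 (pure_lin2 _)).
(* The contraction 1 = f t + s g of the bimodule sequence involves only left linear maps, so it
   survives tensoring with C. *)
have E : u = tens_mapr C f (tens_left t u) + tens_left s (tens_mapr C g u).
  move: (u); apply: tens_ind => [c x y|c x y|m b].
  - by [].
  - rewrite rhom_add rhom_scale !tens_left_lin rhom_add rhom_scale.
    by rewrite scalerDr addrACA.
  rewrite tens_leftE // !tens_maprE tens_leftE // ft.
  by rewrite (linB (pure_lin2 m)) subrK.
exists (tens_left t u); rewrite [RHS]E gu.
by rewrite (lin0 (tens_left_lin (M := C) s)) addr0.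
Qed.

End ProjectiveBimodules.

(** * Exactness of C (x) theta *)

Section Resolution.
Variables (k : fieldType) (A : falgType k) (d : nat) (s : algaut A).
Variable th : biseq d s.
Hypothesis resth : projinj_resolution th.

(** Bimodule counterparts of [eob1] and [emap1], which retain only the right module structure. *)
Definition tob1 (i : nat) : bimod A :=
  if i is j.+1 then tob th j else twist (aut_inv s).
Definition tmap1 (i : nat) : bihom (tob1 i) (tob1 i.+1) :=
  match i with 0 => tin th | j.+1 => tmap th j end.

(** A is free on 1 as a left module, so any preimage of 1 determines a left linear section. *)
Lemma tout_section : exists t : regbimod A -> tlast th,
  leftlinear t /\ forall a, tout th (t a) = a.
Proof.
have [[_ _ _ _ /rsurjP ts] _ _] := resth.
have [p pE] := ts (1 : A).
exists (fun a => lact a p); split.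
  by split=> [c x y|a x]; [exact: lact_linl|rewrite -lactM].
by move=> a; rewrite bihomP [tout th p]pE /= mulr1.
Qed.

Lemma tend_regular : left_regular (tend th).
Proof.
have [[_ _ _ e _] _ [pl _]] := resth.
suff /(left_regular_exact pl e)[] : left_regular (tout th) by [].
have [t [tl tK]] := tout_section.
by exists t; split=> // x; rewrite tK.
Qed.

Let rexact_tmap1 i N (g : rhom (tob th i) N) :
  rexact (emap1 (biseq_exseq th) i) g -> rexact (tmap1 i) g.
Proof. by case: i g. Qed.

Lemma tmap1_regular i : (i <= d)%N -> left_regular (tmap1 i).
Proof.
have [[_ e ed _ _] pp _] := resth.
(* Induction on d - i: regularity is passed from the right end A of theta towards its left end. *)
move=> /subnKC; move: (d - i)%N => j; elim: j i => [i|j IH i ijd].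
  rewrite addn0 => id; have [pd _] := pp d (leqnn d).
  suff : left_regular (tmap1 d) by rewrite id.
  exact: (left_regular_exact pd (rexact_tmap1 ed) tend_regular).1.
have id : (i < d)%N by rewrite -ijd addnS ltnS leq_addr.
have [pi _] := pp i (ltnW id).
have := IH i.+1; rewrite addSn -addnS => /(_ ijd) rg.
exact: (left_regular_exact pi (rexact_tmap1 (e i id)) rg).1.
Qed.

(** The first map of theta is injective and von Neumann regular, hence has a left linear retraction,
    which can be tensored with C. *)
Lemma tens_tin_inj (C : rmod A) (u : tens C (twist (aut_inv s))) :
  tens_mapr C (tin th) u = 0 -> u = 0.
Proof.
have [[/rinjP ti _ _ _ _] _ _] := resth.
have [t [tl tt]] := tmap1_regular (leq0n d).
have tK x : t (tin th x) = x.
  apply/eqP; rewrite -subr_eq0; apply/eqP/ti.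
  by rewrite rhom_sub [X in X - _]tt subrr.
move=> iu.
suff <- : tens_left t (tens_mapr C (tin th) u) = u.
  by rewrite iu (lin0 (tens_left_lin (M := C) t)).
move: (u); apply: tens_ind => [c x y|c x y|m b] //.
  by rewrite rhom_add rhom_scale tens_left_lin.
by rewrite tens_maprE tens_leftE // tK.
Qed.

Lemma tens_tmap1_exact (C : rmod A) i : (i < d)%N ->
  rexact (tens_mapr C (tmap1 i)) (tens_mapr C (tmap th i)).
Proof.
move=> id; have [[_ e _ _ _] pp _] := resth.
have [pi _] := pp i (ltnW id).
have rg := tmap1_regular id.
exact: (left_regular_exact pi (rexact_tmap1 (e i id)) rg).2.
Qed.

Lemma tens_tend_exact (C : rmod A) :
  rexact (tens_mapr C (tmap1 d)) (tens_mapr C (tend th)).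
Proof.
have [[_ _ ed _ _] pp _] := resth; have [pd _] := pp d (leqnn d).
exact: (left_regular_exact pd (rexact_tmap1 ed) tend_regular).2.
Qed.

Lemma tens_reg_inj (C : rmod A) u : tens_reg C u = 0 -> u = 0.
Proof.
move=> u0; have uE : u = pure (tens_reg C u) (1 : regbimod A).
  move: (u); apply: tens_ind => [c x y|c x y|m b] //.
    by rewrite rhom_add rhom_scale pure_lin1.
  by rewrite tens_liftE pure_bal /= mulr1.
by rewrite uE u0 (lin0 (pure_lin1 _)).
Qed.

Lemma tens_tout_surj (C : rmod A) (y : C) :
  exists x, rcomp (tens_reg C) (tens_mapr C (tout th)) x = y.
Proof.
have [t [tl tK]] := tout_section.
exists (pure y (t 1)); rewrite rcompE tens_maprE tK.
by rewrite [LHS]tens_liftE ract1.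
Qed.

Lemma tens_tout_exact (C : rmod A) :
  rexact (tens_mapr C (tend th)) (rcomp (tens_reg C) (tens_mapr C (tout th))).
Proof.
have [[_ _ _ e _] _ [pl _]] := resth.
have rg : left_regular (tout th).
  by have [t [tl tK]] := tout_section; exists t; split=> // x; rewrite tK.
have /rexactP E := (left_regular_exact pl e rg).2 C.
apply/rexactP => y; rewrite rcompE; split=> [/tens_reg_inj/E //|/E ->].
exact: rhom_is0.
Qed.

Let rexact_emap1 C i N (g : rhom (tens C (tob th i)) N) :
  rexact (tens_mapr C (tmap1 i)) g -> rexact (emap1 (tens_seq C th) i) g.
Proof. by case: i g. Qed.

Lemma tens_seq_exact (C : rmod A) : exseq_exact (tens_seq C th).
Proof.
split.
- exact/rinjP/tens_tin_inj.
- by move=> i id; apply/rexact_emap1/tens_tmap1_exact.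
- exact/rexact_emap1/tens_tend_exact.
- exact: tens_tout_exact.
- exact/rsurjP/tens_tout_surj.
Qed.

End Resolution.

(** * Twisting, and injectivity of projective modules *)

Section Twisting.
Variables (k : fieldType) (A : falgType k) (t : algaut A).
Implicit Types L M N : rmod A.

Section Untwist.
Variable M : rmod A.

Let h (m : M) (y : twist t) : M := ract m (autV t y).
Let h_bal : balanced h.
Proof.
split=> [y|m|m a y]; first exact: ract_linl.
  by move=> c x y; rewrite /h linearP ract_linr.
rewrite /h -ractM; congr ract.
by rewrite -[in LHS](autK t a) -rmorphM.
Qed.
(** The k-linear bijection m (x) y |-> m t^-1(y) from M (x) _tA_1 to M, with inverse m |-> m (x) 1.
    It is natural in M, so exactness, surjectivity and injectivity pass through the twist. *)
Definition untwist (u : tens M (twist t)) : M := tens_lift_fun h u.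
Lemma untwist_lin : linear untwist. Proof. exact: tens_lift_lin. Qed.
Lemma untwist_pure m y : untwist (pure m y) = ract m (autV t y).
Proof. exact: tens_lift_pure. Qed.
Lemma untwist1 m : untwist (pure m (1 : twist t)) = m.
Proof. by rewrite untwist_pure rmorph1 ract1. Qed.
Lemma untwistK u : pure (untwist u) (1 : twist t) = u.
Proof.
move: u; apply: tens_ind => [c x y|c x y|m y] //.
  by rewrite untwist_lin pure_lin1.
by rewrite untwist_pure pure_bal /= mulr1 autVK.
Qed.
End Untwist.

Lemma untwist_map M N (f : rhom M N) u :
  untwist (tens_map (twist t) f u) = f (untwist u).
Proof. by rewrite -[in LHS](untwistK u) tens_mapE untwist1. Qed.

Lemma tens_twist_exact L M N (f : rhom L M) (g : rhom M N) : rexact f g ->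
  rexact (tens_map (twist t) f) (tens_map (twist t) g).
Proof.
move=> /rexactP fg; apply/rexactP => y; split=> [gy|[u <-]].
  have /fg[x xE] : g (untwist y) = 0 by rewrite -untwist_map gy (lin0 (@untwist_lin _)).
  by exists (pure x (1 : twist t)); rewrite tens_mapE xE untwistK.
rewrite -[LHS]untwistK !untwist_map.
have -> : g (f (untwist u)) = 0 by apply/fg; exists (untwist u).
exact: (lin0 (pure_lin1 _)).
Qed.

Lemma tens_twist_surj M N (f : rhom M N) : (forall y, exists x, f x = y) ->
  forall y, exists x, tens_map (twist t) f x = y.
Proof.
move=> fs y; have [x xE] := fs (untwist y).
by exists (pure x (1 : twist t)); rewrite tens_mapE xE untwistK.
Qed.

Lemma tens_twist_inj M N (f : rhom M N) : (forall x, f x = 0 -> x = 0) ->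
  forall x, tens_map (twist t) f x = 0 -> x = 0.
Proof.
move=> fi x fx; rewrite -[x]untwistK (fi (untwist x)) ?(lin0 (pure_lin1 _)) //.
by rewrite -untwist_map fx (lin0 (@untwist_lin _)).
Qed.

End Twisting.

Section ShiftInverse.
Variables (k : fieldType) (A : falgType k) (s : algaut A).
Implicit Types L M N X Y : rmod A.
Local Notation T := (twist s).
Local Notation Ti := (twist (aut_inv s)).

Lemma tens_unitE M m :
  tens_unit s M m = pure (pure m (1 : T) : tens M T) (1 : Ti).
Proof. exact: mk_rhomE. Qed.

Lemma tens_unit_riso M : is_riso (tens_unit s M).
Proof.
apply: is_riso_bij => [x|y].
  by rewrite tens_unitE => /(congr1 (@untwist _ _ _ _)) /(congr1 (@untwist _ _ _ _));
     rewrite !untwist1 !(lin0 (@untwist_lin _ _ _ _)).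
by exists (untwist (untwist y)); rewrite tens_unitE !untwistK.
Qed.

Lemma tens_unit_nat M N (f : rhom M N) :
  rcomp (tens_unit s N) f = rcomp (tens_map Ti (tens_map T f)) (tens_unit s M).
Proof. by apply: rhom_ext => x; rewrite !rcompE !tens_unitE !tens_mapE. Qed.

Lemma counit1 X x : counit s X (pure (pure x (1 : Ti) : tens X Ti) (1 : T)) = x.
Proof. by rewrite counitE cou0E rmorph1 !ract1. Qed.

Lemma counit_riso X : is_riso (counit s X).
Proof.
apply: is_riso_bij => [u|x]; last by exists (pure (pure x (1 : Ti) : tens X Ti) (1 : T)); exact: counit1.
rewrite -(untwistK u) -(untwistK (untwist u)) counit1 => ->.
by rewrite !(lin0 (pure_lin1 _)).
Qed.

Lemma counit_nat X Y (f : rhom X Y) :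
  rcomp (counit s Y) (tens_map T (tens_map Ti f)) = rcomp f (counit s X).
Proof.
apply: rhom_ext => u; rewrite !rcompE -(untwistK u) -(untwistK (untwist u)).
by rewrite !tens_mapE !counit1.
Qed.

(** A triangle identity between Sigma and Sigma^-1; it is needed to verify the factorization of the
    first map in (C2). *)
Lemma counit_unit X :
  rcomp (tens_map Ti (counit s X)) (tens_unit s (tens X Ti)) = rid (tens X Ti).
Proof.
apply: tens_ext => x y; rewrite rcompE tens_unitE tens_mapE counitE cou0E ract1 ridE.
by rewrite pure_bal /= mulr1 autK.
Qed.

End ShiftInverse.

Section Splitting.
Variables (k : fieldType) (A : falgType k).
Implicit Types (L M N P X Y Z : rmod A).

Definition right_regular X Y (f : rhom X Y) :=
  exists s : rhom Y X, rcomp f (rcomp s f) = f.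

Lemma right_regular_step X Y Z (f : rhom X Y) (g : rhom Y Z) :
  rproj Y -> rexact f g -> right_regular g -> right_regular f.
Proof.
move=> pY /rexactP fg [s gsg].
have [y|w wE] := @rproj_lift _ _ _ _ _ f (rid Y - rcomp s g) pY.
  have gE : g (s (g y)) = g y by have := rhom_eq y gsg; rewrite !rcompE.
  by apply/fg; rewrite rhomB ridE rhom_sub rcompE gE subrr.
exists w; rewrite rcompA wE; apply: rhom_ext => x; rewrite rcompE rhomB ridE rcompE.
have -> : g (f x) = 0 by apply/fg; exists x.
by rewrite rhom_is0 subr0.
Qed.

(** With all terms from [eob E 0] to C projective the sequence splits from the right; the regularity
    reaching the injective map [ein] is a retraction. *)
Lemma exseq_ein_split d Y C (E : exseq d Y C) : exseq_exact E ->
  (forall i, (i <= d)%N -> rproj (eob E i)) -> rproj (elast E) -> rproj C ->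
  exists r : rhom (eob E 0) Y, rcomp r (ein E) = rid Y.
Proof.
move=> [/rinjP ii e ed el es] pE pl pC.
have [w wE] := pC _ _ (eout E) (rid C) es.
have ro : right_regular (eout E) by exists w; rewrite rcompA wE rcomp1f.
have rd : right_regular (eend E) := right_regular_step pl el ro.
have r1 i : (i <= d)%N -> right_regular (emap1 E i).
  move=> /subnKC; move: (d - i)%N => j; elim: j i => [i|j IH i ijd].
    rewrite addn0 => id; suff : right_regular (emap1 E d) by rewrite id.
    exact: right_regular_step (pE d (leqnn d)) ed rd.
  have id : (i < d)%N by rewrite -ijd addnS ltnS leq_addr.
  have := IH i.+1; rewrite addSn -addnS => /(_ ijd).
  exact: right_regular_step (pE i (ltnW id)) (e i id).
have [r rE] := r1 0 (leq0n d); exists r; apply: rhom_ext => y; rewrite rcompE ridE.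
apply/eqP; rewrite -subr_eq0; apply/eqP/ii.
have := rhom_eq y rE; rewrite !rcompE rhom_sub [emap1 E 0]/(ein E) => ->.
by rewrite subrr.
Qed.

Lemma mono_split X Y Z (f : rhom X Y) (g : rhom Y Z) :
  (forall x, f x = 0 -> x = 0) -> rexact f g -> (forall z, exists y, g y = z) ->
  rproj Z -> exists q : rhom Y X, rcomp q f = rid X.
Proof.
move=> fi /rexactP fg gs pZ.
have [w wE] := pZ _ _ g (rid Z) ((rsurjP _).2 gs).
have [y|q qE] := @factor_inj _ _ _ _ _ f (rid Y - rcomp w g) fi.
  apply/fg; rewrite rhomB ridE rhom_sub -[g (rcomp w g y)]rcompE rcompA wE.
  by rewrite rcomp1f subrr.
exists q; apply: rhom_ext => x; rewrite rcompE ridE; apply/eqP.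
rewrite -subr_eq0; apply/eqP/fi; rewrite rhom_sub -rcompE qE rhomB ridE rcompE.
have -> : g (f x) = 0 by apply/fg; exists x.
by rewrite rhom_is0 subr0 subrr.
Qed.

Variables (d : nat) (s : algaut A) (th : biseq d s).
Hypothesis resth : projinj_resolution th.
Local Notation T := (twist s).
Local Notation Ti := (twist (aut_inv s)).

Lemma tob_bproj i : (i <= d)%N -> bproj (tob th i).
Proof. by move=> id; have [_ /(_ i id)[]] := resth. Qed.

Lemma tlast_bproj : bproj (tlast th).
Proof. by have [_ _ []] := resth. Qed.

(* M embeds naturally into a projective, as Sigma M (x) (Sigma^-1 A -> P_(d+1)). *)
Definition hull_map M : rhom M (tens (tens M T) (tob th 0)) :=
  rcomp (tens_mapr (tens M T) (tin th)) (tens_unit s M).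

Lemma hull_mapE M x :
  hull_map M x = tens_mapr (tens M T) (tin th) (tens_unit s M x).
Proof. exact: rcompE. Qed.

Lemma hull_map_inj M x : hull_map M x = 0 -> x = 0.
Proof.
by rewrite hull_mapE => /(tens_tin_inj resth)/(is_riso_inj (tens_unit_riso s M)).
Qed.

Lemma hull_map_nat M N (f : rhom M N) :
  rcomp (hull_map N) f = rcomp (tens_map (tob th 0) (tens_map T f)) (hull_map M).
Proof.
apply: rhom_ext => x; rewrite rcompE [RHS]rcompE !hull_mapE tens_map_mapr.
congr (rhom_lf _ _); have := rhom_eq x (tens_unit_nat s f).
by rewrite !rcompE.
Qed.

Lemma hull_proj M : rproj (tens (tens M T) (tob th 0)).
Proof. exact/tens_bproj_proj/tob_bproj. Qed.

Lemma rproj_embed M : exists (J : rmod A) (j : rhom M J),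
  rproj J /\ forall x, j x = 0 -> x = 0.
Proof.
by exists (tens (tens M T) (tob th 0)), (hull_map M); split;
  [exact: hull_proj|exact: hull_map_inj].
Qed.

(** The functor M |-> Sigma M (x) P_(d+1) is exact with projective values, so it sends every
    monomorphism to a split one: the cokernel becomes projective. Naturality of [hull_map] turns the
    splitting into an extension of h with values in the hull of P. Finally P is a retract of its
    hull, because Sigma P is projective and Sigma P (x) theta therefore splits. *)
Lemma rproj_injective P M N (m : rhom M N) (h : rhom M P) : rproj P ->
  (forall x, m x = 0 -> x = 0) -> exists h' : rhom N P, rcomp h' m = h.
Proof.
move=> pP mi.
have [r rE] : exists r, rcomp r (hull_map P) = rid P.
  have [|||r0 r0E] := exseq_ein_split (tens_seq_exact resth (tens P T)).
  - by move=> i id; exact/tens_bproj_proj/tob_bproj.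
  - exact/tens_bproj_proj/tlast_bproj.
  - exact: tens_proj.
  have [v [vE _]] := tens_unit_riso s P.
  by exists (rcomp v r0); rewrite -rcompA (rcompA r0) r0E rcomp1f vE.
have [q qE] : exists q, rcomp q (tens_map (tob th 0) (tens_map T m)) = rid _.
  have [C [p [ps pe]]] := cokernel_ex m.
  have p0 := tob_bproj (leq0n d).
  apply: (@mono_split _ _ _ _ (tens_map (tob th 0) (tens_map T p))).
  - exact/tens_bproj_inj/tens_twist_inj.
  - exact/tens_bproj_exact/tens_twist_exact.
  - exact/tens_bproj_surj/tens_twist_surj.
  - exact: tens_bproj_proj.
have qm : rcomp (rcomp q (hull_map N)) m = hull_map M.
  by rewrite -(rcompA q (hull_map N) m) hull_map_nat rcompA qE rcomp1f.
have rh : rcomp (rcomp r (tens_map (tob th 0) (tens_map T h))) (hull_map M) = h.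
  by rewrite -(rcompA r) -hull_map_nat rcompA rE rcomp1f.
by exists (rcomp (rcomp r (tens_map (tob th 0) (tens_map T h))) (rcomp q (hull_map N)));
  rewrite -(rcompA _ _ m) qm.
Qed.

End Splitting.

(** * Angles *)

Section AngleOfSequence.
Variables (k : fieldType) (A : falgType k) (d : nat) (s : algaut A).
(** From here on the d of the angulation is written [d.+1]; its positivity ensures that there is a
    map from [Q d] to [Q d.+1]. The oddness of the actual d becomes evenness of the variable. *)
Variable th : biseq d.+1 s.
Hypothesis resth : projinj_resolution th.
Local Notation T := (twist s).
Local Notation Ti := (twist (aut_inv s)).

Variables (C : rmod A) (Q : nat -> projA A) (L : projA A).
Variables (ei : rhom (tens C Ti) (Q 0)) (em : forall i, rhom (Q i) (Q i.+1)).
Variables (ee : rhom (Q d.+1) L) (eo : rhom L C).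

Definition projA_seq : exseq d.+1 (tens C Ti) C :=
  @ExSeq k A d.+1 (tens C Ti) C Q L ei em ee eo.
Hypothesis exactE : exseq_exact projA_seq.
Hypothesis morE : exseq_mor projA_seq (tens_seq C th).

(* The angle Sigma^-1 L -> Q 0 -> ... -> Q (d+1) -> L. *)
Let X (i : nat) : projA A := if i is j.+1 then Q j else Sigma (aut_inv s) L.
Let x (i : nat) : rhom (X i) (X i.+1) :=
  match i with 0 => rcomp ei (tens_map Ti eo) | j.+1 => em j end.

Let rexact_x i N (g : rhom (Q i) N) : rexact (emap1 projA_seq i) g -> rexact (x i) g.
Proof.
case: i g => [|i] g // /rexactP e; apply/rexactP => y; rewrite e.
have [_ _ _ _ /rsurjP es] := exactE.
split=> -[z <-].
  by have [w wE] := tens_twist_surj (t := aut_inv s) es z; exists w; rewrite rcompE wE.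
by exists (tens_map Ti eo z); rewrite rcompE.
Qed.

(** An angle has to end in Sigma X_0. With X_0 = Sigma^-1 L this is L up to the counit, whose
    inverse c corrects the last map; the rank of that map is unaffected. *)
Lemma angle_of_seq : exists xl, angle th x xl /\
  exists2 c : rhom L (Sigma s (Sigma (aut_inv s) L)), is_riso c & xl = rcomp c ee.
Proof.
have [/rinjP ii e ed /rexactP el /rsurjP es] := exactE.
have cR := counit_riso s L; have [c [c1 c2]] := cR.
have cK y : c (counit s L y) = y by rewrite -rcompE c1 ridE.
have Kc y : counit s L (c y) = y by rewrite -rcompE c2 ridE.
have c0 y : c y = 0 -> y = 0 by move=> cy; rewrite -(Kc y) cy rhom_is0.
pose p := rcomp eo (counit s L).
have ps : forall y, exists x, p x = y.
  by move=> y; have [z <-] := es y; exists (c z); rewrite rcompE Kc.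
have exd : rexact (emap1 projA_seq d.+1) (rcomp c ee).
  move/rexactP: ed => ed; apply/rexactP => y; rewrite -ed rcompE.
  by split=> [/c0//|->]; exact: rhom_is0.
have exl : rexact (rcomp c ee) p.
  apply/rexactP => y; rewrite rcompE el; split=> -[z zE]; exists z.
    by rewrite rcompE zE cK.
  by rewrite -zE rcompE Kc.
have exA : exseq_exact (@angle_seq k A d.+1 s X x (rcomp c ee) C p ei).
  split.
  - exact/rinjP.
  - by move=> [|i] /e.
  - exact: exd.
  - exact: exl.
  - exact/rsurjP.
exists (rcomp c ee); split; last by exists c => //; exists (counit s L).
split.
  split; [|exact: rexact_x|].
    by move=> [|i] id; apply: rexact_x; exact: e id.
  (* Up to the counit, Sigma x_0 is p followed by the injective map Sigma ei, so both have the same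
     kernel. *)
  move/rexactP: exl => exl; apply/rexactP => y; rewrite -exl.
  have -> : p y = counit s C (tens_map T (tens_map Ti eo) y).
    by rewrite -[RHS]rcompE counit_nat.
  rewrite (_ : Sigma_map s (x 0) y = tens_map T ei (tens_map T (tens_map Ti eo) y)).
    by split=> [/(tens_twist_inj ii) ->|/(is_riso_inj (counit_riso s C)) ->]; exact: rhom_is0.
  by rewrite tens_map_comp.
exists C, p, ei; split=> //.
- by split=> //; exact/rsurjP.
- rewrite [x 0]/= rcompA; apply: rhom_ext => y.
  rewrite !rcompE; congr (rhom_lf ei _).
  have := rhom_eq y (counit_unit s L); rewrite rcompE ridE => cuE.
  by rewrite -[in LHS]cuE tens_map_comp.
(* A single morphism that is the identity on both ends already identifies the two classes in
   Ext^{d+2}. *)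
have [u [ul [m1 m2 m3 m4]]] := morE.
apply: Relation_Operators.rst_step; split=> //; first exact: tens_seq_exact.
exists u, (rcomp ul (counit s L)); split=> //.
  rewrite -m3; apply: rhom_ext => y; rewrite !rcompE; congr (rhom_lf ul _).
  exact: Kc.
by rewrite rcompA m4.
Qed.

Variables (R : realType) (rho : morfun A R).
Hypothesis rhoP : is_rank th rho.

Lemma rank_seq_first : rho (rcomp ei (tens_map Ti eo) : rhom (Sigma (aut_inv s) L) (Q 0))
  - rho (rid (Q 0)) + rho (em 0) = 0.
Proof.
have [_ _ _ ra _] := rhoP; have [xl [xa _]] := angle_of_seq.
exact: (ra _ _ _ xa).1 0 isT.
Qed.

Lemma rank_seq_last : rho (em d) - rho (rid (Q d.+1)) + rho ee = 0.
Proof.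
have [_ ri _ ra _] := rhoP; have [xl [xa [c cR xlE]]] := angle_of_seq.
have := (ra _ _ _ xa).2; rewrite xlE /= => <-; congr (_ + _).
by apply: (ri _ _ _ _ _ _ _ _ (is_riso_id _) cR); rewrite rcompf1.
Qed.

End AngleOfSequence.

(** * Rank functions *)

Section RankFunctions.
Variables (k : fieldType) (A : falgType k) (d : nat) (s : algaut A).
Variable th : biseq d.+1 s.
Hypothesis resth : projinj_resolution th.
Variables (R : realType) (rho : morfun A R).
Hypothesis rhoP : is_rank th rho.
Implicit Types X Y Z W P Q : projA A.
Local Notation T := (twist s).
Local Notation Ti := (twist (aut_inv s)).

Definition pzero : projA A := ProjA (@rfree_proj k A 0).

Lemma pzeroE (x : pzero) : x = 0.
Proof. by apply/ffunP => -[]. Qed.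

Let rho_ge0 X Y (f : rhom X Y) : 0 <= rho f. Proof. by have [] := rhoP. Qed.
Let rho_iso X Y X' Y' (f : rhom X Y) (g : rhom X' Y')
    (psi : rhom X X') (phi : rhom Y Y') :
  is_riso psi -> is_riso phi -> rcomp phi f = rcomp g psi -> rho f = rho g.
Proof. by have [_ h _ _ _] := rhoP; exact: h. Qed.
Let rho_sum X Y X' Y' (f : rhom X Y) (g : rhom X' Y') :
  rho (rsum_map f g : rhom (psum X X') (psum Y Y')) = rho f + rho g.
Proof. by have [] := rhoP. Qed.

(** 0 (+) 0 is isomorphic to 0, so this rank equals its own double. *)
Lemma rank_pzero : rho (rid pzero) = 0.
Proof.
have := rho_sum (rid pzero) (rid pzero).
suff -> : rho (rsum_map (rid pzero) (rid pzero) : rhom (psum pzero pzero) (psum pzero pzero)) = rho (rid pzero).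
  lra.
have zz (u : psum pzero pzero) : u = 0.
  by case: u => x y; rewrite (pzeroE x) (pzeroE y).
have z : is_riso (0 : rhom (psum pzero pzero) pzero).
  apply: is_riso_bij => [x _|y]; first exact: zz.
  by exists 0; rewrite rhom0 (pzeroE y).
apply: (rho_iso z z); apply: rhom_ext => u.
by rewrite !rcompE rhom0 [RHS]pzeroE.
Qed.

Section Trivial.
Variable P : projA A.
Let Q (i : nat) : projA A := if i is _.+1 then pzero else Sigma (aut_inv s) P.
Let E := @projA_seq k A d s P Q P (rid (Sigma (aut_inv s) P)) (fun i => 0) 0 (rid P).

Let E_exact : exseq_exact E.
Proof.
have z X (f : rhom X pzero) Y (g : rhom pzero Y) : rexact f g.
  apply/rexactP => y; rewrite (pzeroE y) rhom_is0; split=> // _.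
  by exists 0; rewrite rhom_is0.
split.
- by apply/rinjP => x; rewrite ridE.
- move=> [_|i _]; last exact: z.
  by apply/rexactP => y; rewrite rhom0; split=> // _; exists y; rewrite ridE.
- exact: z.
- apply/rexactP => y; rewrite ridE; split=> [->|[x <-]]; last by rewrite rhom0.
  by exists 0; rewrite rhom0.
- by apply/rsurjP => y; exists y; rewrite ridE.
Qed.

(** P is projective, so the identity of P lifts to the last term of P (x) theta. The only other
    nonzero component is the first map of P (x) theta: both sequences represent the zero class. *)
Let E_mor : exseq_mor E (tens_seq P th).
Proof.
have [_ e _ _ es] := tens_seq_exact resth P.
have [ul ulE] := pcarP P _ _ _ (rid P) es.
pose u i : rhom (Q i) (tens P (tob th i)) :=
  match i with 0 => tens_mapr P (tin th) | _.+1 => 0 end.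
exists u, ul; split.
- exact: rcompf1.
- move=> [|i] id /=; last by rewrite !rcompf0.
  rewrite rcompf0; apply: rhom_ext => x; rewrite rhom0 rcompE.
  by apply/esym; move/rexactP: (e 0%N id) => /= ->; exists x.
- by rewrite /= !rcompf0.
- exact: ulE.
Qed.

Lemma rank_trivial :
  rho (0 : rhom (Sigma (aut_inv s) P) pzero) = 0 /\ rho (0 : rhom pzero P) = 0.
Proof.
have := rank_seq_first resth E_exact E_mor rhoP.
have := rank_seq_last resth E_exact E_mor rhoP.
rewrite rcomp1f (_ : tens_map Ti (rid P) = rid _); last exact: Sigma_map_id.
rewrite rank_pzero => h1 h2; split; first by move: h2; rewrite subrr add0r.
(* The relation at the right end says that two ranks add up to zero; by nonnegativity each of them
   is zero. *)
have := rho_ge0 (0 : rhom (Q d) pzero); have := rho_ge0 (0 : rhom pzero P).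
move: h1; rewrite subr0; lra.
Qed.
End Trivial.

Lemma rank_from_pzero P : rho (0 : rhom pzero P) = 0.
Proof. by have [] := rank_trivial P. Qed.

(** The trivial angles start in Sigma^-1 of a projective, and P is isomorphic to Sigma^-1 (Sigma
    P). *)
Lemma rank_to_pzero P : rho (0 : rhom P pzero) = 0.
Proof.
have [<- _] := rank_trivial (Sigma s P).
apply: (rho_iso (tens_unit_riso s P : is_riso (_ : rhom P (Sigma (aut_inv s) (Sigma s P))))
  (is_riso_id pzero)).
by rewrite rcompf0 rcomp0f.
Qed.

Lemma rank_psum P Q : rho (rid (psum P Q)) = rho (rid P) + rho (rid Q).
Proof. by rewrite -rho_sum rsum_map_id. Qed.

(* row (f, f h) is isomorphic to f (+) (X' -> 0). *)
Lemma row_absorb X X' Y (f : rhom X Y) (h : rhom X' X) :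
  rho (row_rhom f (rcomp f h) : rhom (psum X X') Y) = rho f.
Proof.
have <- : rho (rsum_map f 0 : rhom (psum X X') (psum Y pzero)) = rho f.
  by rewrite rho_sum rank_to_pzero addr0.
pose t : rhom (psum X X') (psum X X') :=
  row_rhom (rinl X X') (col_rhom h (rid X')).
have tE x x' : t (x, x') = (x + h x', x').
  by rewrite row_rhomE col_rhomE ?rinlE ?rinrE ridE; congr pair; rewrite /= add0r.
apply: (rho_iso (psi := t) (phi := (rinl Y pzero : rhom Y (psum Y pzero)))).
- apply: is_riso_bij => [[x x']|[x x']].
    rewrite tE => -[h1 h2]; move: h1; rewrite h2 rhom_is0 addr0 => ->.
    by [].
  by exists (x - h x', x'); rewrite tE subrK.
- apply: is_riso_bij => [x|[x z]]; first by rewrite ?rinlE ?rinrE => -[].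
  by exists x; rewrite ?rinlE ?rinrE (pzeroE z).
apply: rhom_ext => -[x x']; rewrite !rcompE tE ?rinlE ?rinrE row_rhomE rsum_mapE.
by rewrite rhom0 rcompE rhom_add.
Qed.

Lemma row_absorb' X X' Y (f : rhom X' Y) (h : rhom X X') :
  rho (row_rhom (rcomp f h) f : rhom (psum X X') Y) = rho f.
Proof.
have <- : rho (rsum_map 0 f : rhom (psum X X') (psum pzero Y)) = rho f.
  by rewrite rho_sum rank_to_pzero add0r.
pose t : rhom (psum X X') (psum X X') :=
  row_rhom (col_rhom (rid X) h) (rinr X X').
have tE x x' : t (x, x') = (x, h x + x').
  by rewrite row_rhomE col_rhomE ?rinlE ?rinrE ridE; congr pair; rewrite /= addr0.
apply: (rho_iso (psi := t) (phi := (rinr pzero Y : rhom Y (psum pzero Y)))).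
- apply: is_riso_bij => [[x x']|[x x']].
    by rewrite tE => -[-> h2]; move: h2; rewrite rhom_is0 add0r => ->.
  by exists (x, x' - h x); rewrite tE addrC subrK.
- apply: is_riso_bij => [x|[z x]]; first by rewrite ?rinlE ?rinrE => -[].
  by exists x; rewrite ?rinlE ?rinrE (pzeroE z).
apply: rhom_ext => -[x x']; rewrite !rcompE tE ?rinlE ?rinrE row_rhomE rsum_mapE.
by rewrite rhom0 rcompE rhom_add.
Qed.

Lemma col_absorb X Y Y' (f : rhom X Y) (h : rhom Y Y') :
  rho (col_rhom f (rcomp h f) : rhom X (psum Y Y')) = rho f.
Proof.
have <- : rho (rsum_map f 0 : rhom (psum X pzero) (psum Y Y')) = rho f.
  by rewrite rho_sum rank_from_pzero addr0.
pose t : rhom (psum Y Y') (psum Y Y') :=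
  row_rhom (col_rhom (rid Y) (- h)) (rinr Y Y').
have tE y y' : t (y, y') = (y, y' - h y).
  rewrite row_rhomE col_rhomE ?rinlE ?rinrE ridE; congr pair; rewrite /= ?addr0 //.
  by rewrite addrC rhomN.
apply: (rho_iso (psi := (rinl X pzero : rhom X (psum X pzero))) (phi := t)).
- apply: is_riso_bij => [x|[x z]]; first by rewrite ?rinlE ?rinrE => -[].
  by exists x; rewrite ?rinlE ?rinrE (pzeroE z).
- apply: is_riso_bij => [[x x']|[x x']].
    by rewrite tE => -[-> h2]; move: h2; rewrite rhom_is0 subr0 => ->.
  by exists (x, x' + h x); rewrite tE addrK.
by apply: rhom_ext => x; rewrite !rcompE col_rhomE tE ?rinlE ?rinrE rsum_mapE rcompE subrr rhom0.
Qed.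

Lemma col_absorb' X Y Y' (f : rhom X Y') (h : rhom Y' Y) :
  rho (col_rhom (rcomp h f) f : rhom X (psum Y Y')) = rho f.
Proof.
have <- : rho (rsum_map 0 f : rhom (psum pzero X) (psum Y Y')) = rho f.
  by rewrite rho_sum rank_from_pzero add0r.
pose t : rhom (psum Y Y') (psum Y Y') :=
  row_rhom (rinl Y Y') (col_rhom (- h) (rid Y')).
have tE y y' : t (y, y') = (y - h y', y').
  rewrite row_rhomE col_rhomE ?rinlE ?rinrE ridE; congr pair; rewrite /= ?add0r //.
  by rewrite rhomN.
apply: (rho_iso (psi := (rinr pzero X : rhom X (psum pzero X))) (phi := t)).
- apply: is_riso_bij => [x|[z x]]; first by rewrite ?rinlE ?rinrE => -[].
  by exists x; rewrite ?rinlE ?rinrE (pzeroE z).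
- apply: is_riso_bij => [[x x']|[x x']].
    by rewrite tE => -[h1 h2]; move: h1; rewrite h2 rhom_is0 subr0 => ->.
  by exists (x + h x', x'); rewrite tE addrK.
by apply: rhom_ext => x; rewrite !rcompE col_rhomE tE ?rinlE ?rinrE rsum_mapE rcompE subrr rhom0.
Qed.

(** By projectivity f' = f h and f = f' h', so both ranks equal the rank of the row (f, f'). *)
Lemma rank_same_image X X' Y (f : rhom X Y) (f' : rhom X' Y) :
  (forall y, (exists x, f x = y) <-> (exists x, f' x = y)) -> rho f = rho f'.
Proof.
move=> e.
have [x|h hE] := @rproj_lift _ _ _ _ _ f f' (pcarP X'); first by apply/e; exists x.
have [x|h' h'E] := @rproj_lift _ _ _ _ _ f' f (pcarP X); first by apply/e; exists x.
by rewrite -(row_absorb f h) -[RHS](row_absorb' f' h') hE h'E.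
Qed.

(** Dual to [rank_same_image]: by injectivity of projectives each map factors through the other, and
    both ranks equal that of the column (f, f'). *)
Lemma rank_same_kernel X Y Y' (f : rhom X Y) (f' : rhom X Y') :
  (forall x, f x = 0 <-> f' x = 0) -> rho f = rho f'.
Proof.
move=> e.
have ext (Z Z' : projA A) (g : rhom X Z) (g' : rhom X Z') :
    (forall x, g x = 0 -> g' x = 0) -> exists h, rcomp h g = g'.
  move=> gg'; have [I [p [m [ps mi mp]]]] := image_factor g.
  have [x px|q qE] := @factor_surj _ _ _ _ _ p g' ps.
    by apply: gg'; rewrite -mp rcompE px rhom_is0.
  have [h hE] := rproj_injective resth q (pcarP Z') mi.
  by exists h; rewrite -mp rcompA hE.
have [x /e//|h hE] := ext _ _ f f'; have [x /e//|h' h'E] := ext _ _ f' f.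
by rewrite -(col_absorb f h) -[RHS](col_absorb' f' h') hE h'E.
Qed.

Section Schanuel.
Variables (P P' Q Q' : projA A) (C : rmod A).
Variables (f : rhom P Q) (c : rhom Q C) (f' : rhom P' Q') (c' : rhom Q' C).
Variables (h : rhom Q' Q) (h' : rhom Q Q').
Hypotheses (ch : rcomp c h = c') (ch' : rcomp c' h' = c).
Hypotheses (fc : rexact f c) (fc' : rexact f' c').

(* Both maps have image the kernel of Q (+) Q' -> C. *)
Definition schanuel_l : rhom (psum P Q') (psum Q Q') :=
  row_rhom (rcomp (rinl Q Q') f) (col_rhom (- h) (rid Q')).
Definition schanuel_r : rhom (psum Q P') (psum Q Q') :=
  row_rhom (col_rhom (rid Q) (- h')) (rcomp (rinr Q Q') f').

Lemma schanuel_lE p q : schanuel_l (p, q) = (f p - h q, q).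
Proof.
rewrite row_rhomE col_rhomE rcompE ?rinlE ?rinrE ridE rhomN.
by congr pair; rewrite /= add0r.
Qed.
Lemma schanuel_rE q p : schanuel_r (q, p) = (q, f' p - h' q).
Proof.
rewrite row_rhomE col_rhomE rcompE ?rinlE ?rinrE ridE rhomN.
by congr pair; rewrite /= ?addr0 // addrC.
Qed.

Lemma schanuel_image u :
  (exists x, schanuel_l x = u) <-> (exists x, schanuel_r x = u).
Proof.
case: u => q q'; move/rexactP: fc => fcE; move/rexactP: fc' => fcE'.
transitivity (c q + c' q' = 0).
  rewrite -ch rcompE -rhom_add; split=> [[[p y]]|/fcE[p pE]].
    by rewrite schanuel_lE => -[<- <-]; rewrite subrK; apply/fcE; exists p.
  by exists (p, q'); rewrite schanuel_lE pE addrK.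
rewrite -ch' rcompE -rhom_add addrC; split=> [/fcE'[p pE]|[[y p]]].
  by exists (q, p); rewrite schanuel_rE pE addrK.
by rewrite schanuel_rE => -[<- <-]; rewrite subrK; apply/fcE'; exists p.
Qed.

Lemma rank_schanuel_l : rho schanuel_l = rho f + rho (rid Q').
Proof.
rewrite -rho_sum; pose t : rhom (psum Q Q') (psum Q Q') :=
  row_rhom (rinl Q Q') (col_rhom h (rid Q')).
have tE q q' : t (q, q') = (q + h q', q').
  by rewrite row_rhomE col_rhomE ?rinlE ?rinrE ridE; congr pair; rewrite /= add0r.
apply: (rho_iso (is_riso_id _) (phi := t)).
  apply: is_riso_bij => [[x x']|[x x']].
    by rewrite tE => -[h1 h2]; move: h1; rewrite h2 rhom_is0 addr0 => ->.
  by exists (x - h x', x'); rewrite tE subrK.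
apply: rhom_ext => -[p q]; rewrite !rcompE schanuel_lE tE ridE rsum_mapE.
by rewrite subrK ridE.
Qed.

Lemma rank_schanuel_r : rho schanuel_r = rho (rid Q) + rho f'.
Proof.
rewrite -rho_sum; pose t : rhom (psum Q Q') (psum Q Q') :=
  row_rhom (col_rhom (rid Q) h') (rinr Q Q').
have tE q q' : t (q, q') = (q, h' q + q').
  by rewrite row_rhomE col_rhomE ?rinlE ?rinrE ridE; congr pair; rewrite /= addr0.
apply: (rho_iso (is_riso_id _) (phi := t)).
  apply: is_riso_bij => [[x x']|[x x']].
    by rewrite tE => -[-> h2]; move: h2; rewrite rhom_is0 add0r => ->.
  by exists (x, x' - h' x); rewrite tE addrC subrK.
apply: rhom_ext => -[q p]; rewrite !rcompE schanuel_rE tE ridE rsum_mapE.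
by rewrite addrC subrK ridE.
Qed.
End Schanuel.

(** A shear of Q (+) Q' identifies the two maps onto the kernel of Q (+) Q' -> C with f (+) 1 and 1
    (+) f'. Equal images of c and c' are enough for the comparison maps h and h' to exist. *)
Lemma rank_schanuel P P' Q Q' (C : rmod A) (f : rhom P Q) (c : rhom Q C)
    (f' : rhom P' Q') (c' : rhom Q' C) : rexact f c -> rexact f' c' ->
  (forall z, (exists x, c x = z) <-> (exists x, c' x = z)) ->
  rho f + rho (rid Q') = rho (rid Q) + rho f'.
Proof.
move=> fc fc' e.
have [x|h hE] := @rproj_lift _ _ _ _ _ c c' (pcarP Q'); first by apply/e; exists x.
have [x|h' h'E] := @rproj_lift _ _ _ _ _ c' c (pcarP Q); first by apply/e; exists x.
rewrite -(rank_schanuel_l f h) -(rank_schanuel_r f' h').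
by apply: rank_same_image => y; apply: schanuel_image hE h'E fc fc' y.
Qed.

End RankFunctions.

(** * The sequences C (x) theta realized in proj A *)

Section ProjectiveModel.
Variables (k : fieldType) (A : falgType k).
Implicit Types M N X Y Z : rmod A.

(* Junk value 0 when M is not projective: in theta only the terms tob i with
   i <= d + 1 are known to be projective. *)
Definition pobj M : projA A :=
  if pselect (rproj M) is left pM then ProjA pM else pzero A.

Lemma pobj_iso M : {ab : rhom (pobj M) M * rhom M (pobj M) |
  rproj M -> rcomp ab.1 ab.2 = rid M /\ rcomp ab.2 ab.1 = rid (pobj M)}.
Proof.
rewrite /pobj; case: pselect => pM; last by exists (0, 0).
by exists (rid M, rid M); rewrite /= rcomp1f.
Qed.

Definition pin M : rhom (pobj M) M := (sval (pobj_iso M)).1.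
Definition pout M : rhom M (pobj M) := (sval (pobj_iso M)).2.

Lemma poutK M : rproj M -> rcomp (pin M) (pout M) = rid M.
Proof. by case/(svalP (pobj_iso M)). Qed.
Lemma pinK M : rproj M -> rcomp (pout M) (pin M) = rid (pobj M).
Proof. by case/(svalP (pobj_iso M)). Qed.

Lemma rexact_conj X Y Z (X' Y' Z' : rmod A) (f : rhom X Y) (g : rhom Y Z) (a : rhom X' X)
    (b : rhom Y Y') (b' : rhom Y' Y) (c : rhom Z Z') :
  rexact f g -> (forall x, exists x', a x' = x) ->
  rcomp b' b = rid Y -> rcomp b b' = rid Y' -> (forall z, c z = 0 -> z = 0) ->
  rexact (rcomp b (rcomp f a)) (rcomp c (rcomp g b')).
Proof.
move=> /rexactP fg sa b'b bb' ic; apply/rexactP => y.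
have bK z : b (b' z) = z by rewrite -rcompE bb' ridE.
have b'K z : b' (b z) = z by rewrite -rcompE b'b ridE.
rewrite !rcompE; split=> [/ic/fg[x xE]|[x <-]].
  by have [x' x'E] := sa x; exists x'; rewrite !rcompE x'E xE bK.
rewrite !rcompE b'K; have -> : g (f (a x)) = 0 by apply/fg; exists (a x).
exact: rhom_is0.
Qed.
End ProjectiveModel.

Section Resolve.
Variables (k : fieldType) (A : falgType k) (d : nat) (s : algaut A).
Variable th : biseq d.+1 s.
Hypothesis resth : projinj_resolution th.
Local Notation T := (twist s).
Local Notation Ti := (twist (aut_inv s)).

Section Objects.
Variable C : rmod A.
Definition robj i : projA A := pobj (tens C (tob th i)).
Definition rlast : projA A := pobj (tens C (tlast th)).
Definition rin : rhom (tens C Ti) (robj 0) :=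
  rcomp (pout _) (tens_mapr C (tin th)).
Definition rmap i : rhom (robj i) (robj i.+1) :=
  rcomp (pout _) (rcomp (tens_mapr C (tmap th i)) (pin _)).
Definition rend : rhom (robj d.+1) rlast :=
  rcomp (pout _) (rcomp (tens_mapr C (tend th)) (pin _)).
Definition rout : rhom rlast C :=
  rcomp (rcomp (tens_reg C) (tens_mapr C (tout th))) (pin _).

Let pob i : (i <= d.+1)%N -> rproj (tens C (tob th i)).
Proof. by move=> id; apply/tens_bproj_proj/(tob_bproj resth). Qed.
Let pla : rproj (tens C (tlast th)).
Proof. exact/tens_bproj_proj/(tlast_bproj resth). Qed.

Let pout_inj (M : rmod A) : rproj M -> forall z : M, pout M z = 0 -> z = 0.
Proof. by move=> /poutK e z pz; rewrite -(ridE z) -e rcompE pz rhom_is0. Qed.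
Let pin_surj (M : rmod A) : rproj M -> forall z : M, exists x, pin M x = z.
Proof. by move=> /poutK e z; exists (pout M z); rewrite -rcompE e ridE. Qed.

Let surj_id (M : rmod A) (z : M) : exists x, rid M x = z.
Proof. by exists z; rewrite ridE. Qed.

Definition rseq := @projA_seq k A d s C robj rlast rin rmap rend rout.

Lemma rseq_exact : exseq_exact rseq.
Proof.
have [/rinjP e1 e2 e3 e4 /rsurjP e5] := tens_seq_exact resth C.
split.
- apply/rinjP => x; rewrite rcompE => /(pout_inj (pob (leq0n _))); exact: e1.
- move=> i id; have p1 := pob id; have p0 := pob (ltnW id).
  have := e2 i id; case: i id p0 p1 => [|i] id p0 p1 e.
    have := rexact_conj e (@surj_id _) (poutK p0) (pinK p0) (pout_inj p1).
    by rewrite rcompf1.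
  exact: rexact_conj e (pin_surj (pob (ltnW (ltnW id)))) (poutK p0) (pinK p0) (pout_inj p1).
- exact: rexact_conj e3 (pin_surj (pob (leqnSn _))) (poutK (pob (leqnn _)))
    (pinK (pob (leqnn _))) (pout_inj pla).
- have i1 (z : C) : rid C z = 0 -> z = 0 by rewrite ridE.
  have := rexact_conj e4 (pin_surj (pob (leqnn _))) (poutK pla) (pinK pla) i1.
  by rewrite rcomp1f.
- apply/rsurjP => y; have [x <-] := e5 y; have [x' <-] := pin_surj pla x.
  by exists x'; rewrite rcompE.
Qed.

Lemma rseq_mor : exseq_mor rseq (tens_seq C th).
Proof.
exists (fun i => pin _), (pin _); split.
- by rewrite [ein rseq]/= rcompA poutK ?rcomp1f //; exact: pob.
- by move=> i id; rewrite [emap rseq i]/= rcompA poutK ?rcomp1f //; exact: pob.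
- by rewrite [eend rseq]/= rcompA poutK ?rcomp1f.
- by [].
Qed.

End Objects.

Section Functoriality.
Variables (L M N : rmod A) (f : rhom L M) (g : rhom M N).
Hypotheses (fi : forall x, f x = 0 -> x = 0) (fg : rexact f g).
Hypothesis gs : forall y, exists x, g x = y.

Lemma pobj_ses (P : bimod A) : bproj P ->
  exists (f' : rhom (pobj (tens L P)) (pobj (tens M P)))
         (g' : rhom (pobj (tens M P)) (pobj (tens N P))),
  [/\ forall x, f' x = 0 -> x = 0, rexact f' g' & forall y, exists x, g' x = y].
Proof.
move=> bP.
have pK K : rcomp (pin (tens K P)) (pout _) = rid _ by exact/poutK/tens_bproj_proj.
have qK K : rcomp (pout (tens K P)) (pin _) = rid _ by exact/pinK/tens_bproj_proj.
have oi K (z : tens K P) : pout _ z = 0 -> z = 0.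
  by move=> pz; rewrite -(ridE z) -pK rcompE pz rhom_is0.
have ii K z : pin (tens K P) z = 0 -> z = 0.
  by move=> pz; rewrite -(ridE z) -qK rcompE pz rhom_is0.
exists (rcomp (pout _) (rcomp (tens_map P f) (pin _))).
exists (rcomp (pout _) (rcomp (tens_map P g) (pin _))); split.
- by move=> x; rewrite !rcompE => /oi/(tens_bproj_inj bP fi)/ii.
- apply: rexact_conj (tens_bproj_exact bP fg) _ (pK M) (qK M) (@oi N).
  by move=> z; exists (pout _ z); rewrite -rcompE pK ridE.
move=> y; have [x xE] := tens_bproj_surj bP gs (pin _ y).
by exists (pout _ x); rewrite !rcompE -[pin _ (pout _ x)]rcompE pK ridE xE -rcompE qK ridE.
Qed.
End Functoriality.

(** * Ranks along exact sequences *)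

Variables (R : realType) (rho : morfun A R).
Hypothesis rhoP : is_rank th rho.
Implicit Types W P Q X Y Z : projA A.

(** For C the cokernel of f, (RM2) gives the relation for the last two maps between the terms of C
    (x) theta. Two rounds of Schanuel transport it to g and f: the first compares [rend C] with f as
    presentations of C, the second compares maps covering the kernels of these two presentations. *)
Theorem rank_exact W P Q (g : rhom W P) (f : rhom P Q) :
  rexact g f -> rho g + rho f = rho (rid P).
Proof.
move=> gf; have [C [c [cs fc]]] := cokernel_ex f.
have [_ e2 e3 e4 /rsurjP e5] := rseq_exact C.
have base := rank_seq_last resth (rseq_exact C) (rseq_mor C) rhoP.
have im y : (exists x, rout C x = y) <-> (exists x, c x = y).
  by split=> _; [exact: cs|exact: e5].
have [x|h hE] := @rproj_lift _ _ _ _ _ (rout C) c (pcarP Q); first exact: e5.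
have [x|h' h'E] := @rproj_lift _ _ _ _ _ c (rout C) (pcarP (rlast C)); first exact: cs.
have S1 := rank_schanuel resth rhoP e4 fc im.
have im2 := schanuel_image hE h'E e4 fc.
pose g1 : rhom (robj C d) (psum (robj C d.+1) Q) := rcomp (rinl _ _) (rmap C d).
pose g2 : rhom W (psum (rlast C) P) := rcomp (rinr _ _) g.
(* Adding an identity does not change the kernel: the extra coordinate is forced to be zero. So the
   stabilized maps, which have the same image, are the input of the second round, with Q' and Q as
   the stabilizing terms. *)
have x1 : rexact g1 (schanuel_l (rend C) h).
  move/rexactP: e3 => e3; apply/rexactP => -[p q]; rewrite schanuel_lE; split.
    by move=> [h1 q0]; move: h1; rewrite q0 rhom_is0 subr0 => /e3[z <-]; exists z;
       rewrite rcompE rinlE.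
  move=> [z]; rewrite rcompE rinlE => -[<- <-]; rewrite rhom_is0 subr0.
  by rewrite (_ : rend C _ = 0) //; apply/e3; exists z.
have x2 : rexact g2 (schanuel_r f h').
  move/rexactP: gf => gf; apply/rexactP => -[q p]; rewrite schanuel_rE; split.
    by move=> [q0 h1]; move: h1; rewrite q0 rhom_is0 subr0 => /gf[z <-]; exists z;
       rewrite rcompE rinrE.
  move=> [z]; rewrite rcompE rinrE => -[<- <-]; rewrite rhom_is0 subr0.
  by rewrite (_ : f _ = 0) //; apply/gf; exists z.
have S2 := rank_schanuel resth rhoP x1 x2 im2.
have E1 : rho g1 = rho (rmap C d).
  apply: (rank_same_kernel resth rhoP) => x; rewrite rcompE rinlE.
  by split=> [[->]|->].
have E2 : rho g2 = rho g.
  apply: (rank_same_kernel resth rhoP) => x; rewrite rcompE rinrE.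
  by split=> [[->]|->].
move: S2; rewrite E1 E2 !(rank_psum rhoP) => S2; move: base S1 S2.
lra.
Qed.

Lemma rank_ses X Y Z (f : rhom X Y) (g : rhom Y Z) :
  (forall x, f x = 0 -> x = 0) -> rexact f g -> (forall y, exists x, g x = y) ->
  rho (rid Y) = rho (rid X) + rho (rid Z).
Proof.
move=> fi fg gs; rewrite -(rank_exact fg); congr (_ + _).
  apply: (rank_same_kernel resth rhoP) => x; rewrite ridE; split=> [/fi//|->].
  exact: rhom_is0.
apply: (rank_same_image resth rhoP) => y; split=> _; last exact: gs.
by exists y; rewrite ridE.
Qed.

(** The alternating sum of the ranks of the terms up to n, the n-th one counted with sign +1. *)
Fixpoint alt_rank n (M : rmod A) : R :=
  if n is m.+1 then rho (rid (robj M m.+1)) - alt_rank m M else rho (rid (robj M 0)).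

Hypothesis d_even : ~~ odd d.

Lemma rank_euler (M : rmod A) X Y (e : rhom X M) (m : rhom M Y) :
  (forall y, exists x, e x = y) -> (forall x, m x = 0 -> x = 0) ->
  rho (rcomp m e) *+ 2 = rho (rid (rlast M)) - alt_rank d.+1 M.
Proof.
move=> es mi.
have [/rinjP e1 e2 e3 /rexactP e4 /rsurjP e5] := rseq_exact M.
have [_ _ _ _ r3] := rhoP.
pose x0 : rhom (Sigma (aut_inv s) X) (robj M 0) := rcomp (rin M) (tens_map Ti e).
have x0E : rho x0 = rho (rcomp m e).
  (* (RM3) concerns Sigma; invariance under Sigma^-1 follows because Sigma (Sigma^-1 f) is
     isomorphic to f through the counit. *)
  rewrite -[RHS](_ : rho (Sigma_map (aut_inv s) (rcomp m e)) = _); last first.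
    rewrite -r3; have [_ ri _ _ _] := rhoP.
    apply: (ri _ _ _ _ _ _ (counit s X : rhom (Sigma s (Sigma (aut_inv s) X)) X)
      (counit s Y : rhom (Sigma s (Sigma (aut_inv s) Y)) Y)); try exact: counit_riso.
    exact: counit_nat.
  apply: (rank_same_kernel resth rhoP) => x; rewrite rcompE.
  rewrite (_ : Sigma_map _ _ x = tens_map Ti m (tens_map Ti e x)); last first.
    by rewrite tens_map_comp.
  by split=> [/e1|/(tens_twist_inj mi)] ->; exact: rhom_is0.
have b0 : rho x0 + rho (rmap M 0) = rho (rid (robj M 0)).
  apply: rank_exact; have /rexactP ee := e2 0%N isT.
  apply/rexactP => y; rewrite [X in X <-> _]ee; split=> -[z <-].
    by have [w wE] := tens_twist_surj (t := aut_inv s) es z; exists w; rewrite /x0 rcompE wE.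
  by exists (tens_map Ti e z); exact/esym/rcompE.
have b1 i : (i < d)%N -> rho (rmap M i) + rho (rmap M i.+1) = rho (rid (robj M i.+1)).
  by move=> id; apply: rank_exact; exact: (e2 i.+1 id).
have b2 : rho (rmap M d) + rho (rend M) = rho (rid (robj M d.+1)) by exact: rank_exact.
have b3 : rho (rend M) + rho (rcomp m (rout M)) = rho (rid (rlast M)).
  apply: rank_exact; apply/rexactP => y; rewrite -e4 rcompE.
  by split=> [/mi|->] //; exact: rhom_is0.
have b4 : rho (rcomp m (rout M)) = rho (rcomp m e).
  apply: (rank_same_image resth rhoP) => y; split=> -[x <-].
    by have [z zE] := es (rout M x); exists z; rewrite rcompE zE; exact/esym/rcompE.
  by have [z zE] := e5 (e x); exists z; rewrite [RHS]rcompE -zE; exact: rcompE.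
(* Every exact pair along M (x) theta reverses the sign with which the rank of m e occurs. *)
have alt i : (i <= d)%N ->
    rho (rmap M i) = alt_rank i M - (-1) ^+ i * rho (rcomp m e).
  elim: i => [|i IH] id.
    by rewrite expr0 mul1r -x0E /= -b0; lra.
  have := b1 i id; rewrite (IH (ltnW id)) /= exprS; lra.
(* Since the variable d is even, the rank of m e comes back after the last two pairs with a sign
   that doubles it; with the other parity it would cancel. *)
have := alt d (leqnn d); rewrite -signr_odd (negbTE d_even) expr0 mul1r /= mulr2n.
move: b2 b3; rewrite b4; lra.
Qed.

Lemma alt_rank_ses n (L M N : rmod A) (f : rhom L M) (g : rhom M N) :
  (forall x, f x = 0 -> x = 0) -> rexact f g -> (forall y, exists x, g x = y) ->
  (n <= d.+1)%N -> alt_rank n M = alt_rank n L + alt_rank n N.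
Proof.
move=> fi fg gs.
have st i : (i <= d.+1)%N ->
    rho (rid (robj M i)) = rho (rid (robj L i)) + rho (rid (robj N i)).
  move=> id; have [f' [g' [h1 h2 h3]]] := pobj_ses fi fg gs (tob_bproj resth id).
  exact: rank_ses h1 h2 h3.
elim: n => [|n IH] nd; first exact: st.
by rewrite /= IH ?(ltnW nd) // st // opprD addrACA.
Qed.

(** This is additivity on 0 -> Im(f j) -> Im f -> Im g -> 0, stated without functors. On the module
    side the images M of f and N of g and the kernel L of M -> N form a short exact sequence with L
    the image of f j, and the right side of [rank_euler] is additive on it. *)
Theorem rank_additive X Y Y' (K : projA A) (f : rhom X Y) (g : rhom X Y') (j : rhom K X) :
  (forall x, f x = 0 -> g x = 0) -> rexact j g ->
  rho f = rho (rcomp f j) + rho g.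
Proof.
move=> fg /rexactP jg.
have [M [e [m [es mi fE]]]] := image_factor f.
have [N [e' [m' [es' mi' gE]]]] := image_factor g.
have [x ex|h hE] := @factor_surj _ _ _ _ _ e e' es.
  by apply: mi'; rewrite -rcompE gE fg // -fE rcompE ex rhom_is0.
have hs y : exists x, h x = y.
  by have [x <-] := es' y; exists (e x); rewrite -rcompE hE.
have [L [l [li lh]]] := kernel_ex h; have /rexactP lhE := lh.
have gj z : g (j z) = 0 by apply/jg; exists z.
have [x|q qE] := @factor_inj _ _ _ _ _ l (rcomp e j) li.
  by apply/lhE; rewrite rcompE -rcompE hE; apply: mi'; rewrite -rcompE gE gj.
have qs y : exists x, q x = y.
  have [x xE] := es (l y).
  have /jg[z zE] : g x = 0.
    by rewrite -gE rcompE -hE rcompE xE (_ : h (l y) = 0) ?rhom_is0 //; apply/lhE; exists y.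
  exists z; apply/eqP; rewrite -subr_eq0; apply/eqP/li.
  by rewrite rhom_sub -rcompE qE rcompE zE xE subrr.
have mli x : rcomp m l x = 0 -> x = 0 by rewrite rcompE => /mi/li.
have E1 := rank_euler es mi; have E2 := rank_euler es' mi'.
have := rank_euler qs mli; rewrite -rcompA qE rcompA fE => E3.
rewrite fE in E1; rewrite gE in E2.
have a1 := alt_rank_ses li lh hs (leqnn _).
have [f' [g' [h1 h2 h3]]] := pobj_ses li lh hs (tlast_bproj resth).
have a2 : rho (rid (rlast M)) = rho (rid (rlast L)) + rho (rid (rlast N)).
  exact: rank_ses h1 h2 h3.
move: E1 E2 E3; rewrite a1 a2 !mulr2n; lra.
Qed.

End Resolve.

(** * Functors on proj A *)

Section FunctorLemmas.
Variables (k : fieldType) (A : falgType k).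
Implicit Types (P X Y Z W : projA A) (F G H : ftr A).

Lemma fiso_sym F G : fiso F G -> fiso G F.
Proof. by move=> [a [b [h1 h2]]]; exists b, a. Qed.

Section Comp.
Variables (F G H : ftr A) (b : ntr G H) (a : ntr F G).
Lemma ntr_comp_additive X : zmod_morphism (fun u : F X => b X (a X u)).
Proof. by move=> u v; rewrite !raddfB. Qed.
Lemma ntr_comp_nat X Y (f : rhom X Y) (u : F Y) :
  mk_additive (@ntr_comp_additive X) (fmor F f u) =
  fmor H f (mk_additive (@ntr_comp_additive Y) u).
Proof. by rewrite /= !ntr_nat. Qed.
Definition ntr_comp : ntr F H := Ntr ntr_comp_nat.
Lemma ntr_compE X u : ntr_comp X u = b X (a X u). Proof. by []. Qed.
End Comp.

Lemma fiso_trans F G H : fiso F G -> fiso G H -> fiso F H.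
Proof.
move=> [a [b [h1 h2]]] [a' [b' [h1' h2']]]; exists (ntr_comp a' a), (ntr_comp b b').
by split=> X u; rewrite !ntr_compE ?h1' ?h1 ?h2 ?h2'.
Qed.

Lemma ntr_factor_surj G F F' (p : ntr G F) (p' : ntr G F') : ntr_surj p ->
  (forall X v, p X v = 0 -> p' X v = 0) ->
  exists a : ntr F F', forall X v, a X (p X v) = p' X v.
Proof.
move=> ps pp'; pose h X (u : F X) := p' X (sval (cid (ps X u))).
have hp X v : h X (p X v) = p' X v.
  rewrite /h; case: cid => w /= pw; apply/eqP; rewrite -subr_eq0 -raddfB.
  by apply/eqP/pp'; rewrite raddfB pw subrr.
have hA X : zmod_morphism (h X).
  by move=> u v; have [x <-] := ps X u; have [y <-] := ps X v; rewrite -raddfB !hp raddfB.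
have hN X Y (f : rhom X Y) (u : F Y) :
    mk_additive (hA X) (fmor F f u) = fmor F' f (mk_additive (hA Y) u).
  by have [x <-] := ps Y u; rewrite /= -ntr_nat !hp ntr_nat.
by exists (@Ntr _ _ F F' (fun X => mk_additive (hA X)) hN).
Qed.

Lemma fiso_same_kernel G F F' (p : ntr G F) (p' : ntr G F') :
  ntr_surj p -> ntr_surj p' -> (forall X v, p X v = 0 <-> p' X v = 0) -> fiso F F'.
Proof.
move=> ps ps' e.
have [X v /e//|a aE] := @ntr_factor_surj _ _ _ p p' ps.
have [X v /e//|b bE] := @ntr_factor_surj _ _ _ p' p ps'.
exists a, b; split=> X u.
  by have [v <-] := ps X u; rewrite aE bE.
by have [v <-] := ps' X u; rewrite bE aE.
Qed.

Lemma ntr_factor_inj G F F' (i : ntr F F') (q : ntr G F') : ntr_inj i ->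
  (forall X v, exists u, i X u = q X v) ->
  exists a : ntr G F, forall X v, i X (a X v) = q X v.
Proof.
move=> ii iq; pose h X (u : G X) := sval (cid (iq X u)).
have hE X v : i X (h X v) = q X v by rewrite /h; case: cid.
have hA X : zmod_morphism (h X).
  by move=> u v; apply: (ii X); rewrite hE !raddfB !hE.
have hN X Y (f : rhom X Y) (u : G Y) :
    mk_additive (hA X) (fmor G f u) = fmor F f (mk_additive (hA Y) u).
  by apply: (ii X); rewrite /= hE !ntr_nat hE.
by exists (@Ntr _ _ G F (fun X => mk_additive (hA X)) hN).
Qed.

Section Im.
Variables (X Y : projA A) (f : rhom X Y).
Lemma toim_proof Z (u : yo X Z) : `[< exists v, yo_map f Z v = yo_map f Z u >].
Proof. by apply/asboolP; exists u. Qed.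
Lemma toim_additive Z :
  zmod_morphism (fun u : yo X Z => ImT (toim_proof u) : imC f Z).
Proof. by move=> u v; apply: val_inj; exact: (raddfB (yo_map f Z)). Qed.
Lemma toim_nat Z W (g : rhom Z W) (u : yo X W) :
  mk_additive (@toim_additive Z) (fmor (yo X) g u) =
  fmor (imC f) g (mk_additive (@toim_additive W) u).
Proof. by apply: val_inj; rewrite /= yo_comp. Qed.
Definition toim : ntr (yo X) (imC f) := Ntr toim_nat.
Lemma toimE Z u : im_val (toim Z u) = rcomp f u.
Proof. by []. Qed.
Lemma toim_eq0 Z u : toim Z u = 0 <-> rcomp f u = 0.
Proof. by split=> [/(congr1 (@im_val _ _ _))|fu] //; apply: val_inj. Qed.
Lemma toim_surj : ntr_surj toim.
Proof.
by move=> Z [v vP]; have /asboolP[u uE] := vP; exists u; apply: val_inj.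
Qed.
Lemma toim_yoneda Z (u : rhom Z X) : toim Z u = fmor (imC f) u (toim X (rid X)).
Proof. by rewrite -ntr_nat /= rcomp1f. Qed.
End Im.

Lemma imC_fiso (F : ftr A) X Y (f : rhom X Y) (p : ntr (yo X) F) : ntr_surj p ->
  (forall Z (u : rhom Z X), p Z u = 0 <-> rcomp f u = 0) -> fiso F (imC f).
Proof.
move=> ps e; apply: (fiso_same_kernel ps (@toim_surj _ _ f)) => Z u.
by rewrite e toim_eq0.
Qed.

Lemma imC_map X Y X' Y' (f : rhom X Y) (f' : rhom X' Y') (h : rhom Y Y') :
  (forall Z (u : rhom Z X), exists v, rcomp f' v = rcomp h (rcomp f u)) ->
  exists a : ntr (imC f) (imC f'),
    forall Z (w : imC f Z), im_val (a Z w) = rcomp h (im_val w).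
Proof.
move=> hf.
have aP Z (w : imC f Z) : `[< exists v, yo_map f' Z v = rcomp h (im_val w) >].
  by case: w => w /= /asboolP[u <-]; apply/asboolP; exact: hf.
have aA Z : zmod_morphism (fun w : imC f Z => ImT (aP Z w) : imC f' Z).
  by move=> u v; apply: val_inj; exact: (raddfB (yo_map h Z)).
have aN Z W (g : rhom Z W) (w : imC f W) :
    mk_additive (aA Z) (fmor (imC f) g w) = fmor (imC f') g (mk_additive (aA W) w).
  by apply: val_inj; rewrite /= yo_comp.
by exists (@Ntr _ _ (imC f) (imC f') (fun Z => mk_additive (aA Z)) aN).
Qed.

Lemma im_valP X Y (f : rhom X Y) Z (w : imC f Z) : exists u, rcomp f u = im_val w.
Proof. by case: w => w wP; have /asboolP[u uE] := wP; exists u. Qed.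

Lemma im_val0 X Y (f : rhom X Y) Z (w : imC f Z) : im_val w = 0 -> w = 0.
Proof. by move=> h; apply: val_inj. Qed.

Lemma imC_iso X Y X' Y' (f : rhom X Y) (g : rhom X' Y')
    (psi : rhom X X') (phi : rhom Y Y') : is_riso psi -> is_riso phi ->
  rcomp phi f = rcomp g psi -> fiso (imC f) (imC g).
Proof.
move=> [psi' [p1 p2]] [phi' [q1 q2]] e.
have [|a aE] := @imC_map _ _ _ _ f g phi.
  by move=> Z u; exists (rcomp psi u); rewrite !rcompA e.
have [|b bE] := @imC_map _ _ _ _ g f phi'.
  move=> Z u; exists (rcomp psi' u).
  by rewrite -[u in RHS]rcomp1f -p2 -(rcompA psi) (rcompA g) -e !rcompA q1 rcomp1f.
exists a, b; split=> Z w; apply: val_inj.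
  by rewrite /= bE aE rcompA q1 rcomp1f.
by rewrite /= aE bE rcompA q2 rcomp1f.
Qed.

Lemma imC_exact X Y Z (f : rhom X Y) (g : rhom Y Z) : rexact f g ->
  exists (i : ntr (imC f) (imC (rid Y))) (p : ntr (imC (rid Y)) (imC g)),
    [/\ ntr_inj i, ntr_exact i p & ntr_surj p].
Proof.
move=> /rexactP fg.
have [|i iE] := @imC_map _ _ _ _ f (rid Y) (rid Y).
  by move=> W u; exists (rcomp f u).
have [|p pE] := @imC_map _ _ _ _ (rid Y) g g.
  by move=> W u; exists u; rewrite rcomp1f.
exists i, p; split=> W.
- by move=> u v /(congr1 (@im_val _ _ _)); rewrite !iE !rcomp1f => /val_inj.
- move=> v; split=> [/(congr1 (@im_val _ _ _))|[u <-]].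
    rewrite pE => gv.
    have [x|u uE] := @rproj_lift _ _ _ _ _ f (im_val v) (pcarP W).
      by apply/fg; rewrite -rcompE gv rhom0.
    by exists (toim f W u); apply: val_inj; rewrite /= iE toimE uE rcomp1f.
  apply: im_val0; rewrite pE iE rcomp1f; have [w <-] := im_valP u.
  apply: rhom_ext => x; rewrite !rcompE rhom0; apply/fg; by exists (w x).
- move=> w; have [u uE] := im_valP w; exists (toim (rid Y) W u).
  by apply: val_inj; rewrite /= pE toimE rcomp1f.
Qed.

Lemma imC_sum X Y X' Y' (f : rhom X Y) (g : rhom X' Y') :
  let fg : rhom (psum X X') (psum Y Y') := rsum_map f g in
  exists (i : ntr (imC f) (imC fg)) (p : ntr (imC fg) (imC g)),
    [/\ ntr_inj i, ntr_exact i p & ntr_surj p].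
Proof.
move=> fg.
have [|i iE] := @imC_map _ _ _ _ f fg (rinl Y Y').
  move=> W u; exists (rcomp (rinl X X') u); apply: rhom_ext => x.
  by rewrite !rcompE rsum_mapE !rinlE rhom_is0.
pose sn : rhom (psum Y Y') Y' := row_rhom 0 (rid Y').
have snE y : sn y = y.2 by rewrite [LHS]row_rhomE rhom0 add0r ridE.
have [|p pE] := @imC_map _ _ _ _ fg g sn.
  move=> W u; exists (rcomp (row_rhom 0 (rid X')) u); apply: rhom_ext => x.
  by rewrite !rcompE snE rsum_mapE row_rhomE rhom0 add0r ridE.
exists i, p; split=> W.
- move=> u v /(congr1 (@im_val _ _ _)); rewrite !iE => e; apply: val_inj.
  by apply: rhom_ext => x; have := rhom_eq x e; rewrite !rcompE !rinlE => -[].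
- move=> v; split=> [/(congr1 (@im_val _ _ _))|[u <-]].
    rewrite pE => gv; have [u uE] := im_valP v.
    exists (toim f W (rcomp (row_rhom (rid X) 0) u)).
    apply: val_inj; rewrite /= iE toimE -uE; apply: rhom_ext => x.
    have gx : g (u x).2 = 0.
      by have := rhom_eq x gv; rewrite -uE !rcompE snE rsum_mapE rhom0.
    by rewrite !rcompE rinlE row_rhomE rhom0 addr0 ridE rsum_mapE gx.
  apply: im_val0; rewrite pE iE; apply: rhom_ext => x.
  by rewrite !rcompE rinlE snE rhom0.
- move=> w; have [u uE] := im_valP w; exists (toim fg W (rcomp (rinr X X') u)).
  apply: val_inj; rewrite /= pE toimE -uE; apply: rhom_ext => x.
  by rewrite !rcompE snE rsum_mapE rinrE.
Qed.

Lemma adj_eq0 (t : algaut A) P X (h : rhom P (Sigma (aut_inv t) X)) :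
  adj h = 0 <-> h = 0.
Proof.
split=> [h0|->].
  rewrite -(adjK h) h0; apply: rhom_ext => p.
  by rewrite adjVE rhom0 (lin0 (pure_lin1 _)) rhom0.
by have := adjB (0 : rhom P (Sigma (aut_inv t) X)) 0; rewrite !subrr.
Qed.

Lemma imC_shift (t : algaut A) X Y (f : rhom X Y) :
  fiso (SS t (imC f)) (imC (Sigma_map t f : rhom (Sigma t X) (Sigma t Y))).
Proof.
(* In constructor form [aut_inv (aut_inv t)] is convertible to [t], so [adj] for [aut_inv t] relates
   maps Z -> Sigma X to maps Sigma^-1 Z -> X. *)
case: t => a aV aK aVK; set t := AlgAut aK aVK.
pose F := shiftF (aut_inv t) (imC f).
have pA Z : zmod_morphism (fun h : yo (Sigma t X) Z =>
    toim f (Sigma (aut_inv t) Z) (adj (t := aut_inv t) h) : F Z).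
  by move=> h h'; rewrite (adjB (t := aut_inv t) h h') raddfB.
have pN Z W (g : rhom Z W) (h : yo (Sigma t X) W) :
    mk_additive (pA Z) (fmor (yo (Sigma t X)) g h) = fmor F g (mk_additive (pA W) h).
  rewrite /= (adj_natl (t := aut_inv t)).
  exact: (ntr_nat (toim f) (Sigma_map (aut_inv t) g) (adj (t := aut_inv t) h)).
pose p : ntr (yo (Sigma t X)) F := @Ntr _ _ _ F (fun Z => mk_additive (pA Z)) pN.
apply: (@imC_fiso _ _ _ _ p) => [Z v|Z u].
  have [u <-] := toim_surj v; exists (adjV (t := aut_inv t) u).
  by congr (toim f _ _); exact: (adjVK (t := aut_inv t)).
rewrite toim_eq0; have := adj_natr (t := aut_inv t) f u => <-.
exact: (adj_eq0 (t := aut_inv t) (rcomp (Sigma_map t f) u)).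
Qed.

(** An element of X is a map from A to X, so kernels can be tested by maps out of projectives. This
    is the passage from statements about functors on proj A back to modules. *)
Lemma point_rhom (X : rmod A) (x : X) : exists (P : projA A) (u : rhom P X) (e : P),
  u e = x /\ forall (Y : rmod A) (f : rhom X Y), f x = 0 -> rcomp f u = 0.
Proof.
pose u : rhom (rfree A 1) X := free_map (fun=> x).
have uE z : u z = ract x ((z : {ffun 'I_1 -> A}) ord0) by rewrite mk_rhomE big_ord1.
exists (ProjA (@rfree_proj k A 1)), u, (free_gen A ord0); split.
  by rewrite uE ffunE eqxx ract1.
by move=> Y f fx; apply: rhom_ext => z; rewrite rcompE uE rhom_act fx ract0l rhom0.
Qed.

Lemma rhom_vanish X (Y Y' : rmod A) (f : rhom X Y) (g : rhom X Y') :
  (forall Z (u : rhom Z X), rcomp f u = 0 -> rcomp g u = 0) ->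
  forall x, f x = 0 -> g x = 0.
Proof.
move=> fg x; have [P [u [e [<- uP]]]] := point_rhom x => fx.
by rewrite -rcompE (fg _ _ (uP _ f fx)) rhom0.
Qed.

End FunctorLemmas.

(** * The correspondence *)

Section Correspondence.
Variables (k : fieldType) (A : falgType k) (d : nat) (s : algaut A).
Variable th : biseq d.+1 s.
Hypothesis resth : projinj_resolution th.
Variable R : realType.
Implicit Types (P X Y Z W : projA A) (M N : modC A).

(** If M is the cokernel of Hom(-,f) with f : X -> Y, embed the cokernel of f into a projective J.
    The kernel of Hom(-,Y) -> Hom(-,J) is then the image of Hom(-,f), by projectivity of the
    argument. *)
Lemma modC_imC M : exists X Y (f : rhom X Y), fiso M (imC f).
Proof.
have [X [Y [q [p [qp ps]]]]] := mfunP M.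
pose f : rhom X Y := q X (rid X).
have qE Z (u : rhom Z X) : q Z u = rcomp f u.
  by have := ntr_nat q u (rid X); rewrite /= rcomp1f.
have [C [c [cs /rexactP fc]]] := cokernel_ex f.
have [J [j [pJ ji]]] := rproj_embed resth C.
exists Y, (ProjA pJ), (rcomp j c); apply: (imC_fiso ps) => Z v.
rewrite (qp Z v); split=> [[u <-]|h].
  rewrite qE; apply: rhom_ext => z; rewrite !rcompE rhom0.
  by rewrite (_ : c (f (u z)) = 0) ?rhom_is0 //; apply/fc; exists (u z).
have [x|u uE] := @rproj_lift _ _ _ _ _ f v (pcarP Z); last by exists u; rewrite qE.
by apply/fc/ji; have := rhom_eq x h; rewrite !rcompE rhom0.
Qed.

(** Embed N into a representable functor by [modC_imC]; the composite from Hom(-,X) is Hom(-,f) by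
    Yoneda. *)
Lemma modC_presentation N X (b : ntr (yo X) N) : exists Y (f : rhom X Y),
  forall Z (u : rhom Z X), b Z u = 0 <-> rcomp f u = 0.
Proof.
have [X1 [Y1 [n [a [a' [aK _]]]]]] := modC_imC N.
have bE Z (u : rhom Z X) : b Z u = fmor N u (b X (rid X)).
  by rewrite -ntr_nat /= rcomp1f.
exists Y1, (im_val (a X (b X (rid X)))) => Z u; rewrite bE.
rewrite -[X in _ <-> X = 0]/(im_val (fmor (imC n) u (a X (b X (rid X))))) -(ntr_nat a).
split=> [->|/im_val0 h]; first by rewrite raddf0.
by rewrite -(aK _ (fmor N u _)) h raddf0.
Qed.

Lemma additive_is_rank (al : modC A -> R) : is_additive al -> S_invariant s al ->
  is_rank th (fun X Y (f : rhom X Y) => al (imC f)).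
Proof.
move=> [a0 aiso ases] aS.
have aex X Y Z (f : rhom X Y) (g : rhom Y Z) : rexact f g ->
    al (imC f) - al (imC (rid Y)) + al (imC g) = 0.
  move=> /imC_exact[i [p [h1 h2 h3]]].
  by rewrite (ases _ _ _ i p h1 h2 h3) opprD addrA subrr add0r addNr.
split.
- by move=> X Y f; exact: a0.
- by move=> X Y X' Y' f g psi phi h1 h2 e; apply/aiso/(imC_iso h1 h2 e).
- move=> X Y X' Y' f g; have [i [p [h1 h2 h3]]] := imC_sum f g.
  exact: ases h1 h2 h3.
- by move=> X x xl [[h1 h2 _] _]; split=> [i id|]; apply: aex => //; exact: h1.
- by move=> X Y f; rewrite -(aS (imC f)); apply/esym/aiso/imC_shift.
Qed.

Section RankToAdditive.
Variables (rho : morfun A R).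
Hypothesis rhoP : is_rank th rho.

(** By Yoneda the isomorphism and its inverse lift to l : X -> X' and l' : X' -> X. Then g l has the
    kernel of f and, because g l l' = g, the image of g. *)
Lemma rank_fiso X Y X' Y' (f : rhom X Y) (g : rhom X' Y') :
  fiso (imC f) (imC g) -> rho f = rho g.
Proof.
move=> [a [b [ba ab]]].
have [l lE] := toim_surj (a X (toim f X (rid X))).
have aE Z (u : rhom Z X) : a Z (toim f Z u) = toim g Z (rcomp l u).
  rewrite (toim_yoneda f) ntr_nat -lE -ntr_nat; congr (toim g Z _).
have [l' l'E] := toim_surj (b X' (toim g X' (rid X'))).
have gE : rcomp (rcomp g l) l' = g.
  rewrite -rcompA -(toimE g) -aE l'E ab toimE; exact: rcompf1.
have ker Z (u : rhom Z X) : rcomp f u = 0 <-> rcomp (rcomp g l) u = 0.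
  rewrite -rcompA -(toim_eq0 f) -(toim_eq0 g) -aE.
  split=> [->|h]; first by rewrite raddf0.
  by rewrite -(ba Z (toim f Z u)) h raddf0.
transitivity (rho (rcomp g l)).
  apply: (rank_same_kernel resth rhoP) => x.
  by split; apply: rhom_vanish x => Z u /ker.
apply: (rank_same_image resth rhoP) => y; split=> -[x <-].
  by exists (l x); rewrite rcompE.
by exists (l' x); rewrite -[in RHS]gE [RHS]rcompE.
Qed.

Definition rank_value (M : modC A) : R :=
  let (X, h) := cid (modC_imC M) in let (Y, h') := cid h in
  let (f, _) := cid h' in rho f.

Lemma rank_valueE M X Y (f : rhom X Y) : fiso M (imC f) -> rank_value M = rho f.
Proof.
move=> Mf; rewrite /rank_value; case: cid => X0 h; case: cid => Y0 h'.
case: cid => f0 Mf0; apply: rank_fiso.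
exact: fiso_trans (fiso_sym Mf0) Mf.
Qed.

Hypothesis d_even : ~~ odd d.

(** All three functors are presented on one cover: M is Im f for some f : X -> Y, the quotient N is
    Im g for a map g out of the same X, and a weak kernel j of g gives L as Im(f j). This is the
    situation of [rank_additive]. *)
Lemma rank_value_additive : is_additive rank_value.
Proof.
split.
- move=> M; have [X [Y [f Mf]]] := modC_imC M; rewrite (rank_valueE Mf).
  by have [] := rhoP.
- move=> M N MN; have [X [Y [f Nf]]] := modC_imC N.
  by rewrite (rank_valueE Nf) (rank_valueE (fiso_trans MN Nf)).
move=> L M N i p ii ip ps.
have [X [Y [f [a [b [ba ab]]]]]] := modC_imC M.
pose q := ntr_comp b (toim f).
have qs : ntr_surj q.
  move=> Z m; have [u uE] := toim_surj (a Z m).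
  by exists u; rewrite ntr_compE uE ba.
have qf Z (u : rhom Z X) : q Z u = 0 <-> rcomp f u = 0.
  rewrite -(toim_eq0 f) ntr_compE; split=> [h|->]; last by rewrite raddf0.
  by rewrite -(ab Z (toim f Z u)) h raddf0.
have pqs : ntr_surj (ntr_comp p q).
  by move=> Z n; have [m <-] := ps Z n; have [u <-] := qs Z m; exists u.
have [Y' [g pqg]] := modC_presentation (ntr_comp p q).
have [K [j jP]] := weak_kernel g.
have jq Z (u : rhom Z K) : exists l, i Z l = ntr_comp q (yo_map j) Z u.
  by apply/(ip Z _)/(pqg Z _)/jP; exists u.
have [r rE] := @ntr_factor_inj _ _ (yo K) L M i (ntr_comp q (yo_map j)) ii jq.
have rs : ntr_surj r.
  move=> Z l; have [v vE] := qs Z (i Z l).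
  have /jP[u uE] : rcomp g v = 0.
    by apply/(pqg Z v); rewrite ntr_compE vE; apply/(ip Z _); exists l.
  by exists u; apply: (ii Z); rewrite rE ntr_compE -vE -uE.
have rk Z (u : rhom Z K) : r Z u = 0 <-> rcomp (rcomp f j) u = 0.
  rewrite -rcompA -qf; split=> [h|h]; first by have := rE Z u; rewrite h raddf0.
  by apply: (ii Z); rewrite raddf0 rE.
rewrite (rank_valueE (imC_fiso qs qf)) (rank_valueE (imC_fiso pqs pqg)).
rewrite (rank_valueE (imC_fiso rs rk)).
apply: (rank_additive resth rhoP d_even).
  apply: rhom_vanish => Z u fu; apply/(pqg Z u).
  by rewrite ntr_compE (_ : q Z u = 0) ?raddf0 //; apply/qf.
have gj : rcomp g j = 0 by apply/(jP K j); exists (rid K); exact: rcompf1.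
apply/rexactP => x; split=> [|[z <-]]; last by rewrite -rcompE gj rhom0.
have [P [u [e [<- uP]]]] := point_rhom x => gx.
have /jP[l <-] := uP _ g gx.
by exists (l e); rewrite rcompE.
Qed.

Lemma rank_value_invariant : S_invariant s rank_value.
Proof.
move=> M; have [X [Y [f Mf]]] := modC_imC M.
have SMf : fiso (SS s M) (SS s (imC f)).
  have [a [b [ba ab]]] := Mf.
  have cnat (F G : ftr A) (c : ntr F G) X1 Y1 (g : rhom X1 Y1)
      (u : shiftF (aut_inv s) F Y1) :
    c (Sigma (aut_inv s) X1) (fmor (shiftF (aut_inv s) F) g u) =
    fmor (shiftF (aut_inv s) G) g (c (Sigma (aut_inv s) Y1) u) by exact: ntr_nat.
  exists (@Ntr _ _ (SS s M) (SS s (imC f)) (fun Z => a (Sigma (aut_inv s) Z)) (@cnat _ _ a)).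
  exists (@Ntr _ _ (SS s (imC f)) (SS s M) (fun Z => b (Sigma (aut_inv s) Z)) (@cnat _ _ b)).
  by split=> Z u; [exact: ba|exact: ab].
rewrite (rank_valueE Mf) (rank_valueE (fiso_trans SMf (imC_shift s f))).
by have [_ _ _ _ r3] := rhoP; exact: r3.
Qed.
End RankToAdditive.

End Correspondence.

Theorem theoremB (R : realType) (d : nat) (k : fieldType) (A : falgType k)
    (sigma : algaut A) (theta : biseq d sigma) :
  odd d ->
  basic A ->
  twisted_periodic d sigma ->
  projinj_resolution theta ->
  exists (phi : Sadd R sigma -> rankf R theta)
         (psi : rankf R theta -> Sadd R sigma),
    (forall (alpha : Sadd R sigma) (X Y : projA A) (f : rhom X Y),
        sval (phi alpha) X Y f = sval alpha (imC f)) /\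
    (forall M : modC A, exists (X Y : projA A) (f : rhom X Y),
        fiso M (imC f)) /\
    (forall (rho : rankf R theta) (M : modC A) (X Y : projA A) (f : rhom X Y),
        fiso M (imC f) -> sval (psi rho) M = sval rho X Y f) /\
    cancel phi psi /\
    cancel psi phi /\
    (forall alpha : Sadd R sigma,
        add_integral (sval alpha) -> rank_integral (sval (phi alpha))) /\
    (forall rho : rankf R theta,
        rank_integral (sval rho) -> add_integral (sval (psi rho))) /\
    (forall alpha : Sadd R sigma,
        S_irreducible sigma (sval alpha) ->
        rank_irreducible theta (sval (phi alpha))) /\
    (forall rho : rankf R theta,
        rank_irreducible theta (sval rho) ->
        S_irreducible sigma (sval (psi rho))).
Proof.
case: d theta => [|d] th // d_odd _ _ resth; rewrite /= in d_odd.
have psiE (rho : morfun A R) (rhoP : is_rank th rho) (M : modC A) (X Y : projA A) (f : rhom X Y) :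
    fiso M (imC f) -> rank_value resth rho M = rho X Y f.
  exact: (rank_valueE resth rhoP).
have psi_im (rho : morfun A R) (rhoP : is_rank th rho) (X Y : projA A) (f : rhom X Y) :
    rank_value resth rho (imC f) = rho X Y f.
  apply: (psiE _ rhoP); apply: (imC_iso (is_riso_id X) (is_riso_id Y)).
  by rewrite rcomp1f rcompf1.
have phiE (al : modC A -> R) (M : modC A) (X Y : projA A) (f : rhom X Y) :
    is_additive al -> fiso M (imC f) -> al M = al (imC f).
  by move=> [_ aiso _]; exact: aiso.
have ex M := modC_imC resth M.
pose phi (al : Sadd R sigma) : rankf R th :=
  exist _ _ (additive_is_rank th (svalP al).1 (svalP al).2).
pose psi (rho : rankf R th) : Sadd R sigma :=
  exist _ _ (conj (rank_value_additive resth (svalP rho) d_odd)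
                  (rank_value_invariant resth (svalP rho))).
exists phi, psi; split; [by []|split; [exact: ex|split]].
  by move=> rho M X Y f; exact: (psiE _ (svalP rho)).
split.
  move=> [al alP]; apply: eq_exist; apply: funext => M /=.
  have [X [Y [f Mf]]] := ex M.
  by rewrite (psiE _ (additive_is_rank th alP.1 alP.2) _ _ _ _ Mf) (phiE _ _ _ _ _ alP.1 Mf).
split.
  move=> [rho rP]; apply: eq_exist; apply: functional_extensionality_dep => X.
  apply: functional_extensionality_dep => Y.
  by apply: functional_extensionality_dep => f; exact: (psi_im _ rP).
(* Integrality needs no division by 2: every value of one function is literally a value of the
   other. *)
split; first by move=> al ai X Y f; exact: ai.
split.
  move=> rho ri M; have [X [Y [f Mf]]] := ex M.
  by rewrite [sval _ M](psiE _ (svalP rho) _ _ _ _ Mf); exact: ri.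
split=> [al [a1 _ a3 a4 a5]|rho [r1 r2 r3 r4]].
  split=> [| |X Y f|rho1 rho2 r1 i1 r2 i2 e].
  - exact: svalP (phi al).
  - move=> z; apply: a3 => M; have [X [Y [f Mf]]] := ex M.
    by rewrite (phiE _ _ _ _ _ a1 Mf); exact: z.
  - exact: a4.
  (* A decomposition of the rank function is carried to one of alpha summand by summand; the sums
     agree because every functor is an image. *)
  have int (rho : morfun A R) : is_rank th rho -> rank_integral rho ->
      add_integral (rank_value resth rho).
    move=> r ri M; have [X [Y [f Mf]]] := ex M.
    by rewrite (psiE _ r _ _ _ _ Mf); exact: ri.
  have := a5 (rank_value resth rho1) (rank_value resth rho2)
    (rank_value_additive resth r1 d_odd) (rank_value_invariant resth r1) (int _ r1 i1)
    (rank_value_additive resth r2 d_odd) (rank_value_invariant resth r2) (int _ r2 i2).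
  case.
  - move=> M; have [X [Y [f Mf]]] := ex M.
    rewrite (psiE _ r1 _ _ _ _ Mf) (psiE _ r2 _ _ _ _ Mf) (phiE _ _ _ _ _ a1 Mf).
    exact: e.
  - by move=> z; left=> X Y f; rewrite -(psi_im _ r1) z.
  - by move=> z; right=> X Y f; rewrite -(psi_im _ r2) z.
have rP := svalP rho.
split=> [| | |M|al1 al2 a1 s1 i1 a2 s2 i2 e].
- exact: (svalP (psi rho)).1.
- exact: (svalP (psi rho)).2.
- by move=> z; apply: r2 => X Y f; rewrite -(psi_im _ rP); exact: z.
- by have [X [Y [f Mf]]] := ex M; rewrite [sval _ M](psiE _ rP _ _ _ _ Mf); exact: r3.
have := r4 _ _ (additive_is_rank th a1 s1) (fun X Y f => i1 (imC f))
  (additive_is_rank th a2 s2) (fun X Y f => i2 (imC f)).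
case.
- by move=> X Y f; rewrite -(psi_im _ rP) -[LHS]/(sval (psi rho) (imC f)) e.
- move=> z; left=> M; have [X [Y [f Mf]]] := ex M.
  by rewrite (phiE _ _ _ _ _ a1 Mf); exact: z.
- move=> z; right=> M; have [X [Y [f Mf]]] := ex M.
  by rewrite (phiE _ _ _ _ _ a2 Mf); exact: z.
Qed.
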